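(* Let $(S,0)$ be a complex analytic germ and let $\varphi_S:\mathcal O_{S,0}\{x_1,\dots,x_n\}\to\mathcal O_{S,0}\{t_1\}\oplus\dots\oplus\mathcal O_{S,0}\{t_r\}$ be an analytic $\mathcal O_{S,0}$-algebra morphism whose $j$-th component sends each $x_i$ into $t_j\mathcal O_{S,0}\{t_j\}$. Assume that $\varphi_0$ is a primitive parameterization of the reduced curve singularity $(C_0,0)$ with $r$ branches. Then, for $s$ in a sufficiently small neighbourhood of $0\in S$, $(C_s,0)$ is a reduced curve singularity with $r$ branches satisfying $$\dim_{\mathbb C}\Big(\big(\mathbb C\{t_1\}\oplus\dots\oplus\mathbb C\{t_r\}\big)/\mathbb C\{\varphi_s(x_1),\dots,\varphi_s(x_n)\}\Big)=\delta_{\mathbb C}(\mathcal O_{C_s,0})<\infty$$ and $\delta_{\mathbb C}(\mathcal O_{C_s,0})\le\delta_{\mathbb C}(\mathcal O_{C_0,0})$.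
   Context: $\mathcal O_{S,0}\{x_1,\dots,x_n\}$ denotes the ring of convergent power series over $\mathcal O_{S,0}$, i.e. the local ring of $S\times\mathbb C^n$ at $(0,0)$; similarly for $\mathcal O_{S,0}\{t_j\}$. For $S$ a (sufficiently small) representative of the germ and $s\in S$, $\varphi_s:\mathbb C\{x_1,\dots,x_n\}\to\mathbb C\{t_1\}\oplus\dots\oplus\mathbb C\{t_r\}$ is the induced map of $\mathbb C$-algebras, obtained from $\varphi_S$ by evaluating the coefficients of the series $\varphi_S(x_i)$ at $s$, and $\varphi_{s,j}:\mathbb C\{x_1,\dots,x_n\}\to\mathbb C\{t_j\}$ is its $j$-th component. Put $\mathcal O_{C_s,0}:=\mathbb C\{x_1,\dots,x_n\}/\operatorname{Ker}(\varphi_s)\cong\operatorname{Im}(\varphi_s)=\mathbb C\{\varphi_s(x_1),\dots,\varphi_s(x_n)\}$; this is the local ring of the germ $(C_s,0)=V(\operatorname{Ker}\varphi_s)\subset(\mathbb C^n,0)$. A morphism of analytic $\mathbb C$-algebras $\varphi:\mathbb C\{x_1,\dots,x_n\}\to\mathbb C\{t_1\}\oplus\dots\oplus\mathbb C\{t_r\}$ with components $\varphi_j$ and $\varphi_j(x_i)\in t_j\mathbb C\{t_j\}$ is a parameterization of the curve singularity with local ring $\operatorname{Im}(\varphi)$ with $r$ branches if for each $j$ some $\varphi_j(x_i)\neq0$, and $\operatorname{Ker}(\varphi_j)\ne\operatorname{Ker}(\varphi_{j'})$ for $j\ne j'$. It is primitive if for each $j$ the following holds: whenever $\tilde\varphi:\mathbb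 C\{x_1,\dots,x_n\}\to\mathbb C\{t\}$ is a morphism and $\tau\in t_j\mathbb C\{t_j\}$ satisfy $\varphi_j(x_i)=\tilde\varphi(x_i)(\tau(t_j))$ for all $i$, the order of $\tau$ is $1$. For a reduced local ring $R$ containing $\mathbb C$, with integral closure $\overline R$ in its total quotient ring, $\delta_{\mathbb C}(R):=\dim_{\mathbb C}\overline R/R$. *)

(* Defs.v *)
From HB Require Import structures.
From mathcomp Require Import all_boot all_order all_algebra.
From mathcomp Require Import all_classical all_reals topology normedtype sequences.
From mathcomp Require Import complex ring.

Set Implicit Arguments.
Unset Strict Implicit.
Unset Printing Implicit Defensive.

Import Order.TTheory GRing.Theory Num.Theory numFieldNormedType.Exports.
Local Open Scope ring_scope.

(* Multi-indices; the variables are indexed by an arbitrary finite type. *)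
Section Monomials.
Variable I : finType.

Definition mono : Type := {ffun I -> nat}.
HB.instance Definition _ := Choice.on mono.

Implicit Types a b c : mono.

Definition mono0 : mono := [ffun=> 0%N].
Definition mono1 (i : I) : mono := [ffun k => (k == i : nat)].
Definition mdeg a : nat := (\sum_i a i)%N.
Definition madd a b : mono := [ffun i => (a i + b i)%N].
Definition msub a b : mono := [ffun i => (a i - b i)%N].
Definition mle a b : bool := [forall i, a i <= b i]%N.

(* The multi-indices all of whose entries are < N. *)
Definition box (N : nat) : seq mono :=
  [seq ([ffun i => b i : nat] : mono) | b : {ffun I -> 'I_N}].

(* The multi-indices b <= a. *)
Definition below a : seq mono := [seq b <- box (mdeg a).+1 | mle b a].

Lemma box_uniq N : uniq (box N).
Proof.
rewrite map_inj_uniq ?enum_uniq // => b b' /ffunP e.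
by apply/ffunP => i; apply: val_inj; have := e i; rewrite !ffunE.
Qed.

Lemma mem_box N a : (a \in box N) = [forall i, a i < N]%N.
Proof.
apply/mapP/forallP => [[b _ -> i]|aN]; first by rewrite ffunE.
exists [ffun i => Ordinal (aN i)]; first by rewrite mem_enum.
by apply/ffunP => i; rewrite !ffunE.
Qed.

Lemma leq_mdeg a i : (a i <= mdeg a)%N.
Proof. by rewrite /mdeg (bigD1 i) //= leq_addr. Qed.

Lemma mleP a b : reflect (forall i, a i <= b i)%N (mle a b).
Proof. exact: forallP. Qed.

Lemma mem_below a b : (b \in below a) = mle b a.
Proof.
rewrite mem_filter mem_box; case: mleP => //= ba.
by apply/forallP => i; rewrite ltnS (leq_trans (ba i)) ?leq_mdeg.
Qed.

Lemma below_uniq a : uniq (below a).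
Proof. by rewrite filter_uniq ?box_uniq. Qed.

Lemma mdegD a b : mdeg (madd a b) = (mdeg a + mdeg b)%N.
Proof. by rewrite /mdeg -big_split; apply: eq_bigr => i _; rewrite ffunE. Qed.

Lemma msubK a b : mle b a -> madd b (msub a b) = a.
Proof. by move=> /mleP ba; apply/ffunP => i; rewrite !ffunE subnKC. Qed.

Lemma maddK a b : msub (madd b a) b = a.
Proof. by apply/ffunP => i; rewrite !ffunE addKn. Qed.

Lemma msub_le a b : mle (msub a b) a.
Proof. by apply/mleP => i; rewrite ffunE leq_subr. Qed.

Lemma msub_inv a b : mle b a -> msub a (msub a b) = b.
Proof. by move=> /mleP ba; apply/ffunP => i; rewrite !ffunE subKn. Qed.

Lemma msubA a b c : msub (msub a b) c = msub a (madd b c).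
Proof. by apply/ffunP => i; rewrite !ffunE subnDA. Qed.

Lemma madd_le a b c : mle b a -> mle (madd b c) a = mle c (msub a b).
Proof.
move=> /mleP ba; apply/mleP/mleP => h i; have := h i; have := ba i;
  rewrite !ffunE => bai; first by rewrite leq_subRL.
by rewrite leq_subRL.
Qed.

Lemma mle_trans : transitive mle.
Proof.
move=> b a c /mleP ab /mleP bc; apply/mleP => i.
exact: leq_trans (ab i) (bc i).
Qed.

Lemma msub0 a : msub a mono0 = a.
Proof. by apply/ffunP => i; rewrite !ffunE subn0. Qed.

Lemma mle0 a : mle mono0 a.
Proof. by apply/mleP => i; rewrite ffunE. Qed.

Lemma below_rev a : perm_eq (below a) [seq msub a b | b <- below a].
Proof.
apply: uniq_perm; rewrite ?below_uniq //.
  rewrite map_inj_in_uniq ?below_uniq // => b c; rewrite !mem_below => ba ca e.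
  by rewrite -(msub_inv ba) e msub_inv.
move=> b; apply/idP/mapP => [|[c _ ->]]; rewrite mem_below ?msub_le //.
by move=> ba; exists (msub a b); rewrite ?mem_below ?msub_le ?msub_inv.
Qed.

Lemma below_shift a b : mle b a ->
  perm_eq [seq c <- below a | mle b c] [seq madd b c | c <- below (msub a b)].
Proof.
move=> ba; apply: uniq_perm; rewrite ?filter_uniq ?box_uniq //.
  by rewrite map_inj_uniq ?below_uniq // => c d e; rewrite -(maddK c b) e maddK.
move=> c; rewrite mem_filter mem_below; apply/andP/mapP => [[bc ca]|[d]].
  by exists (msub c b); rewrite ?msubK // mem_below -madd_le ?msubK.
rewrite mem_below -madd_le // => h -> {c}; split=> //.
by apply/mleP => i; rewrite ffunE leq_addr.
Qed.

End Monomials.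

Section Sums.
Variables (K : numFieldType) (T : choiceType).

Lemma ler_sum_sub (s t : seq T) (F : T -> K) :
  uniq s -> {subset s <= t} -> uniq t -> (forall x, 0 <= F x) ->
  \sum_(x <- s) F x <= \sum_(x <- t) F x.
Proof.
move=> us st ut F0.
have e : perm_eq s [seq x <- t | x \in s].
  apply: uniq_perm; rewrite ?filter_uniq // => x.
  by rewrite mem_filter andb_idr //; exact: st.
rewrite (perm_big _ e).
by rewrite big_filter big_mkcond; apply: ler_sum => x _; case: ifP.
Qed.

End Sums.

(* K{x_i, i in I}: the power series in the variables x_i that converge        *)
(* absolutely in some polydisc around the origin.                             *)
Section ConvergentSeries.
Variables (K : numFieldType) (I : finType).
Local Notation mono := (mono I).
Implicit Types f g h : mono -> K.

Definition convergent f : Prop := exists r M : K, 0 < r /\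
  forall N, \sum_(a <- box I N) `|f a| * r ^+ mdeg a <= M.

Definition convergentb : {pred mono -> K} := fun f => `[< convergent f >].

Record cps : Type := Cps { coef :> mono -> K; _ : convergentb coef }.

HB.instance Definition _ := [isSub for coef].
HB.instance Definition _ := [Choice of cps by <:].

Lemma convergent_le f (r M s : K) : 0 < s -> s <= r ->
  (forall N, \sum_(a <- box I N) `|f a| * r ^+ mdeg a <= M) ->
  forall N, \sum_(a <- box I N) `|f a| * s ^+ mdeg a <= M.
Proof.
move=> s0 sr H N; apply: le_trans (H N); apply: ler_sum => a _.
by apply: ler_wpM2l => //; apply: lerXn2r; rewrite ?nnegrE ?(ltW s0) ?(le_trans (ltW s0)).
Qed.

Lemma convergent2 f g : convergent f -> convergent g -> exists r M M' : K,
  [/\ 0 < r, forall N, \sum_(a <- box I N) `|f a| * r ^+ mdeg a <= M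
    & forall N, \sum_(a <- box I N) `|g a| * r ^+ mdeg a <= M'].
Proof.
move=> [r [M [r0 H]]] [s [M' [s0 H']]].
have rs0 : 0 < r + s by apply: addr_gt0.
exists (r * s / (r + s)), M, M'.
have t0 : 0 < r * s / (r + s) by rewrite divr_gt0 ?mulr_gt0.
split=> //; [apply: convergent_le t0 _ H|apply: convergent_le t0 _ H'].
  by rewrite ler_pdivrMr // ler_pM2l // lerDr ltW.
by rewrite ler_pdivrMr // mulrC ler_pM2l // lerDl ltW.
Qed.

Lemma convergent_submod : submod_closed convergentb.
Proof.
split=> [|c f g].
  apply/asboolP; exists 1, 0; split=> // N.
  by rewrite big1 // => a _; rewrite normr0 mul0r.
move=> /asboolP cf /asboolP cg; apply/asboolP.
have [r [M [M' [r0 H H']]]] := convergent2 cf cg.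
exists r, (`|c| * M + M'); split=> // N.
apply: (@le_trans _ _ (\sum_(a <- box I N)
   (`|c| * (`|f a| * r ^+ mdeg a) + `|g a| * r ^+ mdeg a))).
  apply: ler_sum => a _; rewrite mulrA -mulrDl ler_wpM2r ?exprn_ge0 ?(ltW r0) //.
  by rewrite -normrM; exact: ler_normD.
by rewrite big_split /= -mulr_sumr lerD ?ler_wpM2l.
Qed.

HB.instance Definition _ := GRing.isSubmodClosed.Build K (mono -> K) convergentb
  convergent_submod.
HB.instance Definition _ := [SubChoice_isSubZmodule of cps by <:].
HB.instance Definition _ := [SubZmodule_isSubLmodule of cps by <:].

Definition conv f g : mono -> K :=
  fun a => \sum_(b <- below a) f b * g (msub a b).

Lemma convC f g : conv f g = conv g f.
Proof.
apply/funext => a; rewrite /conv (perm_big _ (below_rev a)) big_map.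
rewrite big_seq [RHS]big_seq; apply: eq_bigr => b.
by rewrite mem_below => ba; rewrite msub_inv // mulrC.
Qed.

Lemma convA f g h : conv f (conv g h) = conv (conv f g) h.
Proof.
apply/funext => a; rewrite /conv.
under [RHS]eq_bigr do rewrite mulr_suml.
transitivity (\sum_(e <- below a) \sum_(b <- below a | mle b e)
   f b * g (msub e b) * h (msub a e)); last first.
  rewrite big_seq [RHS]big_seq; apply: eq_bigr => e; rewrite mem_below => ea.
  rewrite -[LHS]big_filter; apply: perm_big.
  apply: uniq_perm; rewrite ?filter_uniq ?box_uniq // => b.
  rewrite mem_filter !mem_below andb_idr // => be; exact: mle_trans be ea.
rewrite (exchange_big_dep predT) //=.
rewrite big_seq [RHS]big_seq; apply: eq_bigr => b; rewrite mem_below => ba.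
rewrite -[RHS]big_filter (perm_big _ (below_shift ba)) big_map mulr_sumr.
by apply: eq_bigr => c _; rewrite maddK msubA mulrA.
Qed.

Lemma convDl f g h : conv (f + g) h = conv f h + conv g h.
Proof.
apply/funext => a; change (conv (f + g) h a = conv f h a + conv g h a).
rewrite /conv -big_split /=.
by apply: eq_bigr => b _; rewrite mulrDl.
Qed.

Lemma convZl (c : K) f g : conv (c *: f) g = c *: conv f g.
Proof.
apply/funext => a; change (conv (c *: f) g a = c *: conv f g a).
rewrite /conv scaler_sumr; apply: eq_bigr => b _.
by rewrite fctE -scalerAl.
Qed.

Lemma conv_convergent f g : convergentb f -> convergentb g ->
  convergentb (conv f g).
Proof.
move=> /asboolP cf /asboolP cg; apply/asboolP.
have [r [M [M' [r0 H H']]]] := convergent2 cf cg.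
exists r, (M * M'); split=> // N.
pose u b := `|f b| * r ^+ mdeg b; pose v b := `|g b| * r ^+ mdeg b.
have u0 b : 0 <= u b by rewrite mulr_ge0 ?exprn_ge0 ?(ltW r0).
have v0 b : 0 <= v b by rewrite mulr_ge0 ?exprn_ge0 ?(ltW r0).
apply: (@le_trans _ _ (\sum_(a <- box I N) \sum_(b <- below a) u b * v (msub a b))).
  apply: ler_sum => a _; rewrite -ler_pdivlMr ?exprn_gt0 // mulr_suml.
  apply: le_trans (ler_norm_sum _ _ _) _.
  rewrite big_seq [X in _ <= X]big_seq; apply: ler_sum => b.
  rewrite mem_below => ba; rewrite normrM ler_pdivlMr ?exprn_gt0 //.
  by rewrite /u /v mulrACA -exprD -mdegD msubK.
rewrite (eq_big_seq (fun a => \sum_(b <- box I N | mle b a) u b * v (msub a b)));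
  last first.
  move=> a; rewrite mem_box => /forallP aN; rewrite -[RHS]big_filter; apply: perm_big.
  apply: uniq_perm; rewrite ?filter_uniq ?box_uniq // => b.
  rewrite mem_below mem_filter andb_idr // => /mleP ba.
  by rewrite mem_box; apply/forallP => i; apply: leq_ltn_trans (ba i) (aN i).
rewrite (exchange_big_dep predT) //=.
apply: (@le_trans _ _ (\sum_(b <- box I N) u b * (\sum_(c <- box I N) v c))).
  apply: ler_sum => b _; rewrite -mulr_sumr ler_wpM2l //.
  rewrite -big_filter -(big_map (fun a => msub a b) predT v).
  apply: ler_sum_sub; rewrite ?box_uniq //.
    rewrite map_inj_in_uniq ?filter_uniq ?box_uniq // => c d.
    rewrite !mem_filter => /andP[bc _] /andP[bd _] e.
    by rewrite -(msubK bc) e msubK.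
  move=> c /mapP[d]; rewrite mem_filter => /andP[bd]; rewrite !mem_box.
  move=> /forallP dN ->; apply/forallP => i.
  by rewrite ffunE (leq_ltn_trans (leq_subr _ _)).
rewrite -mulr_suml; apply: ler_pM => //; exact: sumr_ge0.
Qed.

Definition mono_fun (e : mono) : mono -> K := fun a => (a == e)%:R.

Lemma mono_fun_convergent e : convergentb (mono_fun e).
Proof.
apply/asboolP; exists 1, 1; split=> // N.
under eq_bigr do rewrite expr1n mulr1.
have [eN|eN] := boolP (e \in box I N).
  rewrite (bigD1_seq e) ?box_uniq //= big1 ?addr0 /mono_fun ?eqxx ?normr1 //.
  by move=> a /negPf ->; rewrite normr0.
rewrite big1_seq // => a /= aN; rewrite /mono_fun; case: eqP => [E|_].
  by rewrite -E aN in eN.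
by rewrite normr0.
Qed.

Definition cmono (e : mono) : cps := Cps (mono_fun_convergent e).

Definition cmul (f g : cps) : cps := Cps (conv_convergent (valP f) (valP g)).

Lemma cmulA : associative cmul.
Proof. by move=> f g h; apply: val_inj; exact: convA. Qed.

Lemma cmulC : commutative cmul.
Proof. by move=> f g; apply: val_inj; exact: convC. Qed.

Lemma cmul1 : left_id (cmono (mono0 I)) cmul.
Proof.
move=> f; apply: val_inj; apply/funext => a; rewrite /= /conv.
rewrite (bigD1_seq (mono0 I)) ?below_uniq ?mem_below ?mle0 //= big1.
  by rewrite addr0 /mono_fun eqxx mul1r msub0.
by move=> b /negPf b0; rewrite /mono_fun b0 mul0r.
Qed.

Lemma cmulDl : left_distributive cmul +%R.
Proof.
by move=> f g h; apply: val_inj; exact: convDl.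
Qed.

Lemma cone_neq0 : cmono (mono0 I) != 0.
Proof.
apply/eqP => /(congr1 (fun f : cps => f (mono0 I))); rewrite /= /mono_fun eqxx.
by move/eqP; rewrite oner_eq0.
Qed.

HB.instance Definition _ := GRing.Zmodule_isComNzRing.Build cps
  cmulA cmulC cmul1 cmulDl cone_neq0.

Lemma cmulZl (c : K) (f g : cps) : c *: (f * g) = (c *: f) * g.
Proof.
by apply: val_inj; apply/esym; exact: convZl.
Qed.

HB.instance Definition _ := GRing.Lmodule_isLalgebra.Build K cps cmulZl.
HB.instance Definition _ := GRing.Lalgebra_isComAlgebra.Build K cps.

Definition cvar (i : I) : cps := cmono (mono1 i).

Lemma coef0M (f g : cps) : (f * g) (mono0 I) = f (mono0 I) * g (mono0 I).
Proof.
rewrite /GRing.mul /= /conv (bigD1_seq (mono0 I)) ?below_uniq ?mem_below ?mle0 //=.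
rewrite msub0 big1_seq ?addr0 // => b /andP[b0]; rewrite mem_below => /mleP h.
case/eqP: b0; apply/ffunP => i; apply/eqP; have := h i.
by rewrite !ffunE leqn0.
Qed.

Lemma coef_sum (L : Type) (s : seq L) (F : L -> cps) (a : mono) :
  (\sum_(l <- s) F l) a = \sum_(l <- s) F l a.
Proof. by apply: (big_morph (fun f : cps => f a)). Qed.

End ConvergentSeries.

Arguments cvar K {I} i.

(* The inclusion K{y} -> K{y, z}. *)
Section Inclusion.
Variables (K : numFieldType) (I J : finType).

Definition mjoin (a : mono I) (b : mono J) : mono (I + J)%type :=
  [ffun k => match k with inl i => a i | inr j => b j end].
Definition mleft (c : mono (I + J)%type) : mono I := [ffun i => c (inl i)].
Definition mright (c : mono (I + J)%type) : mono J := [ffun j => c (inr j)].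

Definition incl_fun (f : mono I -> K) : mono (I + J)%type -> K :=
  fun c => if mright c == mono0 J then f (mleft c) else 0.

Lemma mdeg_left c : mright c = mono0 J -> mdeg c = mdeg (mleft c).
Proof.
move=> /ffunP h; rewrite /mdeg big_sumType /= addnC big1 => [|j _].
  by apply: eq_bigr => i _; rewrite ffunE.
by have := h j; rewrite !ffunE.
Qed.

Lemma incl_convergent f : convergentb f -> convergentb (incl_fun f).
Proof.
move=> /asboolP[r [M [r0 H]]]; apply/asboolP; exists r, M; split=> // N.
apply: le_trans (H N).
have -> : \sum_(c <- box _ N) `|incl_fun f c| * r ^+ mdeg c =
  \sum_(c <- box _ N | mright c == mono0 J)
     `|f (mleft c)| * r ^+ mdeg (mleft c).
  rewrite [RHS]big_mkcond; apply: eq_bigr => c _; rewrite /incl_fun.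
  by case: eqP => [/mdeg_left ->//|_]; rewrite normr0 mul0r.
rewrite -big_filter.
rewrite -(big_map (@mleft) predT (fun a => `|f a| * r ^+ mdeg a)).
apply: ler_sum_sub; rewrite ?box_uniq //; last first.
- by move=> a; rewrite mulr_ge0 ?exprn_ge0 ?(ltW r0).
- move=> a /mapP[c]; rewrite mem_filter !mem_box => /andP[_ /forallP cN] ->.
  by apply/forallP => i; rewrite ffunE.
rewrite map_inj_in_uniq ?filter_uniq ?box_uniq // => c d.
rewrite !mem_filter => /andP[/eqP/ffunP c0 _] /andP[/eqP/ffunP d0 _] /ffunP e.
apply/ffunP => -[i|j]; first by have := e i; rewrite !ffunE.
by have := c0 j; have := d0 j; rewrite !ffunE => -> ->.
Qed.

Definition incl (f : cps K I) : cps K (I + J)%type :=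
  Cps (incl_convergent (valP f)).

End Inclusion.

(* The value at s of the series f, as the limit of the sums over the boxes    *)
(* [0, N)^I; meaningful where f converges absolutely.                         *)
Definition peval (K : numFieldType) (I : finType) (f : mono I -> K) (s : I -> K)
    : K :=
  limn (fun N : nat => \sum_(a <- box I N) f a * \prod_i s i ^+ a i).

(* F(s, z) as a series in z: the coefficients, series in y, evaluated at s.   *)
Definition specialize (K : numFieldType) (I J : finType)
    (F : cps K (I + J)%type) (s : I -> K) : mono J -> K :=
  fun b => peval (fun a => F (mjoin a b)) s.

(* A complex analytic germ (S,0), embedded in (K^m,0): the not necessarily    *)
(* reduced zero locus of finitely many series without constant term.          *)
Record germ (K : numFieldType) := Germ {
  gdim : nat;
  gnum : nat;
  geqn : 'I_gnum -> cps K 'I_gdim;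
  geqn0 : forall l, geqn l (mono0 'I_gdim) = 0
}.

(* Meaningful for s close to 0, where the equations converge. *)
Definition gpoint (K : numFieldType) (S : germ K) (s : 'I_(gdim S) -> K) : Prop :=
  forall l, peval (geqn l) s = 0.

Section RelativeSeries.
Variables (K : numFieldType) (S : germ K) (J : finType).

Definition gideal : {pred cps K ('I_(gdim S) + J)%type} := fun F =>
  `[< exists h : 'I_(gnum S) -> cps K ('I_(gdim S) + J)%type,
        F = \sum_l h l * incl J (geqn l) >].

Lemma gideal_closed : idealr_closed gideal.
Proof.
split.
- by apply/asboolP; exists (fun=> 0); rewrite big1 // => l _; rewrite mul0r.
- apply/asboolP => -[h /(congr1 (fun F : cps _ _ => F (mono0 _)))].
  rewrite coef_sum [LHS]/= /mono_fun eqxx.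
  move=> /eqP; rewrite big1 ?oner_eq0 // => l _; rewrite coef0M /= /incl_fun.
  have -> : mleft (mono0 ('I_(gdim S) + J)%type) = mono0 _.
    by apply/ffunP => i; rewrite !ffunE.
  by rewrite geqn0 if_same mulr0.
- move=> a u v /asboolP[h ->] /asboolP[k ->]; apply/asboolP.
  exists (fun l => a * h l + k l); rewrite mulr_sumr -big_split /=.
  by apply: eq_bigr => l _; rewrite mulrDl mulrA.
Qed.

HB.instance Definition _ := isIdealr.Build _ gideal gideal_closed.

(* O_{S,0}{z_j, j in J}, the local ring of S x K^J at (0,0). *)
Definition OSx := {ideal_quot gideal}.
HB.instance Definition _ := GRing.ComNzRing.on OSx.

Definition piS (F : cps K ('I_(gdim S) + J)%type) : OSx := (\pi_OSx F)%qT.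

End RelativeSeries.

Arguments piS {K S J} F.

Section CommutativeAlgebra.
Variable R : comNzRingType.

(* Total quotient ring of R: fractions whose denominator is a nonzerodivisor. *)
Definition regb : {pred R} := fun s => `[< GRing.rreg s >].

Record tratio : Type := TRatio { tpair :> R * R; _ : regb tpair.2 }.
HB.instance Definition _ := [isSub for tpair].
HB.instance Definition _ := [Choice of tratio by <:].

Implicit Types x y z : tratio.

Lemma tratioP x : GRing.rreg x.2.
Proof. by apply/asboolP; exact: (valP x). Qed.

Lemma regb1 : regb 1. Proof. by apply/asboolP/rreg1. Qed.

Lemma regbM x y : regb (x.2 * y.2).
Proof. by apply/asboolP; apply: rregM; apply: tratioP. Qed.

Definition teq x y : bool := x.1 * y.2 == y.1 * x.2.

Lemma teq_refl : reflexive teq. Proof. by move=> x; exact: eqxx. Qed.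
Lemma teq_sym : symmetric teq. Proof. by move=> x y; exact: eq_sym. Qed.
Lemma teq_trans : transitive teq.
Proof.
move=> y x z /eqP xy /eqP yz; apply/eqP; apply: (tratioP (x := y)).
by rewrite mulrAC xy mulrAC yz mulrAC.
Qed.

Canonical teq_equiv := EquivRel teq teq_refl teq_sym teq_trans.

Definition tfrac := {eq_quot teq}%qT.
HB.instance Definition _ : EqQuotient _ teq tfrac := EqQuotient.on tfrac.
HB.instance Definition _ := Choice.on tfrac.

Local Open Scope quotient_scope.

Definition tmk a x : tratio := @TRatio (a, x.2) (valP x).
Definition tadd0 x y : tratio :=
  @TRatio (x.1 * y.2 + y.1 * x.2, x.2 * y.2) (regbM x y).
Definition tmul0 x y : tratio := @TRatio (x.1 * y.1, x.2 * y.2) (regbM x y).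
Definition tof0 (a : R) : tratio := @TRatio (a, 1) regb1.

Definition tofrac (a : R) : tfrac := \pi_tfrac (tof0 a).
Definition tadd (p q : tfrac) : tfrac := \pi_tfrac (tadd0 (repr p) (repr q)).
Definition topp (p : tfrac) : tfrac :=
  \pi_tfrac (tmk (- (repr p).1) (repr p)).
Definition tmul (p q : tfrac) : tfrac := \pi_tfrac (tmul0 (repr p) (repr q)).

Lemma tpiP x y : reflect (\pi_tfrac x = \pi_tfrac y) (teq x y).
Proof. exact: (eqmodP teq_equiv). Qed.

Lemma reprP x : (repr (\pi_tfrac x)).1 * x.2 = x.1 * (repr (\pi_tfrac x)).2.
Proof. by apply/eqP; change (teq (repr (\pi_tfrac x)) x); apply/tpiP; rewrite reprK. Qed.

Lemma taddE x y : tadd (\pi x) (\pi y) = \pi_tfrac (tadd0 x y).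
Proof.
apply/tpiP/eqP => /=; have := reprP x; have := reprP y.
set a := repr (\pi x); set b := repr (\pi y) => hb ha.
by ring: ha hb.
Qed.

Lemma toppE x : topp (\pi x) = \pi_tfrac (tmk (- x.1) x).
Proof.
apply/tpiP/eqP => /=; have := reprP x; set a := repr (\pi x) => ha.
by ring: ha.
Qed.

Lemma tmulE x y : tmul (\pi x) (\pi y) = \pi_tfrac (tmul0 x y).
Proof.
apply/tpiP/eqP => /=; have := reprP x; have := reprP y.
set a := repr (\pi x); set b := repr (\pi y) => hb ha.
by ring: ha hb.
Qed.

Lemma taddA : associative tadd.
Proof.
elim/quotW=> x; elim/quotW=> y; elim/quotW=> z; rewrite !taddE.
by apply/tpiP/eqP => /=; ring.
Qed.

Lemma taddC : commutative tadd.
Proof.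
by elim/quotW=> x; elim/quotW=> y; rewrite !taddE; apply/tpiP/eqP => /=; ring.
Qed.

Lemma tadd0l : left_id (tofrac 0) tadd.
Proof. by elim/quotW=> x; rewrite taddE; apply/tpiP/eqP => /=; ring. Qed.

Lemma taddNl : left_inverse (tofrac 0) topp tadd.
Proof.
by elim/quotW=> x; rewrite toppE taddE; apply/tpiP/eqP => /=; ring.
Qed.

HB.instance Definition _ :=
  GRing.isZmodule.Build tfrac taddA taddC tadd0l taddNl.

Lemma tmulA : associative tmul.
Proof.
elim/quotW=> x; elim/quotW=> y; elim/quotW=> z; rewrite !tmulE.
by apply/tpiP/eqP => /=; ring.
Qed.

Lemma tmulC : commutative tmul.
Proof.
by elim/quotW=> x; elim/quotW=> y; rewrite !tmulE; apply/tpiP/eqP => /=; ring.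
Qed.

Lemma tmul1l : left_id (tofrac 1) tmul.
Proof. by elim/quotW=> x; rewrite tmulE; apply/tpiP/eqP => /=; ring. Qed.

Lemma tmulDl : left_distributive tmul tadd.
Proof.
elim/quotW=> x; elim/quotW=> y; elim/quotW=> z; rewrite taddE !tmulE taddE.
by apply/tpiP/eqP => /=; ring.
Qed.

Lemma tone_neq0 : tofrac 1 != tofrac 0.
Proof. by apply/eqP => /tpiP /eqP /=; rewrite !mulr1 => /eqP; rewrite oner_eq0. Qed.

HB.instance Definition _ := GRing.Zmodule_isComNzRing.Build tfrac
  tmulA tmulC tmul1l tmulDl tone_neq0.

Lemma tofrac_zmod : zmod_morphism tofrac.
Proof.
move=> a b; apply/esym; transitivity (tadd (tofrac a) (topp (tofrac b))) => //.
by rewrite /tofrac toppE taddE; apply/tpiP/eqP => /=; ring.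
Qed.

Lemma tofrac_monoid : monoid_morphism tofrac.
Proof.
split=> // a b; apply/esym; transitivity (tmul (tofrac a) (tofrac b)) => //.
by rewrite /tofrac tmulE; apply/tpiP/eqP => /=; ring.
Qed.

HB.instance Definition _ := GRing.isZmodMorphism.Build R tfrac tofrac tofrac_zmod.
HB.instance Definition _ := GRing.isMonoidMorphism.Build R tfrac tofrac tofrac_monoid.

Definition prime_ideal (P : pred R) : Prop :=
  idealr_closed P /\ prime_idealr_closed P.

Definition strictly_included (P Q : pred R) : Prop :=
  {subset P <= Q} /\ ~ {subset Q <= P}.

Definition minimal_prime (P : pred R) : Prop :=
  prime_ideal P /\ forall Q, prime_ideal Q -> ~ strictly_included Q P.

(* dim R/P = 1 for the Krull dimension. *)
Definition coheight1 (P : pred R) : Prop :=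
  (exists Q, prime_ideal Q /\ strictly_included P Q) /\
  ~ (exists Q Q', [/\ prime_ideal Q, prime_ideal Q',
                      strictly_included P Q & strictly_included Q Q']).

Definition reduced : Prop := forall (a : R) k, a ^+ k = 0 -> a = 0.

(* R, the local ring of a germ, is that of a reduced germ of pure dimension 1 *)
(* with exactly r irreducible components.                                     *)
Definition reduced_curve_singularity (r : nat) : Prop :=
  [/\ reduced,
      forall P, minimal_prime P -> coheight1 P
    & exists p : 'I_r -> pred R,
        [/\ forall j, minimal_prime (p j),
            forall j j', p j =i p j' -> j = j'
          & forall P, minimal_prime P -> exists j, P =i p j]].

End CommutativeAlgebra.

Arguments tofrac {R} a.

(* A/B has a basis of d elements, i.e. dim_K A/B = d < oo; A and B are meant  *)
(* to be subspaces of V, with B contained in A.                               *)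
Definition quotient_dim (K : fieldType) (V : zmodType) (scal : K -> V -> V)
    (A B : V -> Prop) (d : nat) : Prop :=
  exists e : 'I_d -> V, (forall i, A (e i)) /\
    forall v, A v -> exists! c : 'rV[K]_d, B (v - \sum_i scal (c 0 i) (e i)).

(* delta_K(R) = d < oo, where R contains K through kappa and is embedded in   *)
(* its total quotient ring.                                                   *)
Definition delta_eq (K : fieldType) (R : comNzRingType)
    (kappa : {rmorphism K -> R}) (d : nat) : Prop :=
  quotient_dim (fun c (q : tfrac R) => tofrac (kappa c) * q)
    (fun q => integralOver (@tofrac R) q)
    (fun q => exists a : R, q = tofrac a) d.

Section Parameterizations.
Variables (K : numFieldType) (n r : nat).
Local Notation Kx := (cps K 'I_n).
Local Notation Kt := (cps K 'I_1).
Implicit Types phi : {lrmorphism Kx -> {ffun 'I_r.+1 -> Kt}}.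

Definition kerp phi : {pred Kx} := fun g => phi g == 0.

Lemma kerp_closed phi : idealr_closed (kerp phi).
Proof.
split; rewrite ?unfold_in /kerp.
- by rewrite rmorph0.
- by rewrite rmorph1; apply/eqP => /ffunP/(_ ord0)/eqP; rewrite !ffunE oner_eq0.
- move=> a u v; rewrite !unfold_in => /eqP u0 /eqP v0.
  by rewrite rmorphD rmorphM /= u0 v0 mulr0 addr0.
Qed.

HB.instance Definition _ phi := isIdealr.Build Kx (kerp phi) (kerp_closed phi).

(* O_{C,0} := K{x}/Ker(phi). *)
Definition OC phi := {ideal_quot (kerp phi)}.
HB.instance Definition _ phi := GRing.ComNzRing.on (OC phi).

Definition scalarC phi : {rmorphism K -> OC phi} :=
  (\pi_(OC phi) \o GRing.in_alg Kx)%qT.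

Definition order1 (tau : Kt) : Prop :=
  tau (mono0 'I_1) = 0 /\ tau (mono1 ord0) <> 0.

(* The series g(tau(t)), for tau without constant term: tau ^+ k does not     *)
(* contribute to the coefficient of t^a when k > a.                           *)
Definition comp_series (g tau : Kt) : mono 'I_1 -> K := fun a =>
  \sum_(k < (mdeg a).+1) g [ffun=> k : nat] * (tau ^+ k) a.

Definition parameterization phi : Prop :=
  [/\ forall i j, (phi (cvar K i) j : Kt) (mono0 'I_1) = 0,
      forall j, exists i, phi (cvar K i) j <> 0
    & forall j j', j <> j' -> ~ (forall g, phi g j = 0 <-> phi g j' = 0)].

Definition primitive phi : Prop :=
  forall (j : 'I_r.+1) (psi : {lrmorphism Kx -> Kt}) (tau : Kt),
    tau (mono0 'I_1) = 0 ->
    (forall i, (phi (cvar K i) j : Kt) = comp_series (psi (cvar K i)) tau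
        :> (mono 'I_1 -> K)) ->
    order1 tau.

End Parameterizations.

Section Families.
Variables (K : numFieldType) (S : germ K) (n r : nat).

(* phiS : O_{S,0}{x} -> O_{S,0}{t_1} + ... + O_{S,0}{t_r} is a morphism of    *)
(* O_{S,0}-algebras; elements of O_{S,0} are given by representatives.        *)
Definition OS_algebra_morphism
    (phiS : {rmorphism OSx S 'I_n -> {ffun 'I_r.+1 -> OSx S 'I_1}}) : Prop :=
  forall g : cps K 'I_(gdim S), phiS (piS (incl 'I_n g)) = [ffun=> piS (incl 'I_1 g)].

(* F i j represents the class of phiS(x_i)_j; phi is the K-algebra morphism   *)
(* with phi(x_i)_j = F i j (s, t_j), the coefficients being evaluated at s.   *)
(* Representatives of the same class give the same series for s in S close    *)
(* to 0, as their difference is a combination of the equations of S.          *)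
Definition induced_at (F : 'I_n -> 'I_r.+1 -> cps K ('I_(gdim S) + 'I_1)%type)
    (s : 'I_(gdim S) -> K)
    (phi : {lrmorphism cps K 'I_n -> {ffun 'I_r.+1 -> cps K 'I_1}}) : Prop :=
  forall i j, (phi (cvar K i) j : cps K 'I_1) = specialize (F i j) s
    :> (mono 'I_1 -> K).

End Families.

(* Main.v *)
Require Import Defs.
From HB Require Import structures.
From mathcomp Require Import all_boot all_order all_algebra.
From mathcomp Require Import all_classical all_reals topology normedtype sequences.
From mathcomp Require Import complex zify ring lra.

Set Implicit Arguments.
Unset Strict Implicit.
Unset Printing Implicit Defensive.

Import Order.TTheory GRing.Theory Num.Theory numFieldNormedType.Exports.
Local Open Scope ring_scope.

(** Let K be the field of complex numbers, B the product of the rings K{t_j},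
    and A_s the image of phi_s in B.  Everything reduces to one fact: for s
    close to 0 in S, the ring A_s contains t^k B for some k, and d elements
    that span B modulo A_0 also span B modulo A_s.

    Nakayama.  If x_i has order e on a branch, Weierstrass division by its
    image (weierstrass) makes K{t} a finitely generated K{x}-module, and so is
    every t^k B.  With E bounding such orders e over all branches, t^(k+E) B
    lies in the product of t^k B with the maximal ideal of K{x}; hence t^k B is
    contained in A as soon as it is contained in A + t^(k+E) B
    (ideal_in_image).  If d elements span B modulo A + t^(E(d+1)) B, the d+2
    subspaces A + t^(Ei) B, i <= d+1, cannot all differ, so A contains some
    t^k B (conductor_of_approx).

    The special fibre.  On one branch, the differences of orders of elements
    of the image form a group qZ; let tau be a quotient of two elements of the
    image, of order q.  Division by tau of an element of K{t} which is a
    quotient of elements of the image leaves a constant remainder, since the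
    orders below q do not occur; iterating, each phi_0(x_i) is a convergent
    power series in tau, and primitivity gives q = 1
    (primitive_consecutive).  Two consecutive orders generate all large ones,
    and the Nakayama argument yields a conductor (conductor_of_consecutive).
    The image of a branch has dimension 1, so distinct kernels are
    incomparable; this separates the branches (conductor_of_branches).

    Semicontinuity.  The constant term in t of phi_S(x_i) lies in the ideal of
    S and vanishes at the points of S, so phi_s exists by substitution of
    convergent series.  Let e_1, ..., e_d be a basis of B modulo A_0 and write
    each monomial t_j^k with k < N as a combination of the e_i plus
    phi_0(g_jk).  Replacing phi_0 by phi_s moves the coefficients of degree
    < N by quantities that tend to 0 with s; a determinant equal to 1 at s = 0
    stays nonzero, and the e_i span B modulo A_s + t^N B (near_spanned).

    The curve.  When A contains t^k B, its minimal primes are the kernels of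
    the projections to the branches, and the only other prime is the maximal
    ideal (curve_singularity_of_image).  Writing b as the fraction t^k b / t^k
    embeds B in the total quotient ring of A, with the integral closure of A
    as image since each K{t_j} is a discrete valuation ring
    (normalization_exists).  So dim B/A is the delta invariant. *)

(** * Multi-indices and weighted norms *)

Section MonoMore.
Variable I : finType.
Implicit Types a b c : mono I.

Lemma mdeg0 : mdeg (mono0 I) = 0%N.
Proof. by rewrite /mdeg big1 // => i _; rewrite ffunE. Qed.

Lemma mdeg_eq0 a : mdeg a = 0%N -> a = mono0 I.
Proof.
move=> a0; apply/ffunP => i; rewrite ffunE; apply/eqP.
by rewrite -leqn0 -a0 leq_mdeg.
Qed.

Lemma box_mdeg a N : (mdeg a < N)%N -> a \in box I N.
Proof. by move=> h; rewrite mem_box; apply/forallP => i; apply: leq_ltn_trans (leq_mdeg a i) h. Qed.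

Lemma mdeg_box a N : a \in box I N -> (mdeg a <= #|I| * N)%N.
Proof.
rewrite mem_box => /forallP h; rewrite /mdeg -sum_nat_const.
by apply: leq_sum => i _; apply: ltnW.
Qed.

Lemma boxS N M : (N <= M)%N -> {subset box I N <= box I M}.
Proof.
move=> NM a; rewrite !mem_box => /forallP h; apply/forallP => i.
exact: leq_trans (h i) NM.
Qed.

Lemma box1 : box I 1 = [:: mono0 I].
Proof.
apply: perm_small_eq => //; apply: uniq_perm; rewrite ?box_uniq //= => a.
rewrite mem_box inE; apply/forallP/eqP => [h|-> i]; last by rewrite ffunE.
by apply/ffunP => i; have := h i; rewrite ffunE ltnS leqn0 => /eqP.
Qed.

Lemma maddC a b : madd a b = madd b a.
Proof. by apply/ffunP => i; rewrite !ffunE addnC. Qed.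

(** The Cauchy product regrouped over pairs (b, c) with b + c in the box; all
    estimates on products of series go through this form. *)
Lemma sum_box_below (V : nmodType) N (F : mono I -> mono I -> V) :
  \sum_(a <- box I N) \sum_(b <- below a) F b (msub a b) =
  \sum_(b <- box I N) \sum_(c <- box I N | madd b c \in box I N) F b c.
Proof.
rewrite [RHS](eq_bigr (fun b => \sum_(c <- box I N)
  if madd b c \in box I N then F b c else 0)); last first.
  by move=> b _; rewrite big_mkcond.
pose G (p : mono I * mono I) := if madd p.1 p.2 \in box I N then F p.1 p.2 else 0.
transitivity (\sum_(p <- [seq (b, msub a b) | a <- box I N, b <- below a])
  F p.1 p.2); first by rewrite big_allpairs_dep.
transitivity (\sum_(p <- [seq (b, c) | b <- box I N, c <- box I N]) G p);
  last by rewrite big_allpairs.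
rewrite -big_mkcond /= -[RHS]big_filter.
apply: perm_big; apply: uniq_perm.
- apply: allpairs_uniq_dep => [||[a b] [a' b']]; rewrite ?box_uniq //.
    by move=> a _; rewrite below_uniq.
  move=> /allpairsPdep[x [y [_ h1 [-> ->]]]] /allpairsPdep[x' [y' [_ h2 [-> ->]]]] [e1 e2].
  move: h1 h2; rewrite !mem_below => h1 h2.
  have ex : x = x' by rewrite -(msubK h1) e2 e1 msubK.
  by rewrite ex e1.
- by rewrite filter_uniq // allpairs_uniq ?box_uniq // => -[? ?] [? ?].
move=> [b c]; rewrite mem_filter /=; apply/allpairsPdep/andP => [[a [b' [aN h [-> ->]]]]|].
  move: h; rewrite mem_below => h; rewrite msubK //; split=> //.
  by apply/allpairsPdep; exists b', (msub a b'); split=> //;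
    move: aN; rewrite !mem_box => /forallP aN; apply/forallP => i;
    apply: leq_ltn_trans (aN i) => //; rewrite ?ffunE ?leq_subr //; move/mleP: h.
move=> [bcN _]; exists (madd b c), b; split=> //; last by rewrite maddK.
by rewrite mem_below; apply/mleP => i; rewrite ffunE leq_addr.
Qed.

Lemma sum_below (V : nmodType) N a (F : mono I -> mono I -> V) : (mdeg a < N)%N ->
  \sum_(b <- below a) F b (msub a b) =
  \sum_(b <- box I N) \sum_(c <- box I N | madd b c == a) F b c.
Proof.
move=> aN.
have := sum_box_below N (fun b c => if madd b c == a then F b c else 0).
have aB := box_mdeg aN.
rewrite (bigD1_seq a) ?box_uniq //= [X in _ + X]big1_seq ?addr0; last first.
  move=> c /andP[ca _]; rewrite big1_seq // => b; rewrite mem_below => /= h.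
  by rewrite msubK // (negPf ca).
rewrite (eq_big_seq (fun b => F b (msub a b))); last first.
  by move=> b; rewrite mem_below => h; rewrite msubK // eqxx.
move=> ->; apply: eq_bigr => b _; rewrite [RHS]big_mkcond [LHS]big_mkcond.
apply: eq_bigr => c _; case: ifP => //; case: ifP => // /eqP ->.
by rewrite aB.
Qed.

End MonoMore.

Section NormBounds.
Variables (K : numFieldType) (I : finType).
Implicit Types (f g : mono I -> K) (rho M : K).

(** The weighted l^1-norm of f at radius rho is at most M.  The norm itself need
    not exist in an arbitrary numeric field, so only the bound is expressed. *)
Definition wnorm_le f rho M := forall N, \sum_(a <- box I N) `|f a| * rho ^+ mdeg a <= M.

Lemma wnorm_le_seq f rho M (s : seq (mono I)) : 0 <= rho -> wnorm_le f rho M -> uniq s ->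
  \sum_(a <- s) `|f a| * rho ^+ mdeg a <= M.
Proof.
move=> r0 H us; apply: le_trans (H (\sum_(a <- s) (mdeg a).+1)%N).
apply: ler_sum_sub; rewrite ?box_uniq // => a; last first.
  by rewrite mulr_ge0 // exprn_ge0.
by move=> sa; apply: box_mdeg; rewrite (big_rem a) //= leq_addr.
Qed.

Lemma wnorm_le_coef f rho M a : 0 <= rho -> wnorm_le f rho M -> `|f a| * rho ^+ mdeg a <= M.
Proof. by move=> r0 H; have := wnorm_le_seq (s := [:: a]) r0 H isT; rewrite big_seq1. Qed.

Lemma wnorm_le_ge0 f rho M : 0 <= rho -> wnorm_le f rho M -> 0 <= M.
Proof. by move=> r0 H; have := wnorm_le_seq (s := [::]) r0 H isT; rewrite big_nil. Qed.

Lemma wnorm_le_radius f rho M sig : 0 <= sig -> sig <= rho -> wnorm_le f rho M -> wnorm_le f sig M.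
Proof.
move=> s0 sr H N; apply: le_trans (H N); apply: ler_sum => a _.
by apply: ler_wpM2l => //; apply: lerXn2r; rewrite ?nnegrE ?(le_trans s0).
Qed.

Lemma wnorm_le_weak f rho M M' : M <= M' -> wnorm_le f rho M -> wnorm_le f rho M'.
Proof. by move=> h H N; apply: le_trans (H N) h. Qed.

Lemma wnorm_le_conv f g rho M M' : 0 <= rho -> wnorm_le f rho M -> wnorm_le g rho M' ->
  wnorm_le (conv f g) rho (M * M').
Proof.
move=> r0 H H' N.
pose u b := `|f b| * rho ^+ mdeg b; pose v b := `|g b| * rho ^+ mdeg b.
have u0 b : 0 <= u b by rewrite mulr_ge0 ?exprn_ge0.
have v0 b : 0 <= v b by rewrite mulr_ge0 ?exprn_ge0.
apply: (@le_trans _ _ (\sum_(a <- box I N) \sum_(b <- below a) u b * v (msub a b))).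
  apply: ler_sum => a _; rewrite /conv.
  apply: le_trans (ler_wpM2r (exprn_ge0 _ r0) (ler_norm_sum _ _ _)) _.
  rewrite mulr_suml big_seq [leRHS]big_seq; apply: ler_sum => b.
  rewrite mem_below => ba; rewrite normrM /u /v mulrACA -exprD -mdegD msubK //.
rewrite (sum_box_below N (fun b c => u b * v c)).
apply: (@le_trans _ _ (\sum_(b <- box I N) u b * (\sum_(c <- box I N) v c))).
  apply: ler_sum => b _; rewrite mulr_sumr [leLHS]big_mkcond.
  by apply: ler_sum => c _; case: ifP => // _; rewrite mulr_ge0.
by rewrite -mulr_suml; apply: ler_pM => //; apply: sumr_ge0.
Qed.

Lemma wnorm_leM (f g : cps K I) rho M M' : 0 <= rho -> wnorm_le f rho M ->
  wnorm_le g rho M' -> wnorm_le (f * g) rho (M * M').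
Proof. exact: wnorm_le_conv. Qed.

(** Without constant term, every monomial gains at least one factor theta; this
    makes the norm of a noninvertible series as small as desired. *)
Lemma wnorm_le_scale f rho M theta : 0 <= rho -> 0 <= theta -> theta <= 1 ->
  f (mono0 I) = 0 -> wnorm_le f rho M -> wnorm_le f (theta * rho) (theta * M).
Proof.
move=> r0 t0 t1 f0 H N; apply: le_trans (ler_wpM2l t0 (H N)).
rewrite mulr_sumr; apply: ler_sum => a _; rewrite exprMn.
case: (posnP (mdeg a)) => [/mdeg_eq0 ->|ap].
  by rewrite f0 normr0 !mul0r mulr0.
rewrite mulrCA ler_wpM2r ?mulr_ge0 ?exprn_ge0 //.
by rewrite -(prednK ap) exprS ler_piMr // exprn_ile1.
Qed.

Lemma wnorm_le1 rho : 0 <= rho -> wnorm_le (1 : cps K I) rho 1.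
Proof.
move=> r0 N; have [eN|eN] := boolP (mono0 I \in box I N).
  rewrite (bigD1_seq (mono0 I)) ?box_uniq //= big1 => [|a /negPf a0].
    by rewrite addr0 /mono_fun eqxx normr1 mdeg0 expr0 mulr1.
  by rewrite /mono_fun a0 normr0 mul0r.
rewrite big1_seq // => a /= aN; rewrite /mono_fun; case: eqP => [E|_].
  by rewrite -E aN in eN.
by rewrite normr0 mul0r.
Qed.

Lemma convergent_wnorm (f : cps K I) : exists rho M, 0 < rho /\ wnorm_le f rho M.
Proof. by have /asboolP[r [M [r0 H]]] := valP f; exists r, M. Qed.

(** The inverse of 1 plus the sum of the inverse radii is at most each radius. *)
Lemma wnorm_le_common (T : finType) (h : T -> cps K I) :
  exists rho M, 0 < rho /\ forall t, wnorm_le (h t) rho M.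
Proof.
have H t : exists p : K * K, 0 < p.1 /\ wnorm_le (h t) p.1 p.2.
  by have [r [M [r0 H]]] := convergent_wnorm (h t); exists (r, M).
have [p pP] := choice H.
have s0 t : 0 <= (p t).1^-1 by rewrite invr_ge0 ltW //; case: (pP t).
have M0 t : 0 <= (p t).2 by case: (pP t) => /ltW h1; exact: wnorm_le_ge0.
pose s := 1 + \sum_t (p t).1^-1.
have sp : 0 < s by rewrite ltr_pwDl // sumr_ge0.
exists s^-1, (\sum_t (p t).2); split; rewrite ?invr_gt0 // => t.
have [r0 H1] := pP t.
apply: wnorm_le_weak (wnorm_le_radius _ _ H1).
- by rewrite (bigD1 t) //= lerDl sumr_ge0.
- by rewrite invr_ge0 ltW.
- rewrite -[leRHS]invrK lef_pV2 ?posrE ?invr_gt0 //.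
  rewrite /s (bigD1 t) //= addrCA lerDl addr_ge0 // sumr_ge0 //.
Qed.

End NormBounds.

(** * Substitution of convergent power series *)

Section Coefs.
Variables (K : numFieldType) (I : finType).
Implicit Types f g : cps K I.

Lemma scoefM f g a : (f * g) a = \sum_(b <- below a) f b * g (msub a b).
Proof. by []. Qed.
Lemma scoefD f g a : (f + g) a = f a + g a. Proof. by []. Qed.
Lemma scoefN f a : (- f) a = - f a. Proof. by []. Qed.
Lemma scoefB f g a : (f - g) a = f a - g a. Proof. by []. Qed.
Lemma scoefZ (c : K) f a : (c *: f) a = c * f a. Proof. by []. Qed.
Lemma scoef1 a : (1 : cps K I) a = (a == mono0 I)%:R. Proof. by []. Qed.

Lemma scoef_sum (T : Type) (s : seq T) (P : pred T) (F : T -> cps K I) a :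
  (\sum_(t <- s | P t) F t) a = \sum_(t <- s | P t) F t a.
Proof. by apply: (big_morph (fun f : cps K I => f a)). Qed.

Lemma cpsP f g : (forall a, f a = g a) -> f = g.
Proof. by move=> fg; apply: val_inj; apply/funext => a; exact: fg. Qed.

Lemma scoefM_box N f g a : (mdeg a < N)%N -> (f * g) a =
  \sum_(b <- box I N) \sum_(c <- box I N | madd b c == a) f b * g c.
Proof. by move=> aN; rewrite scoefM (sum_below (fun b c => f b * g c) aN). Qed.

(** Membership in the k-th power of the maximal ideal. *)
Definition order_ge f k := forall a, (mdeg a < k)%N -> f a = 0.

Lemma order_ge0 f : order_ge f 0. Proof. by []. Qed.

Lemma order_ge1 f : f (mono0 I) = 0 -> order_ge f 1.
Proof. by move=> f0 a; rewrite ltnS leqn0 => /eqP/mdeg_eq0 ->. Qed.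

Lemma order_geM f g k l : order_ge f k -> order_ge g l -> order_ge (f * g) (k + l).
Proof.
move=> fk gl a ak; rewrite scoefM big1_seq // => b; rewrite mem_below /= => ba.
have [bk|kb] := ltnP (mdeg b) k; first by rewrite fk ?mul0r.
rewrite gl ?mulr0 //; move: ak; rewrite -{1}(msubK ba) mdegD; lia.
Qed.

Lemma order_ge_le f k l : (k <= l)%N -> order_ge f l -> order_ge f k.
Proof. by move=> kl fl a ak; apply: fl; apply: leq_trans kl. Qed.

Lemma order_geX f k m : order_ge f k -> order_ge (f ^+ m) (k * m).
Proof.
move=> fk; elim: m => [|m IH]; first by rewrite muln0.
by rewrite exprS mulnS; apply: order_geM.
Qed.

End Coefs.

Section Powers.
Variables (K : numFieldType) (I J : finType) (h : J -> cps K I).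

Definition mpower (b : mono J) : cps K I := \prod_j h j ^+ b j.

Lemma mpowerD b c : mpower (madd b c) = mpower b * mpower c.
Proof.
by rewrite /mpower -big_split; apply: eq_bigr => j _; rewrite ffunE exprD.
Qed.

Lemma mpower0 : mpower (mono0 J) = 1.
Proof. by rewrite /mpower big1 // => j _; rewrite ffunE. Qed.

Lemma mpower1 j : mpower (mono1 j) = h j.
Proof.
rewrite /mpower (bigD1 j) //= ffunE eqxx expr1 big1 ?mulr1 // => i /negPf ij.
by rewrite ffunE ij.
Qed.

Lemma wnorm_le_mpower rho sig b : 0 <= rho -> 0 <= sig -> (forall j, wnorm_le (h j) rho sig) ->
  wnorm_le (mpower b) rho (sig ^+ mdeg b).
Proof.
move=> r0 s0 H; rewrite /mpower /mdeg.
apply: (big_rec2 (fun (f : cps K I) k => wnorm_le f rho (sig ^+ k))) => [|j f k _ IH].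
  exact: wnorm_le1.
rewrite exprD; apply: (wnorm_leM r0) => //.
elim: (b j) => [|m IHm]; first exact: wnorm_le1.
by rewrite !exprS; apply: (wnorm_leM r0).
Qed.

Hypothesis h0 : forall j, h j (mono0 I) = 0.

Lemma order_ge_mpower b : order_ge (mpower b) (mdeg b).
Proof.
rewrite /mpower /mdeg; apply: (big_rec2 (fun (f : cps K I) k => order_ge f k)) => [|j y x _ IH]; first exact: order_ge0.
apply: order_geM => //.
by rewrite -[X in order_ge _ X]mul1n; apply: order_geX; apply: order_ge1.
Qed.

(** The sum over all b of f_b h^b: since h has no constant term, h^b contributes
    to the coefficient of index a only when mdeg b <= mdeg a. *)
Definition subst_fun (f : mono J -> K) : mono I -> K := fun a =>
  \sum_(b <- box J (mdeg a).+1) f b * mpower b a.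

Lemma subst_funE N f a : (mdeg a < N)%N ->
  subst_fun f a = \sum_(b <- box J N) f b * mpower b a.
Proof.
move=> aN; rewrite [RHS](bigID (fun b => b \in box J (mdeg a).+1)) /=.
rewrite [X in _ + X]big1 ?addr0 => [|b bB]; last first.
  rewrite order_ge_mpower ?mulr0 // ltnNge; apply: contra bB => ba.
  by apply: box_mdeg; rewrite ltnS.
rewrite -big_filter; apply: perm_big; apply: uniq_perm; rewrite ?filter_uniq ?box_uniq //.
by move=> b; rewrite mem_filter andb_idr // => /boxS; apply.
Qed.

(** If f converges at radius sig, shrink the radius of the h_j until each of
    them has norm at most sig there. *)
Lemma subst_convergent f : convergentb f -> convergentb (subst_fun f).
Proof.
move=> /asboolP[sig [M [s0 H]]]; apply/asboolP.
have [rho [M0 [r0 H0]]] := wnorm_le_common h.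
have M1 : 0 <= `|M0| by [].
have M0s : 0 < `|M0| + sig by rewrite ltr_wpDl.
(* This th satisfies th <= 1 and th * M0 <= sig. *)
pose th := sig / (`|M0| + sig).
have th0 : 0 < th by rewrite divr_gt0.
have th1 : th <= 1 by rewrite ler_pdivrMr // mul1r lerDr.
have Hh j : wnorm_le (h j) (th * rho) sig.
  have := wnorm_le_scale (ltW r0) (ltW th0) th1 (h0 j) (H0 j); apply: wnorm_le_weak.
  rewrite /th mulrAC ler_pdivrMr // ler_wpM2l ?(ltW s0) //.
  rewrite (le_trans (real_ler_norm _)) ?lerDl ?(ltW s0) //.
  by rewrite ger0_real // (wnorm_le_ge0 (ltW r0) (H0 j)).
have tr0 : 0 <= th * rho by rewrite ltW // mulr_gt0.
exists (th * rho), M; split; first by rewrite mulr_gt0.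
move=> N; pose N' := (#|I| * N).+1.
apply: (@le_trans _ _ (\sum_(a <- box I N) \sum_(b <- box J N')
   `|f b| * (`|mpower b a| * (th * rho) ^+ mdeg a))).
  rewrite big_seq [leRHS]big_seq; apply: ler_sum => a aN.
  rewrite (@subst_funE N') ?ltnS ?mdeg_box //.
  apply: le_trans (ler_wpM2r (exprn_ge0 _ tr0) (ler_norm_sum _ _ _)) _.
  by rewrite mulr_suml; apply: ler_sum => b _; rewrite normrM mulrA.
rewrite exchange_big /=; apply: le_trans (H N'); apply: ler_sum => b _.
by rewrite -mulr_sumr ler_wpM2l //; apply: wnorm_le_mpower => //; apply: ltW.
Qed.

Definition subst (f : cps K J) : cps K I := Cps (subst_convergent (valP f)).

Lemma substE f a : subst f a = subst_fun f a. Proof. by []. Qed.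

Lemma subst_zmod : zmod_morphism subst.
Proof.
move=> f g; apply: cpsP => a; rewrite scoefB !substE /subst_fun -sumrB.
by apply: eq_bigr => b _; rewrite scoefB mulrBl.
Qed.

Lemma subst_monoid : monoid_morphism subst.
Proof.
split.
  apply: cpsP => a; rewrite substE /subst_fun (bigD1_seq (mono0 J)) ?box_uniq //=; last first.
    by apply: box_mdeg; rewrite mdeg0.
  rewrite big1 ?addr0 => [|b /negPf b0]; last by rewrite /= /mono_fun b0 mul0r.
  by rewrite mpower0 /= /mono_fun eqxx mul1r.
move=> f g; apply: cpsP => a; pose N := (mdeg a).+1.
transitivity (\sum_(b <- box J N) \sum_(c <- box J N) f b * g c * (mpower b * mpower c) a).
  rewrite substE (@subst_funE N) //.
  rewrite (eq_bigr (fun e => \sum_(b <- below e)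
     f b * g (msub e b) * (mpower b * mpower (msub e b)) a)); last first.
    move=> e _; rewrite scoefM mulr_suml big_seq [RHS]big_seq; apply: eq_bigr => b.
    by rewrite mem_below => be; rewrite -mpowerD msubK.
  rewrite (sum_box_below N (fun b c => f b * g c * (mpower b * mpower c) a)).
  apply: eq_bigr => b _; rewrite [LHS]big_mkcond; apply: eq_bigr => c _.
  case: ifP => // bcN; rewrite -mpowerD order_ge_mpower ?mulr0 // ltnNge.
  by apply: contraFN bcN => bc; apply: box_mdeg; rewrite ltnS.
rewrite scoefM [RHS]big_seq.
rewrite [RHS](eq_bigr (fun e => \sum_(b <- box J N) \sum_(c <- box J N)
    f b * g c * (mpower b e * mpower c (msub a e)))); last first.
  move=> e; rewrite mem_below => ea.
  have eN : (mdeg e < N)%N by rewrite ltnS -(msubK ea) mdegD leq_addr.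
  have sN : (mdeg (msub a e) < N)%N by rewrite ltnS -{2}(msubK ea) mdegD leq_addl.
  rewrite !substE (subst_funE _ eN) (subst_funE _ sN) mulr_suml.
  by apply: eq_bigr => b _; rewrite mulr_sumr; apply: eq_bigr => c _; rewrite mulrACA.
rewrite -[RHS]big_seq [RHS]exchange_big; apply: eq_bigr => b _.
rewrite [RHS]exchange_big; apply: eq_bigr => c _.
by rewrite scoefM mulr_sumr.
Qed.

Lemma subst_scalable : scalable subst.
Proof.
move=> c f; apply: cpsP => a; rewrite scoefZ !substE /subst_fun mulr_sumr.
by apply: eq_bigr => b _; rewrite scoefZ mulrA.
Qed.

HB.instance Definition _ := GRing.isZmodMorphism.Build _ _ subst subst_zmod.
HB.instance Definition _ := GRing.isMonoidMorphism.Build _ _ subst subst_monoid.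
HB.instance Definition _ := GRing.isScalable.Build K _ _ _ subst subst_scalable.

Lemma substX j : subst (cvar K j) = h j.
Proof.
apply: cpsP => a; rewrite substE (@subst_funE (mdeg a).+2) //.
rewrite (bigD1_seq (mono1 j)) ?box_uniq //=; last first.
  by rewrite mem_box; apply/forallP => i; rewrite ffunE; case: (i == j).
rewrite big1 ?addr0 => [|b /negPf b0]; last by rewrite /mono_fun b0 mul0r.
by rewrite mpower1 /mono_fun eqxx mul1r.
Qed.

End Powers.

Lemma subst_exists (K : numFieldType) (I J : finType) (h : J -> cps K I) :
  (forall j, h j (mono0 I) = 0) ->
  exists phi : {lrmorphism cps K J -> cps K I}, forall j, phi (cvar K j) = h j.
Proof. by move=> h0; exists (subst h0) => j; exact: substX. Qed.

Section OneVariableMono.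

(** Multi-indices in the variable t are natural numbers. *)
Definition tmono (k : nat) : mono 'I_1 := [ffun=> k].

Lemma tmono_inj : injective tmono.
Proof. by move=> k l /ffunP/(_ ord0); rewrite !ffunE. Qed.

Lemma mdeg_tmono k : mdeg (tmono k) = k.
Proof. by rewrite /mdeg big_ord1 ffunE. Qed.

Lemma tmono_mdeg a : tmono (mdeg a) = a.
Proof. by apply/ffunP => i; rewrite ffunE /mdeg big_ord1 (ord1 i). Qed.

Lemma box_tmono N : perm_eq (box 'I_1 N) [seq tmono k | k <- iota 0 N].
Proof.
apply: uniq_perm; rewrite ?box_uniq ?(map_inj_uniq tmono_inj) ?iota_uniq // => a.
rewrite mem_box; apply/forallP/mapP => [aN|[k]].
  by exists (mdeg a); rewrite ?tmono_mdeg // mem_iota /mdeg big_ord1 aN.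
by rewrite mem_iota => kN -> i; rewrite ffunE.
Qed.

Lemma sum_box_tmono (V : nmodType) N (F : mono 'I_1 -> V) :
  \sum_(a <- box 'I_1 N) F a = \sum_(k < N) F (tmono k).
Proof. by rewrite (perm_big _ (box_tmono N)) big_map -(big_mkord predT (fun k => F (tmono k))) /index_iota subn0. Qed.

End OneVariableMono.

Section Units.
Variables (K : numFieldType) (I : finType).
Implicit Types f g : cps K I.

Lemma half_sum N : \sum_(k < N) 2%:R^-1 ^+ k <= 2%:R :> K.
Proof.
have := subrX1 (2%:R^-1 : K) N.
have two : (2%:R : K) != 0 by rewrite pnatr_eq0.
have -> : 2%:R^-1 - 1 = - 2%:R^-1 :> K by field.
move=> e.
have -> : \sum_(k < N) 2%:R^-1 ^+ k = 2%:R * (1 - 2%:R^-1 ^+ N) :> K.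
  by rewrite -opprB e mulNr opprK mulrA divff // mul1r.
by rewrite ler_piMr ?ler0n // gerBl exprn_ge0 // invr_ge0 ler0n.
Qed.

Lemma geom_bound_convergent (f : mono 'I_1 -> K) (M C : K) : 0 <= C ->
  (forall k, `|f (tmono k)| <= M * C ^+ k) -> convergentb f.
Proof.
move=> C0 H; apply/asboolP.
have C1 : 0 < 2%:R * (C + 1) by rewrite mulr_gt0 ?ltr0n // ltr_wpDl.
have M0 : 0 <= M by have := le_trans (normr_ge0 _) (H 0%N); rewrite mulr1.
exists (2%:R * (C + 1))^-1, (M * 2%:R); split; rewrite ?invr_gt0 // => N.
rewrite sum_box_tmono; apply: le_trans (ler_wpM2l M0 (half_sum N)).
rewrite mulr_sumr; apply: ler_sum => k _; rewrite mdeg_tmono.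
apply: le_trans (ler_wpM2r _ (H k)) _; first by rewrite exprn_ge0 // invr_ge0 ltW.
rewrite -mulrA ler_wpM2l // -exprMn lerXn2r ?nnegrE ?invr_ge0 ?ler0n //.
  by rewrite mulr_ge0 // invr_ge0 ltW.
rewrite ler_pdivrMr // mulrA mulVf ?pnatr_eq0 // mul1r lerDl ler01 //.
Qed.

Lemma geom_convergent : convergentb ((fun=> 1) : mono 'I_1 -> K).
Proof.
by apply: (@geom_bound_convergent _ 1 1) => // k; rewrite normr1 expr1n mulr1.
Qed.

(** Substitute 1 - f / f(0), which has no constant term, into the geometric
    series. *)
Lemma cps_inv f : f (mono0 I) != 0 -> exists g, f * g = 1.
Proof.
move=> f0.
pose h (_ : 'I_1) : cps K I := 1 - (f (mono0 I))^-1 *: f.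
have h0 j : h j (mono0 I) = 0 by rewrite scoefB scoefZ scoef1 eqxx mulVf // subrr.
have [phi phiX] := subst_exists h0.
pose G : cps K 'I_1 := Cps geom_convergent.
have GE : (1 - cvar K ord0) * G = 1.
  apply: cpsP => a; rewrite mulrBl mul1r scoefB scoef1.
  have [->|an0] := eqVneq a (mono0 _).
    by rewrite Defs.coef0M /= /mono_fun; case: eqP => [/ffunP/(_ ord0)|]; rewrite ?ffunE ?eqxx // mul0r subr0.
  have a1 : mle (mono1 ord0) a.
    apply/mleP => i; rewrite ffunE ord1 eqxx lt0n; apply: contra an0 => /eqP e.
    by apply/eqP/ffunP => j; rewrite ffunE ord1.
  rewrite scoefM (bigD1_seq (mono1 ord0)) ?below_uniq ?mem_below //=.
  rewrite big1 ?addr0 => [|b /negPf b0]; last by rewrite /mono_fun b0 mul0r.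
  by rewrite /mono_fun eqxx mul1r subrr.
exists ((f (mono0 I))^-1 *: phi G).
have := congr1 phi GE; rewrite rmorphM rmorphB !rmorph1 /= phiX /h subKr => <-.
by rewrite -scalerAr -scalerAl.
Qed.

End Units.

Section Uniqueness.
Variables (K : numFieldType) (I J : finType).

(** The monomials outside the box of size N are divisible by some y_j ^+ N; the
    first such j is chosen, so that each monomial is counted once. *)
Definition tail_fun N (f : mono J -> K) (j : J) : mono J -> K := fun c =>
  let b := madd c [ffun i => if i == j then N else 0%N] in
  if [pick i | N <= b i]%N == Some j then f b else 0.

Lemma tail_convergent N f j : convergentb f -> convergentb (tail_fun N f j).
Proof.
move=> /asboolP[r [M [r0 H]]]; apply/asboolP.
exists r, (M / r ^+ N); split=> // n.
rewrite ler_pdivlMr ?exprn_gt0 //.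
pose sh (c : mono J) : mono J := madd c [ffun i => if i == j then N else 0%N].
have shdeg c : mdeg (sh c) = (mdeg c + N)%N.
  rewrite mdegD; congr addn; rewrite /mdeg (bigD1 j) //= ffunE eqxx big1 ?addn0 //.
  by move=> i /negPf ij; rewrite ffunE ij.
have us : uniq (map sh (box J n)).
  rewrite map_inj_uniq ?box_uniq // => c d e.
  by apply/ffunP => i; move/ffunP: e => /(_ i); rewrite !ffunE => /addIn.
apply: le_trans (wnorm_le_seq (ltW r0) H us).
rewrite mulr_suml [leRHS]big_map; apply: ler_sum => c _.
rewrite -mulrA -exprD -shdeg ler_wpM2r ?exprn_ge0 ?(ltW r0) //.
by rewrite /tail_fun -/(sh c); case: ifP => // _; rewrite normr0.
Qed.

Definition tail N (f : cps K J) j : cps K J := Cps (tail_convergent N j (valP f)).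

Lemma coef_cmonoM (e : mono J) (f : cps K J) a :
  (cmono K e * f) a = if mle e a then f (msub a e) else 0.
Proof.
rewrite scoefM; case: ifP => ea.
  rewrite (bigD1_seq e) ?below_uniq ?mem_below //= /mono_fun eqxx mul1r.
  by rewrite big1 ?addr0 // => b /negPf be; rewrite be mul0r.
rewrite big1_seq // => b; rewrite mem_below /= => ba.
by rewrite /mono_fun; case: eqP => [be|]; rewrite ?mul0r // -be ba in ea *.
Qed.

Lemma cmonoD (b c : mono J) : cmono K (madd b c) = cmono K b * cmono K c.
Proof.
apply: cpsP => a; rewrite coef_cmonoM /= /mono_fun.
case: mleP => [/mleP ba|ba].
  by congr (nat_of_bool _)%:R; apply/eqP/eqP => [->|<-]; rewrite ?maddK ?msubK.
case: eqP => // aE; case: ba => i; rewrite aE ffunE leq_addr //.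
Qed.

Lemma cvarX (j : J) N : cvar K j ^+ N = cmono K [ffun i => if i == j then N else 0%N].
Proof.
elim: N => [|N IH].
  by rewrite expr0; congr cmono; apply/ffunP => i; rewrite !ffunE if_same.
rewrite exprS IH -cmonoD; congr cmono; apply/ffunP => i; rewrite !ffunE.
by case: eqP.
Qed.

Lemma split_tail N (f : cps K J) :
  f = \sum_(b <- box J N) f b *: cmono K b + \sum_j cvar K j ^+ N * tail N f j.
Proof.
apply: cpsP => a; rewrite scoefD !scoef_sum.
under [X in _ = _ + X]eq_bigr do rewrite cvarX coef_cmonoM.
have [aN|aN] := boolP (a \in box J N).
  rewrite (bigD1_seq a) ?box_uniq //.
  rewrite (big1 _ (fun b => b != a)) ?addr0 => [|b /negPf b0]; last first.
    by rewrite scoefZ /= /mono_fun eq_sym b0 mulr0.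
  rewrite scoefZ [cmono _ _ _]/= /mono_fun eqxx mulr1.
  rewrite [X in _ + X]big1 /= ?addr0 // => j _; case: mleP => // /(_ j); rewrite ffunE eqxx.
  by move: aN; rewrite mem_box => /forallP/(_ j); rewrite ltnNge => /negPf ->.
rewrite big1_seq ?add0r => [|b /andP[_ bN]]; last first.
  rewrite scoefZ /= /mono_fun; case: eqP => [ab|]; rewrite ?mulr0 //.
  by rewrite -ab (negPf aN) in bN.
have [i iP|nj] := pickP (fun i => N <= a i)%N; last first.
  by case/negP: aN; rewrite mem_box; apply/forallP => i; rewrite ltnNge nj.
have [j branch_ideal] : exists j, [pick i | N <= a i]%N = Some j.
  by case: pickP => [j|/(_ i)]; [exists j|rewrite iP].
have Nj : (N <= a j)%N by move: branch_ideal; case: pickP => // ? ? [<-].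
rewrite (bigD1 j) //= big1 ?addr0 => [|l lj].
  have -> : mle [ffun i0 => if i0 == j then N else 0%N] a.
    by apply/mleP => l; rewrite ffunE; case: eqP => [->|].
  rewrite /tail_fun /= maddC msubK ?branch_ideal ?eqxx //.
  by apply/mleP => l; rewrite ffunE; case: eqP => [->|].
case: ifP => // la; rewrite /= /tail_fun maddC msubK // branch_ideal.
by case: ifP => // /eqP[e]; rewrite e eqxx in lj.
Qed.

(** A morphism of K-algebras without continuity assumption is nevertheless a
    substitution: it is determined modulo the N-th power of the maximal ideal
    by the polynomial part of f, because the tails y_j ^+ N * r_j are sent to
    order at least N. *)
Lemma morph_coef (phi : {lrmorphism cps K J -> cps K I}) N f a :
  (forall j, phi (cvar K j) (mono0 I) = 0) -> (mdeg a < N)%N ->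
  phi f a = \sum_(b <- box J N) f b * mpower (fun j => phi (cvar K j)) b a.
Proof.
move=> p0 aN; rewrite {1}(split_tail N f) rmorphD scoefD.
rewrite !rmorph_sum !scoef_sum [X in _ + X]big1 ?addr0 => [|j _]; last first.
  rewrite rmorphM rmorphXn /=.
  have H := order_geX (m := N) (order_ge1 (p0 j)); rewrite mul1n in H.
  by apply: (order_geM H (@order_ge0 _ _ _)); rewrite addn0.
apply: eq_bigr => b _; rewrite /= linearZ scoefZ; congr (_ * coef _ a).
have [m bm] := ubnP (mdeg b); elim: m => // m IH in b bm *.
have [i ib|b0] := pickP (fun i => 0 < b i)%N; last first.
  have -> : b = mono0 J by apply/ffunP => i; have := b0 i; rewrite lt0n ffunE => /negbFE/eqP.
  by rewrite mpower0 -[cmono _ _]/(1 : cps K J) rmorph1.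
have ib1 : mle (mono1 i) b by apply/mleP => j; rewrite ffunE; case: eqP => // ->.
have d1 : mdeg b = (mdeg (mono1 i) + mdeg (msub b (mono1 i)))%N.
  by rewrite -mdegD msubK.
have d2 : (0 < mdeg (mono1 i))%N by rewrite (leq_trans _ (leq_mdeg _ i)) // ffunE eqxx.
set c := msub b (mono1 i) in d1 *.
have bE : b = madd (mono1 i) c by rewrite msubK.
rewrite bE cmonoD mpowerD rmorphM /= mpower1 (IH c) //.
by rewrite ltnS in bm; apply: leq_trans bm; rewrite d1 -addn1 addnC leq_add2r.
Qed.

End Uniqueness.

(** * Series in one variable and Weierstrass division *)

Section OneVariable.
Variable K : numFieldType.
Local Notation Kt := (cps K 'I_1).
Local Notation X := (cvar K (ord0 : 'I_1)).
Implicit Types f g u w : Kt.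

Definition tcoef f k := f (tmono k).
Arguments tcoef : simpl never.

Lemma tcoefP f g : (forall k, tcoef f k = tcoef g k) -> f = g.
Proof. by move=> fg; apply: cpsP => a; rewrite -(tmono_mdeg a); exact: fg. Qed.

Lemma tcoefD f g k : tcoef (f + g) k = tcoef f k + tcoef g k. Proof. by []. Qed.
Lemma tcoefB f g k : tcoef (f - g) k = tcoef f k - tcoef g k. Proof. by []. Qed.
Lemma tcoefZ (c : K) f k : tcoef (c *: f) k = c * tcoef f k. Proof. by []. Qed.
Lemma tcoef0 k : tcoef 0 k = 0. Proof. by []. Qed.
Lemma tcoef1 k : tcoef 1 k = (k == 0%N)%:R.
Proof.
rewrite /tcoef /= /mono_fun; congr (nat_of_bool _)%:R; apply/eqP/eqP => [|->].
  by move/ffunP/(_ ord0); rewrite !ffunE.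
by apply/ffunP => i; rewrite !ffunE.
Qed.
Lemma tcoef_sum (T : Type) (s : seq T) (P : pred T) (F : T -> Kt) k :
  tcoef (\sum_(t <- s | P t) F t) k = \sum_(t <- s | P t) tcoef (F t) k.
Proof. by apply: (big_morph (fun f => tcoef f k)). Qed.

Lemma tcoefM f g k : tcoef (f * g) k = \sum_(i < k.+1) tcoef f i * tcoef g (k - i).
Proof.
rewrite /tcoef (@scoefM_box _ _ k.+1) ?mdeg_tmono //.
rewrite sum_box_tmono; apply: eq_bigr => i _.
rewrite big_mkcond sum_box_tmono -big_mkcond /=.
have ki : (k - i < k.+1)%N by rewrite ltnS leq_subr.
rewrite (eq_bigl (pred1 (Ordinal ki))) ?big_pred1_eq // => j /=.
rewrite -val_eqE /=; apply/eqP/eqP => [/ffunP/(_ ord0)|->].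
  by rewrite !ffunE => e; apply/eqP; rewrite -(eqn_add2l i) e subnKC // -ltnS.
by apply/ffunP => l; rewrite !ffunE subnKC // -ltnS.
Qed.

Lemma tcoef0M f g : tcoef (f * g) 0 = tcoef f 0 * tcoef g 0.
Proof. by rewrite tcoefM big_ord1. Qed.

Lemma tcoef_mono0 f : f (mono0 'I_1) = tcoef f 0.
Proof. by rewrite /tcoef; congr (coef f); apply/ffunP => i; rewrite !ffunE. Qed.

Lemma order_geP f k : order_ge f k <-> forall i, (i < k)%N -> tcoef f i = 0.
Proof.
split=> [fk i ik|H a ak]; first by apply: fk; rewrite mdeg_tmono.
by rewrite -(tmono_mdeg a); apply: H.
Qed.

Lemma tcoef_XnM n f k : tcoef (X ^+ n * f) k = if (n <= k)%N then tcoef f (k - n) else 0.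
Proof.
rewrite cvarX /tcoef coef_cmonoM.
have -> : mle [ffun i => if i == ord0 then n else 0%N] (tmono k) = (n <= k)%N.
  apply/mleP/idP => [/(_ ord0)|nk i]; rewrite !ffunE ?eqxx //.
  by case: ifP.
case: ifP => // nk; congr (coef f); apply/ffunP => i.
by rewrite !ffunE ord1 eqxx.
Qed.

Lemma tcoef_Xn n k : tcoef (X ^+ n) k = (k == n)%:R.
Proof.
rewrite -[X ^+ n]mulr1 tcoef_XnM tcoef1; case: leqP => nk; first by rewrite subn_eq0 eqn_leq nk andbT.
by case: eqP => // e; rewrite e ltnn in nk.
Qed.

Lemma order_ge_Xn n f : order_ge (X ^+ n * f) n.
Proof. by apply/order_geP => i ni; rewrite tcoef_XnM leqNgt ni. Qed.

Lemma shift_convergent e f : convergentb (fun a : mono 'I_1 => tcoef f (mdeg a + e)).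
Proof.
have [r [M [r0 H]]] := convergent_wnorm f.
apply: (@geom_bound_convergent _ _ (M / r ^+ e) r^-1) => [|k].
  by rewrite invr_ge0 ltW.
rewrite mdeg_tmono exprVn -mulrA -invfM -exprD ler_pdivlMr ?exprn_gt0 //.
have := wnorm_le_coef (tmono (k + e)) (ltW r0) H; rewrite mdeg_tmono addnC //.
Qed.

Definition shift e f : Kt := Cps (shift_convergent e f).

Lemma tcoef_shift e f k : tcoef (shift e f) k = tcoef f (k + e).
Proof. by rewrite /tcoef /= mdeg_tmono. Qed.

Lemma wnorm_le_shift e f r M : 0 < r -> wnorm_le f r M -> wnorm_le (shift e f) r (M / r ^+ e).
Proof.
move=> r0 H N; rewrite ler_pdivlMr ?exprn_gt0 // sum_box_tmono mulr_suml.
have us : uniq [seq tmono (k + e) | k <- iota 0 N].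
  by rewrite map_inj_uniq ?iota_uniq // => k l /tmono_inj /addIn.
apply: le_trans (wnorm_le_seq (ltW r0) H us); rewrite big_map.
rewrite -[in iota 0 N](subn0 N) -/(index_iota 0 N) big_mkord.
apply: ler_sum => k _.
by rewrite -mulrA -exprD !mdeg_tmono; have := tcoef_shift e f k; rewrite /tcoef => ->.
Qed.

Lemma order_ge_shift e f : order_ge f e -> f = X ^+ e * shift e f.
Proof.
move=> /order_geP fe; apply: tcoefP => k; rewrite tcoef_XnM.
by case: leqP => ke; rewrite ?tcoef_shift ?subnK // fe.
Qed.

Lemma trunc_shift e f : f = \sum_(k < e) tcoef f k *: X ^+ k + X ^+ e * shift e f.
Proof.
apply: tcoefP => k; rewrite tcoefD tcoef_sum tcoef_XnM.
case: leqP => ke.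
  rewrite tcoef_shift subnK // big1 ?add0r // => i _.
  rewrite tcoefZ tcoef_Xn; case: eqP => [ki|]; last by rewrite mulr0.
  by rewrite ki leqNgt ltn_ord in ke.
rewrite (bigD1 (Ordinal ke)) //= tcoefZ tcoef_Xn eqxx mulr1 big1 ?addr0 // => i ik.
rewrite tcoefZ tcoef_Xn; case: eqP => [e1|]; last by rewrite mulr0.
by case/eqP: ik; apply: val_inj.
Qed.

(** A relation rather than a function, as 0 has no order. *)
Definition has_order f k := order_ge f k /\ tcoef f k <> 0.

Lemma has_order_ex f : f <> 0 -> exists k, has_order f k.
Proof.
move=> f0.
have [k kP] : exists k, tcoef f k != 0.
  apply: contra_notP f0 => H; apply: tcoefP => k; apply/eqP; rewrite tcoef0.
  by apply/negP => /negP h; apply: H; exists k.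
have ex : exists k, tcoef f k != 0 by exists k.
have [m m0 mmin] := ex_minnP ex.
exists m; split; last by apply/eqP.
apply/order_geP => i in_image; apply/eqP; rewrite -[_ == _]negbK; apply/negP => /mmin.
by rewrite leqNgt in_image.
Qed.

Lemma has_order_neq0 f k : has_order f k -> f <> 0.
Proof. by move=> [_ fk] f0; apply: fk; rewrite f0. Qed.

Lemma has_order_le f k m : has_order f k -> order_ge f m -> (m <= k)%N.
Proof. by move=> [_ fk] /order_geP fm; rewrite leqNgt; apply/negP => /fm. Qed.

Lemma has_order_uniq f k l : has_order f k -> has_order f l -> k = l.
Proof.
move=> fk fl; apply/eqP; rewrite eqn_leq.
by rewrite (has_order_le fl (proj1 fk)) (has_order_le fk (proj1 fl)).
Qed.

(** K{t} is a discrete valuation ring with uniformizer t. *)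
Lemma has_order_unit f k : has_order f k -> exists u v : Kt, f = X ^+ k * u /\ u * v = 1.
Proof.
move=> [fk0 fk]; have [v uv] : exists v, shift k f * v = 1.
  by apply: cps_inv; rewrite tcoef_mono0 tcoef_shift add0n; apply/eqP.
by exists (shift k f), v; split=> //; apply: order_ge_shift.
Qed.

Lemma has_order_div f g k : has_order f k -> order_ge g k -> exists h, g = f * h.
Proof.
move=> /has_order_unit[u [v [-> uv]]] /order_ge_shift ->.
exists (v * shift k g); rewrite mulrA -[_ * u * v]mulrA uv mulr1 //.
Qed.

Lemma has_orderM f g k l : has_order f k -> has_order g l -> has_order (f * g) (k + l).
Proof.
move=> [fk fk0] [gl gl0]; split; first exact: order_geM.
rewrite (order_ge_shift fk) (order_ge_shift gl) mulrACA -exprD tcoef_XnM leqnn subnn.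
rewrite tcoef0M !tcoef_shift !add0n => /eqP; rewrite mulf_eq0.
by move=> /orP[/eqP|/eqP].
Qed.

Lemma has_order_Xn n : has_order (X ^+ n) n.
Proof.
split; last by rewrite tcoef_Xn eqxx; apply/eqP/oner_neq0.
by apply/order_geP => i; rewrite tcoef_Xn ltn_neqAle => /andP[/negPf ->].
Qed.

Lemma Kt_domain f g : f * g = 0 -> f = 0 \/ g = 0.
Proof.
move=> fg; have [->|/eqP f0] := eqVneq f 0; first by left.
have [->|/eqP g0] := eqVneq g 0; first by right.
have [k fk] := has_order_ex f0; have [l gl] := has_order_ex g0.
by case: (has_order_neq0 (has_orderM fk gl)).
Qed.

Lemma has_order_div_ge f g v k : has_order f v -> order_ge g (v + k) ->
  exists h, g = f * h /\ order_ge h k.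
Proof.
move=> fv gk; have [h hE] := has_order_div fv (order_ge_le (leq_addr k v) gk).
exists h; split=> //; have [->//|/eqP h0] := eqVneq h 0.
have [l hl] := has_order_ex h0; apply: (order_ge_le _ (proj1 hl)).
by have := has_order_le (has_orderM fv hl); rewrite -hE => /(_ _ gk); rewrite leq_add2l.
Qed.

Lemma has_orderX f k n : has_order f k -> has_order (f ^+ n) (n * k).
Proof.
move=> fk; elim: n => [|n IH].
  by rewrite expr0 mul0n -[1](expr0 X); apply: has_order_Xn.
by rewrite exprS mulSn; apply: has_orderM.
Qed.

Lemma Kt_exp f k : f ^+ k = 0 -> f = 0.
Proof.
elim: k => [/eqP|k IH]; first by rewrite expr0 oner_eq0.
by rewrite exprS => /Kt_domain[].
Qed.

Lemma morph_comp_series (psi : {lrmorphism Kt -> Kt}) g :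
  tcoef (psi X) 0 = 0 -> (psi g : mono 'I_1 -> K) = comp_series g (psi X).
Proof.
move=> p0; apply/funext => a.
rewrite (@morph_coef _ _ _ _ (mdeg a).+1) //; last first.
  by move=> j; rewrite tcoef_mono0 (ord1 j).
rewrite sum_box_tmono; apply: eq_bigr => k _; congr (_ * coef _ a).
by rewrite /mpower big_ord1 ffunE.
Qed.

Lemma morph_trunc (psi : {lrmorphism Kt -> Kt}) g n : tcoef (psi X) 0 = 0 ->
  order_ge (psi g - \sum_(k < n) tcoef g k *: psi X ^+ k) n.
Proof.
move=> p0 a an; rewrite scoefB scoef_sum.
rewrite (@morph_coef _ _ _ _ n) //; last by move=> j; rewrite tcoef_mono0 (ord1 j).
apply/eqP; rewrite subr_eq0; apply/eqP.
rewrite sum_box_tmono; apply: eq_bigr => k _; rewrite scoefZ; congr (_ * coef _ a).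
by rewrite /mpower big_ord1 ffunE.
Qed.

Section Weierstrass.
Variables (u w : Kt) (e : nat).
Hypothesis uw : u * w = X ^+ e.

(** When u * w = X ^+ e, the series wstep f is the quotient of the division of f
    by u with remainder of degree < e. *)
Definition wstep f := w * shift e f.

Lemma wstepE f : f = \sum_(k < e) tcoef f k *: X ^+ k + u * wstep f.
Proof. by rewrite /wstep mulrA uw -trunc_shift. Qed.

(** Each division step multiplies the norm by at most the norm of w divided by
    r ^+ e, so the successive remainders grow at most geometrically. *)
Lemma wcoef_convergent f k :
  convergentb (fun a : mono 'I_1 => tcoef (iter (mdeg a) wstep f) k).
Proof.
have [r [M [r0 H]]] := wnorm_le_common (fun b : bool => if b then f else w).
have Hf := H true; have Hw := H false; rewrite /= in Hf Hw.
have M0 := wnorm_le_ge0 (ltW r0) Hf.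
pose C := M / r ^+ e.
have C0 : 0 <= C by rewrite divr_ge0 // exprn_ge0 // ltW.
have Hi i : wnorm_le (iter i wstep f) r (M * C ^+ i).
  elim: i => [|i IH]; first by rewrite expr0 mulr1.
  rewrite iterS exprS (_ : M * (C * C ^+ i) = M * (M * C ^+ i / r ^+ e)); last first.
    by rewrite /C; ring.
  by apply: wnorm_leM (ltW r0) Hw _; apply: wnorm_le_shift.
apply: (@geom_bound_convergent _ _ (M / r ^+ k) C) => // i.
rewrite mdeg_tmono -mulrAC ler_pdivlMr ?exprn_gt0 //.
by have := wnorm_le_coef (tmono k) (ltW r0) (Hi i); rewrite mdeg_tmono.
Qed.

Definition wcoef f k : Kt := Cps (wcoef_convergent f k).

Lemma tcoef_wcoef f k i : tcoef (wcoef f k) i = tcoef (iter i wstep f) k.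
Proof. by rewrite {1}/tcoef /= mdeg_tmono. Qed.

(** Iterating the division by u expands f in powers of u with remainders of
    degree < e as coefficients; collecting the powers of u gives e convergent
    series in u.  Modulo t^n only the first n steps matter. *)
Lemma weierstrass (psi : {lrmorphism Kt -> Kt}) f : psi X = u -> tcoef u 0 = 0 ->
  f = \sum_(k < e) psi (wcoef f k) * X ^+ k.
Proof.
move=> pX u0; apply: tcoefP => m; pose n := m.+1.
have fE i : f = \sum_(j < i) u ^+ j * (\sum_(k < e) tcoef (iter j wstep f) k *: X ^+ k) +
    u ^+ i * iter i wstep f.
  elim: i => [|i IH]; first by rewrite big_ord0 add0r expr0 mul1r.
  by rewrite big_ord_recr /= -addrA exprSr -mulrA -mulrDr -wstepE.
have un : order_ge (u ^+ n) n.
  by rewrite -[X in order_ge _ X]mul1n; apply: order_geX; apply: order_ge1; rewrite tcoef_mono0.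
have /order_geP h0 := order_geM un (@order_ge0 _ _ (iter n wstep f)).
rewrite {1}(fE n) tcoefD h0 ?addn0 // addr0.
rewrite (eq_bigr (fun j : 'I_n => \sum_(k < e) (tcoef (wcoef f k) j *: u ^+ j) * X ^+ k));
  last first.
  move=> j _; rewrite mulr_sumr; apply: eq_bigr => k _.
  by rewrite tcoef_wcoef -scalerAr -scalerAl.
rewrite exchange_big !tcoef_sum; apply: eq_bigr => k _.
rewrite -mulr_suml -pX; apply/eqP; rewrite eq_sym -subr_eq0 -tcoefB -mulrBl.
have := @morph_trunc psi (wcoef f k) n; rewrite pX => /(_ u0) h1.
by have /order_geP -> := order_geM h1 (@order_ge0 _ _ (X ^+ k)); rewrite ?addn0.
Qed.

End Weierstrass.

End OneVariable.

Arguments tcoef : simpl never.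

(** * Nakayama's lemma and the codimension of an image *)

Section Evaluation0.
Variables (K : numFieldType) (I : finType).
Definition ev0 (f : cps K I) : K := f (mono0 I).
Lemma ev0_zmod : zmod_morphism ev0. Proof. by []. Qed.
Lemma ev0_monoid : monoid_morphism ev0.
Proof. by split=> [|f g]; rewrite /ev0 ?Defs.coef0M // scoef1 eqxx. Qed.
HB.instance Definition _ := GRing.isZmodMorphism.Build _ _ ev0 ev0_zmod.
HB.instance Definition _ := GRing.isMonoidMorphism.Build _ _ ev0 ev0_monoid.
End Evaluation0.

Section QuotientDim.
Variables (K : fieldType) (V : lmodType K) (P : V -> Prop).
Hypothesis P_lin : forall c u v, P u -> P v -> P (c *: u + v).

Definition spans d (e : 'I_d -> V) : Prop :=
  forall v, exists c : 'I_d -> K, P (v - \sum_i c i *: e i).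

(** A spanning family of least cardinality is a basis: a nontrivial relation
    would allow one of its members to be dropped. *)
Lemma quotient_dim_le d0 (e : 'I_d0 -> V) : spans e ->
  exists2 d, (d <= d0)%N & quotient_dim (fun c (v : V) => c *: v) (fun=> True) P d.
Proof.
move=> he.
have ex : exists d, `[< exists e : 'I_d -> V, spans e >].
  by exists d0; apply/asboolP; exists e.
have [d /asboolP[f hf] dmin] := ex_minnP ex.
exists d; first by apply: dmin; apply/asboolP; exists e.
exists f; split=> // v _; have [c hc] := hf v.
exists (\row_i c i); split.
  by under eq_bigr do rewrite mxE.
move=> c' hc'; apply/rowP => i; apply: contrapT => ne.
pose del k := c k - c' 0 k.
have deli : del i != 0 by apply/eqP => /subr0_eq; rewrite mxE in ne.
have hdel : P (\sum_k del k *: f k).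
  have -> : \sum_k del k *: f k =
      (-1) *: (v - \sum_k c k *: f k) + (v - \sum_k c' 0 k *: f k).
    rewrite scaleN1r opprB addrA subrK /del.
    by rewrite -sumrB; apply: eq_bigr => k _; rewrite scalerBl.
  exact: P_lin.
case: d f hf dmin c hc c' hc' i ne del deli hdel => [|d] f hf dmin c hc c' hc' i ne del deli hdel.
  by case: (i).
have /dmin : `[< exists e : 'I_d -> V, spans e >]; last by rewrite ltnn.
apply/asboolP; exists (fun k => f (lift i k)) => w; have [b hb] := hf w.
exists (fun k => b (lift i k) - b i / del i * del (lift i k)).
have -> : w - \sum_k (b (lift i k) - b i / del i * del (lift i k)) *: f (lift i k) =
   (b i / del i) *: (\sum_k del k *: f k) + (w - \sum_k b k *: f k).
  rewrite !(bigD1_ord i) //= scalerDr scalerA mulfVK // scaler_sumr.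
  have -> : \sum_k (b (lift i k) - b i / del i * del (lift i k)) *: f (lift i k) =
     \sum_k b (lift i k) *: f (lift i k) -
     \sum_k (b i / del i) *: (del (lift i k) *: f (lift i k)).
    by rewrite -sumrB; apply: eq_bigr => k _; rewrite scalerBl scalerA.
  set s1 := \sum_k _; set s2 := \sum_k _.
  by rewrite opprB opprD [w + (- _ - _)]addrCA addrACA subrr add0r addrCA.
exact: P_lin.
Qed.

End QuotientDim.

Section Branches.
Variables (K : numFieldType) (I : finType) (r : nat).
Local Notation Kt := (cps K 'I_1).
Local Notation X := (cvar K (ord0 : 'I_1)).
Local Notation B := {ffun 'I_r.+1 -> Kt}.
Variable phi : {lrmorphism cps K I -> B}.

Definition branch j (g : cps K I) : Kt := phi g j.

Lemma branch_zmod j : zmod_morphism (branch j).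
Proof. by move=> f g; rewrite /branch rmorphB !ffunE. Qed.
Lemma branch_monoid j : monoid_morphism (branch j).
Proof.
by split=> [|f g]; rewrite /branch ?rmorph1 ?rmorphM !ffunE.
Qed.
Lemma branch_scalable j : scalable (branch j).
Proof. by move=> c f; rewrite /branch linearZ !ffunE. Qed.
HB.instance Definition _ j := GRing.isZmodMorphism.Build _ _ (branch j) (branch_zmod j).
HB.instance Definition _ j := GRing.isMonoidMorphism.Build _ _ (branch j) (branch_monoid j).
HB.instance Definition _ j := GRing.isScalable.Build K _ _ _ (branch j) (branch_scalable j).

Lemma branchP (b : B) g : (forall j, b j = branch j g) -> b = phi g.
Proof. by move=> H; apply/ffunP. Qed.

(** The vector (v t) solves a linear system with matrix 1 - x, whose determinant
    is a unit of the local ring; apply the adjugate.  Working on one branch at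
    a time, the same g serves all branches. *)
Lemma nakayama (T : finType) (v : T -> B) (x : T -> T -> cps K I) (al : T -> cps K I) :
  (forall t t', ev0 (x t t') = 0) ->
  (forall t, v t = phi (al t) + \sum_t' phi (x t t') * v t') ->
  forall t, exists g, v t = phi g.
Proof.
move=> x0 hv t; pose m := #|T|.
pose M : 'M[cps K I]_m := 1%:M - \matrix_(i, k) x (enum_val i) (enum_val k).
have /cps_inv[di dE] : (\det M) (mono0 I) != 0.
  rewrite -/(ev0 (\det M)) -det_map_mx.
  suff -> : map_mx (@ev0 K I) M = 1%:M by rewrite det1 oner_neq0.
  apply/matrixP => i k; rewrite !mxE rmorphB /= x0 subr0.
  by case: (i == k); rewrite ?rmorph0 ?rmorph1.
pose a : 'cV[cps K I]_m := \col_i al (enum_val i).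
exists (di * (\adj M *m a) (enum_rank t) 0); apply: branchP => j.
pose V : 'cV[Kt]_m := \col_i v (enum_val i) j.
have MV : map_mx (branch j) M *m V = map_mx (branch j) a.
  apply/matrixP => i k; rewrite !mxE.
  rewrite (eq_bigr (fun l => (i == l)%:R * v (enum_val l) j -
     branch j (x (enum_val i) (enum_val l)) * v (enum_val l) j)); last first.
    by move=> l _; rewrite !mxE rmorphB rmorph_nat mulrBl.
  rewrite sumrB (bigD1 i) //= eqxx mul1r big1 ?addr0; last first.
    by move=> l /negPf li; rewrite eq_sym li mul0r.
  rewrite {1}hv ffunE -addrA;
  suff -> : (\sum_t' phi (x (enum_val i) t') * v t') j =
     \sum_(l < m) branch j (x (enum_val i) (enum_val l)) * v (enum_val l) j.
    by rewrite subrr addr0.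
  rewrite sum_ffunE (reindex_onto (@enum_val T T) enum_rank) /=; last first.
    by move=> l _; rewrite enum_rankK.
  rewrite (eq_bigl predT) => [|l]; last by rewrite enum_valK eqxx.
  by apply: eq_bigr => l _; rewrite !ffunE.
have := congr1 (mulmx (map_mx (branch j) (\adj M))) MV.
rewrite mulmxA -!map_mxM mul_adj_mx => /matrixP/(_ (enum_rank t) 0).
rewrite map_scalar_mx mul_scalar_mx !mxE enum_rankK rmorphM /= => <-.
by rewrite mulrA -rmorphM mulrC [di * _]mulrC dE rmorph1 mulr1.
Qed.

(** Membership in the ideal t^k B. *)
Definition in_tpow k (b : B) := forall j, order_ge (b j) k.

(** E bounds the multiplicities of the branches: t^E B lies in the ideal of B
    generated by the coordinates. *)
Definition adapted E := (forall i j, tcoef (phi (cvar K i) j) 0 = 0) /\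
  forall j, exists i e, (0 < e <= E)%N /\ has_order (phi (cvar K i) j) e.

(** The generators t_j^(k+l), l < E, of t^k B as a module over K{x}. *)
Definition tgen k E (t : 'I_r.+1 * 'I_E) : B :=
  [ffun j => if j == t.1 then X ^+ (k + t.2) else 0].

Variable E : nat.
Hypothesis adE : adapted E.

Lemma tgen_span k b : in_tpow k b ->
  exists a : 'I_r.+1 * 'I_E -> cps K I, b = \sum_t phi (a t) * tgen k t.
Proof.
move=> bk.
have H j : exists a : 'I_E -> cps K I, b j = \sum_l branch j (a l) * X ^+ (k + l).
  have [x0 /(_ j)[i [e [/andP[e0 eE] ve]]]] := adE.
  pose u := phi (cvar K i) j.
  have [w uw] : exists w, X ^+ e = u * w.
    by apply: (has_order_div ve); exact: (has_order_Xn K e).1.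
  have [sb sbE] : exists sb : {lrmorphism Kt -> cps K I}, forall j', sb (cvar K j') = cvar K i.
    apply: subst_exists => _; rewrite /= /mono_fun; case: eqP => // /ffunP/(_ i).
    by rewrite !ffunE eqxx.
  pose psi : {lrmorphism Kt -> Kt} := [the {lrmorphism Kt -> Kt} of branch j \o sb].
  have pX : psi X = u by rewrite /= sbE.
  pose f := shift k (b j).
  have := weierstrass (esym uw) f pX (x0 i j) => fE.
  exists (fun l => if (l < e)%N then sb (wcoef w e f l) else 0).
  rewrite (order_ge_shift (bk j)) -/f {1}fE mulr_sumr.
  rewrite (big_ord_widen _ (fun l => X ^+ k * (psi (wcoef w e f l) * X ^+ l)) eE).
  rewrite [LHS]big_mkcond; apply: eq_bigr => l _; case: ifP => _.
    by rewrite mulrCA -exprD.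
  by rewrite rmorph0 mul0r.
have [a aP] := choice H.
exists (fun t => a t.1 t.2); apply/ffunP => j; rewrite sum_ffunE aP.
rewrite -(pair_bigA _ (fun j' l => (phi (a j' l) * tgen k (j', l)) j)) /=.
rewrite (bigD1 j) //= [X in _ = _ + X]big1 ?addr0 => [|j' jj'].
  by apply: eq_bigr => l _; rewrite !ffunE eqxx.
by rewrite big1 // => l _; rewrite !ffunE eq_sym (negPf jj') mulr0.
Qed.

(** On each branch, t^(k+E) is divisible by t^k times a coordinate. *)
Lemma tgen_span_max k b : in_tpow (k + E) b ->
  exists a : 'I_r.+1 * 'I_E -> cps K I,
    (forall t, ev0 (a t) = 0) /\ b = \sum_t phi (a t) * tgen k t.
Proof.
move=> bk; have [x0 ad] := adE.
have [i iP] := choice ad.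
have H j : exists h, b j = phi (cvar K (i j)) j * h /\ order_ge h k.
  have [e [/andP[e0 eE] ve]] := iP j.
  by apply: (has_order_div_ge ve); apply: order_ge_le (bk j); rewrite addnC leq_add2l.
have [h hP] := choice H.
have hk : in_tpow k [ffun j => h j] by move=> j; rewrite ffunE; case: (hP j).
have [a aE] := tgen_span hk.
exists (fun t => cvar K (i t.1) * a t); split=> [t|].
  rewrite rmorphM /= /ev0 /= /mono_fun; case: eqP => [/ffunP/(_ (i t.1))|]; rewrite ?mul0r //.
  by rewrite !ffunE eqxx.
apply/ffunP => j; have [-> _] := hP j.
have -> : h j = [ffun j => h j] j by rewrite ffunE.
rewrite aE !sum_ffunE mulr_sumr; apply: eq_bigr => t _.
rewrite !ffunE rmorphM ffunE; case: eqP => [->|]; rewrite ?mulr0 //.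
by rewrite mulrA.
Qed.

Lemma ideal_in_image k :
  (forall b, in_tpow k b -> exists g, in_tpow (k + E) (b - phi g)) ->
  forall b, in_tpow k b -> exists g, b = phi g.
Proof.
move=> H b bk.
have tgenk (t : 'I_r.+1 * 'I_E) : in_tpow k (tgen k t : B).
  move=> j; rewrite ffunE; case: ifP => // _.
  by rewrite exprD; apply: order_ge_Xn.
have Ht (t : 'I_r.+1 * 'I_E) : exists ax : cps K I * ('I_r.+1 * 'I_E -> cps K I),
   (forall t', ev0 (ax.2 t') = 0) /\
   tgen k t = phi ax.1 + \sum_t' phi (ax.2 t') * tgen k t'.
  have [g /tgen_span_max[a [a0 aE]]] := H _ (tgenk t).
  by exists (g, a); split=> //=; rewrite -aE addrC subrK.
have [ax axP] := choice Ht.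
have [g gP] := choice (nakayama (fun t t' => (axP t).1 t') (fun t => (axP t).2)).
have [a ->] := tgen_span bk.
exists (\sum_t a t * g t); rewrite rmorph_sum; apply: eq_bigr => t _.
by rewrite rmorphM gP.
Qed.

(** Pigeonhole: were all inclusions between the subspaces A + t^(E i) B,
    i <= d+1, strict, one vector picked in each difference would give d+1
    vectors independent modulo A + t^N B, a space of codimension at most d. *)
Lemma conductor_of_approx d (e : 'I_d -> B) N : (E * d.+1 <= N)%N ->
  (forall b, exists (c : 'I_d -> K) g, in_tpow N (b - \sum_i c i *: e i - phi g)) ->
  exists2 k, (k <= N)%N & forall b, in_tpow k b -> exists g, b = phi g.
Proof.
move=> dN H.
suff [i Hi] : exists i : 'I_d.+1, forall b, in_tpow (E * i) b -> exists g, in_tpow (E * i + E) (b - phi g).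
  exists (E * i)%N; last exact: ideal_in_image.
  by apply: leq_trans dN; rewrite leq_mul2l ltnW ?orbT // ltn_ord.
apply: contrapT => nH.
have Hv (i : 'I_d.+1) : exists v, in_tpow (E * i) v /\ ~ exists g, in_tpow (E * i + E) (v - phi g).
  apply: contrapT => h; apply: nH; exists i => b bi; apply: contrapT => h'.
  by apply: h; exists b.
have [v vP] := choice Hv.
have Hc (i : 'I_d.+1) : exists cg : ('I_d -> K) * cps K I,
    in_tpow N (v i - \sum_l cg.1 l *: e l - phi cg.2).
  by have [c [g h]] := H (v i); exists (c, g).
have [cg cgP] := choice Hc.
pose C : 'M[K]_(d.+1, d) := \matrix_(i, l) (cg i).1 l.
have [lam [lamC [j0 lj0]]] : exists lam : 'rV[K]_d.+1, lam *m C = 0 /\ exists j0, lam 0 j0 != 0.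
  have : kermx C != 0.
    rewrite kermx_eq0 /row_free neq_ltn; apply/orP; left.
    by rewrite ltnS rank_leq_col.
  move=> /matrix0Pn[i0 [j0 z0]]; exists (row i0 (kermx C)).
  by rewrite -row_mul mulmx_ker row0; split=> //; exists j0; rewrite mxE.
(* In a nontrivial relation modulo A + t^N B, the vector of least index is a
   combination of later ones, which lie in the next step of the filtration. *)
pose i1 := [arg min_(i < j0 | lam 0 i != 0) i].
have [li1 i1min] : lam 0 i1 != 0 /\ forall i, lam 0 i != 0 -> (i1 <= i)%N.
  by rewrite /i1; case: arg_minnP.
have [_ []] := vP i1.
pose c i := - (lam 0 i / lam 0 i1).
have cC l : \sum_i lam 0 i * (cg i).1 l = 0.
  by have /rowP/(_ l) := lamC; rewrite !mxE; under eq_bigr do rewrite mxE.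
exists ((lam 0 i1)^-1 *: \sum_i lam 0 i *: (cg i).2) => j.
have -> : v i1 - phi ((lam 0 i1)^-1 *: (\sum_i lam 0 i *: (cg i).2)) =
  (lam 0 i1)^-1 *: (\sum_i lam 0 i *: (v i - \sum_l (cg i).1 l *: e l - phi (cg i).2)
     - \sum_(i | i != i1) lam 0 i *: v i).
  rewrite linearZ /= rmorph_sum /=.
  have -> : \sum_i lam 0 i *: (v i - \sum_l (cg i).1 l *: e l - phi (cg i).2) =
     \sum_i lam 0 i *: v i - \sum_i lam 0 i *: phi (cg i).2.
    rewrite -sumrB; transitivity (\sum_i (lam 0 i *: v i - lam 0 i *: phi (cg i).2)
      - \sum_i \sum_l (lam 0 i * (cg i).1 l) *: e l).
      rewrite -sumrB; apply: eq_bigr => i _.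
      rewrite !scalerBr scaler_sumr addrAC; congr (_ - _).
      by apply: eq_bigr => l _; rewrite scalerA.
    rewrite exchange_big [X in _ - X]big1 ?subr0 // => l _.
    by rewrite -scaler_suml cC scale0r.
  rewrite [in RHS](bigD1 i1) //=.
  rewrite addrAC addrK.
  rewrite scalerBr scalerA mulVf // scale1r; congr (_ - _ *: _).
  by apply: eq_bigr => i _; rewrite linearZ.
rewrite !ffunE => a aE; rewrite scoefZ scoefB !sum_ffunE !scoef_sum.
rewrite big1 ?sub0r => [|i _].
  rewrite big1 ?oppr0 ?mulr0 // => i ii1; rewrite ffunE; rewrite scoefZ.
  have [->|li] := eqVneq (lam 0 i) 0; first by rewrite mul0r.
  have [vi _] := vP i; rewrite vi ?mulr0 //; apply: leq_trans aE _.
  rewrite -mulnSr leq_mul2l; apply/orP; right.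
  by rewrite ltn_neqAle i1min // andbT eq_sym.
rewrite ffunE scoefZ cgP ?mulr0 //; apply: leq_trans aE _; apply: leq_trans dN.
by rewrite -mulnSr leq_mul2l ltn_ord orbT.
Qed.

End Branches.

(** * Subrings of finite codimension in a product of power series rings *)

Section PrimeIdeals.
Variable R : comNzRingType.

Lemma prime_exp (Q : pred R) x k : prime_ideal Q -> x ^+ k \in Q -> x \in Q.
Proof.
move=> [[_ Q1 _] Qp]; elim: k => [|k IH]; first by rewrite expr0 (negPf Q1).
by rewrite exprS => /Qp/orP[].
Qed.

Lemma prime_prod (Q : pred R) (T : finType) (x : T -> R) :
  prime_ideal Q -> \prod_t x t \in Q -> exists t, x t \in Q.
Proof.
move=> [[_ Q1 _] Qp].
elim/big_ind: _ => [|a b IHa IHb /Qp/orP[/IHa|/IHb]//|t _ h]; last by exists t.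
by rewrite (negPf Q1).
Qed.

Lemma ideal_mul (Q : pred R) a x : prime_ideal Q -> x \in Q -> a * x \in Q.
Proof. by move=> [[Q0 _ Ql] _] xQ; rewrite -[a * x]addr0; apply: Ql. Qed.

Lemma ideal_add (Q : pred R) x y : prime_ideal Q -> x \in Q -> y \in Q -> x + y \in Q.
Proof. by move=> [[Q0 _ Ql] _] xQ yQ; rewrite -[x]mul1r; apply: Ql. Qed.

(** Nonconstant monic polynomials stay monic when a constant is subtracted. *)
Definition monic1 (p : {poly R}) := p \is monic /\ (1 < size p)%N.

Lemma monic1_XsubC c : monic1 ('X - c%:P).
Proof. by split; rewrite ?monicXsubC ?size_XsubC. Qed.

Lemma monic1M p q : monic1 p -> monic1 q -> monic1 (p * q).
Proof.
move=> [mp sp] [mq sq]; split; first exact: rpredM.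
rewrite size_Mmonic ?monic_neq0 //; first by lia.
Qed.

Lemma monic1X p n : monic1 p -> monic1 (p ^+ n.+1).
Proof.
move=> mp; elim: n => [|n IH]; first by rewrite expr1.
by rewrite exprS; apply: monic1M.
Qed.

Lemma monic1_prod n (p : 'I_n.+1 -> {poly R}) : (forall i, monic1 (p i)) ->
  monic1 (\prod_i p i).
Proof.
elim: n p => [|n IH] p H; first by rewrite big_ord1.
by rewrite big_ord_recl; apply: monic1M => //; apply: IH.
Qed.

Lemma monic1_subC p c : monic1 p -> p - c%:P \is monic.
Proof.
move=> [/monicP mp sp]; apply/monicP; rewrite lead_coefDl //.
by rewrite size_polyN (leq_ltn_trans (size_polyC_leq1 _)).
Qed.

End PrimeIdeals.

(** Here psi identifies R with a subring of B that contains t^N B; by psi_loc and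
    psi_unit, this subring is local and its nonunits are its elements with
    constant term 0. *)
Section FiniteCodim.
Variables (K : numFieldType) (r : nat) (R : comNzRingType).
Local Notation Kt := (cps K 'I_1).
Local Notation X := (cvar K (ord0 : 'I_1)).
Local Notation B := {ffun 'I_r.+1 -> Kt}.
Variables (psi : {rmorphism R -> B}) (kappa : {rmorphism K -> R}) (N : nat).
Hypothesis psi_inj : injective psi.
Hypothesis psi_kappa : forall c j, psi (kappa c) j = c *: 1.
Hypothesis psi_onto : forall b : B, in_tpow N b -> exists q, b = psi q.
Hypothesis psi_loc : forall q j j', tcoef (psi q j) 0 = tcoef (psi q j') 0.
Hypothesis psi_unit : forall q, tcoef (psi q ord0) 0 <> 0 -> exists q', q * q' = 1.

Lemma psi_eq0 q : (forall j, psi q j = 0) -> q = 0.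
Proof. by move=> h; apply: psi_inj; rewrite rmorph0; apply/ffunP => j; rewrite ffunE h. Qed.

Lemma psiM q q' j : psi (q * q') j = psi q j * psi q' j.
Proof. by rewrite rmorphM ffunE. Qed.

Lemma psiD q q' j : psi (q + q') j = psi q j + psi q' j.
Proof. by rewrite rmorphD ffunE. Qed.

Lemma psiB q q' j : psi (q - q') j = psi q j - psi q' j.
Proof. by rewrite rmorphB !ffunE. Qed.

Lemma psiX q n j : psi (q ^+ n) j = psi q j ^+ n.
Proof. by elim: n => [|n IH]; rewrite ?expr0 ?rmorph1 ?ffunE // !exprS psiM IH. Qed.

Lemma psi_prod (T : Type) (s : seq T) (F : T -> R) j :
  psi (\prod_(t <- s) F t) j = \prod_(t <- s) psi (F t) j.
Proof.
elim/big_rec2: _ => [|t x y _ <-]; first by rewrite rmorph1 ffunE.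
by rewrite psiM.
Qed.

Lemma psi_sum (T : Type) (s : seq T) (F : T -> R) j :
  psi (\sum_(t <- s) F t) j = \sum_(t <- s) psi (F t) j.
Proof. by rewrite rmorph_sum sum_ffunE. Qed.

Lemma Xn_neq0 n : X ^+ n <> 0 :> Kt.
Proof. exact: has_order_neq0 (has_order_Xn K n). Qed.

Lemma Kt_lreg (f g h : Kt) : f <> 0 -> f * g = f * h -> g = h.
Proof.
move=> f0 /eqP; rewrite -subr_eq0 -mulrBr => /eqP/Kt_domain[] // /eqP.
by rewrite subr_eq0 => /eqP.
Qed.

Lemma supported_on_branch j : exists h, forall j', psi h j' = if j' == j then X ^+ N.+1 else 0.
Proof.
have [|h hE] := @psi_onto [ffun j' => if j' == j then X ^+ N.+1 else 0].
  move=> j'; rewrite ffunE; case: ifP => // _.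
  by apply/order_geP => i iN; rewrite tcoef_Xn; case: eqP => // e; rewrite e ltnNge ltnW in iN.
by exists h => j'; rewrite -hE ffunE.
Qed.

Definition branch_ideal j : pred R := fun q => `[< psi q j = 0 >].
Definition max_ideal : pred R := fun q => `[< tcoef (psi q ord0) 0 = 0 >].

Lemma branch_idealP j q : reflect (psi q j = 0) (q \in branch_ideal j).
Proof. exact: asboolP. Qed.
Lemma max_idealP q : reflect (tcoef (psi q ord0) 0 = 0) (q \in max_ideal).
Proof. exact: asboolP. Qed.

Lemma branch_ideal_prime j : prime_ideal (branch_ideal j).
Proof.
split; first split.
- by apply/branch_idealP; rewrite rmorph0 ffunE.
- by apply/branch_idealP; rewrite rmorph1 ffunE; apply/eqP/oner_neq0.
- by move=> a u v /branch_idealP u0 /branch_idealP v0; apply/branch_idealP; rewrite psiD psiM u0 v0 mulr0 addr0.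
move=> u v /branch_idealP; rewrite psiM => /Kt_domain h.
by apply/orP; case: h => h; [left|right]; apply/branch_idealP.
Qed.

Lemma max_ideal_prime : prime_ideal max_ideal.
Proof.
split; first split.
- by apply/max_idealP; rewrite rmorph0 ffunE.
- by apply/max_idealP; rewrite rmorph1 ffunE tcoef1; apply/eqP/oner_neq0.
- by move=> a u v /max_idealP u0 /max_idealP v0; apply/max_idealP; rewrite psiD psiM tcoefD tcoef0M u0 v0 mulr0 addr0.
move=> u v /max_idealP; rewrite psiM tcoef0M => /eqP; rewrite mulf_eq0.
by move=> /orP h; apply/orP; case: h => /eqP h; [left|right]; apply/max_idealP.
Qed.

Lemma prime_sub_max_ideal (Q : pred R) : prime_ideal Q -> {subset Q <= max_ideal}.
Proof.
move=> pQ q qQ; apply/max_idealP; apply: contrapT => /psi_unit[q' e].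
have [[_ /negP Q1 _] _] := pQ; apply: Q1; rewrite -e mulrC; exact: ideal_mul.
Qed.

(** For f in the maximal ideal, a large power of f is divisible by g on branch j
    with a quotient in t^N K{t_j}, and that quotient comes from R.  Hence
    f^(v+N) lies in the ideal generated by g and the j-th kernel. *)
Lemma branch_ideal_dim1 (Q : pred R) j g : prime_ideal Q -> {subset branch_ideal j <= Q} ->
  g \in Q -> g \notin branch_ideal j -> {subset max_ideal <= Q}.
Proof.
move=> pQ jQ gQ /branch_idealP gj f /max_idealP f0.
have [v vg] := has_order_ex gj.
have f1 : order_ge (psi f j) 1 by apply: order_ge1; rewrite tcoef_mono0 (psi_loc _ j ord0).
have fX n : order_ge (psi f j ^+ n) n by rewrite -[X in order_ge _ X]mul1n; apply: order_geX.
have [h hE] := has_order_div vg (fX v).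
have [|q qE] := @psi_onto [ffun j' => if j' == j then h * psi f j ^+ N else 0].
  move=> j'; rewrite ffunE; case: ifP => // _.
  by rewrite -[N]add0n; apply: order_geM.
apply: (@prime_exp _ _ _ (v + N)) => //.
rewrite -[_ ^+ _](subrK (q * g)); apply: ideal_add => //; last exact: ideal_mul.
apply: jQ; apply/branch_idealP; rewrite psiB psiX psiM -qE ffunE eqxx.
by rewrite exprD hE -mulrA [h * _ * _]mulrC subrr.
Qed.

(** The product of elements taken from all the kernels is 0. *)
Lemma prime_contains_branch_ideal (Q : pred R) : prime_ideal Q -> exists j, {subset branch_ideal j <= Q}.
Proof.
move=> pQ; apply: contrapT => H.
have Hj j : exists q, q \in branch_ideal j /\ q \notin Q.
  apply: contrapT => h; apply: H; exists j => q qj.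
  by apply: contrapT => /negP nq; apply: h; exists q.
have [q qP] := choice Hj.
have q0 : \prod_j q j = 0.
  apply: psi_eq0 => j; rewrite psi_prod (bigD1 j) //=.
  by have [/branch_idealP -> _] := qP j; rewrite mul0r.
have [[Q0 _ _] _] := pQ.
have [j qj] : exists j, q j \in Q by apply: prime_prod => //; rewrite q0.
by have [_ /negP] := qP j.
Qed.

Lemma branch_ideal_incomparable j j' : {subset branch_ideal j <= branch_ideal j'} -> j = j'.
Proof.
move=> H; apply/eqP/negP => /negP jj'; have [h hE] := supported_on_branch j'.
have /H/branch_idealP : h \in branch_ideal j by apply/branch_idealP; rewrite hE (negPf jj').
by rewrite hE eqxx; exact: Xn_neq0.
Qed.

Lemma branch_ideal_minimal j : minimal_prime (branch_ideal j).
Proof.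
split; first exact: branch_ideal_prime.
move=> Q /prime_contains_branch_ideal[j' jQ] [Qj nQ]; apply: nQ.
have e : j' = j by apply: branch_ideal_incomparable => q /jQ/Qj.
by rewrite e in jQ.
Qed.

Lemma minimal_branch_ideal (P : pred R) : minimal_prime P -> exists j, P =i branch_ideal j.
Proof.
move=> [pP mP]; have [j jP] := prime_contains_branch_ideal pP; exists j.
have Pj : {subset P <= branch_ideal j}.
  by apply: contrapT => h; apply: (mP (branch_ideal j)); [exact: branch_ideal_prime|split].
by move=> q; apply/idP/idP => [/Pj|/jP].
Qed.

Lemma minimal_coheight1 (P : pred R) : minimal_prime P -> coheight1 P.
Proof.
move=> mP; have [j Pj] := minimal_branch_ideal mP; have [pP _] := mP.
have [h hE] := supported_on_branch j.
have hP : h \notin P by rewrite Pj; apply/branch_idealP; rewrite hE eqxx; exact: Xn_neq0.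
split.
  exists max_ideal; split; [exact: max_ideal_prime|split; first exact: prime_sub_max_ideal].
  move=> /(_ h) H; case/negP: hP; apply: H; apply/max_idealP; rewrite hE; case: ifP => //.
  by rewrite tcoef_Xn.
move=> [Q [Q' [pQ pQ' [PQ nQP] [QQ' nQ'Q]]]]; apply: nQ'Q => q /(prime_sub_max_ideal pQ').
suff H : {subset max_ideal <= Q} by exact: H.
have [g [gQ gP]] : exists g, g \in Q /\ g \notin P.
  apply: contrapT => h'; apply: nQP => g gQ; apply: contrapT => /negP gP.
  by apply: h'; exists g.
apply: (branch_ideal_dim1 (j := j) pQ _ gQ); last by rewrite -Pj.
by move=> x; rewrite -Pj => /PQ.
Qed.

Lemma curve_singularity_of_image : reduced_curve_singularity R r.+1.
Proof.
split; first 2 last.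
- exists branch_ideal; split; [exact: branch_ideal_minimal| |exact: minimal_branch_ideal].
  by move=> j j' e; apply: branch_ideal_incomparable => q; rewrite e.
- move=> a k ak; apply: psi_eq0 => j; apply: (@Kt_exp _ _ k).
  by rewrite -psiX ak rmorph0 ffunE.
- exact: minimal_coheight1.
Qed.

Lemma tofrac_inj : injective (@Defs.tofrac R).
Proof. by move=> a b /tpiP/eqP /=; rewrite !mulr1. Qed.

Lemma tofrac_inv (s : R) : GRing.rreg s -> exists si, Defs.tofrac s * si = 1.
Proof.
move=> sr; have rs : regb s by apply/asboolP.
exists (\pi_(tfrac R) (@TRatio _ (1, s) rs))%qT.
rewrite [LHS](_ : _ = tmul (Defs.tofrac s) (\pi_(tfrac R) (@TRatio _ (1, s) rs))%qT) //.
by rewrite tmulE; apply/tpiP/eqP => /=; ring.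
Qed.

Lemma tfrac_den (q : tfrac R) : exists a s, GRing.rreg s /\ q * Defs.tofrac s = Defs.tofrac a.
Proof.
elim/quotW: q => x; exists x.1, x.2; split; first exact: tratioP.
rewrite [LHS](_ : _ = tmul (\pi_(tfrac R) x)%qT (Defs.tofrac x.2)) //.
by rewrite tmulE; apply/tpiP/eqP => /=; ring.
Qed.

Lemma rreg_branch s j : GRing.rreg s -> psi s j <> 0.
Proof.
move=> sr sj; have [h hE] := supported_on_branch j.
have : h = 0.
  apply: sr; rewrite mul0r; apply: psi_eq0 => j'; rewrite psiM hE.
  by case: eqP => [->|]; rewrite ?sj ?mulr0 ?mul0r.
by move=> h0; have := hE j; rewrite h0 rmorph0 ffunE eqxx => /esym; exact: Xn_neq0.
Qed.

Lemma branch_rreg s : (forall j, psi s j <> 0) -> GRing.rreg s.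
Proof.
move=> s0 x y e; apply: psi_inj; apply/ffunP => j.
by apply: (Kt_lreg (s0 j)); rewrite ![psi s j * _]mulrC -!psiM e.
Qed.

(** An isomorphism of B with the integral closure of R in its total quotient
    ring, compatible with the embedding psi of R in B. *)
Definition normalization_map (io : B -> tfrac R) : Prop :=
  [/\ forall b b', io (b + b') = io b + io b',
      forall b b', io (b * b') = io b * io b',
      forall a, io (psi a) = Defs.tofrac a,
      injective io &
      forall q, integralOver (@Defs.tofrac R) q <-> exists b, q = io b].

(** With w in R the element equal to t^N on every branch, io b is the fraction
    t^N b / w.  An integral fraction has nonnegative order on each branch, so it
    comes from B.  Conversely, if c_j is the constant term of b on branch j, the
    product of the b - c_j has positive order everywhere, so its (N+1)-st power
    lies in R, which is an integral equation for b. *)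
Lemma normalization_exists : exists io, normalization_map io.
Proof.
pose xN : B := [ffun=> X ^+ N].
have xNB b : in_tpow N (xN * b) by move=> j; rewrite !ffunE; apply: order_ge_Xn.
have [w wE] : exists w, xN = psi w.
  by apply: psi_onto => j; rewrite ffunE -[X ^+ N]mulr1; apply: order_ge_Xn.
have [lift liftP] := choice (fun b => psi_onto (xNB b)).
have wr : GRing.rreg w by apply: branch_rreg => j; rewrite -wE ffunE; exact: Xn_neq0.
have [wi wwi] := tofrac_inv wr.
pose io b := Defs.tofrac (lift b) * wi.
have liftD b b' : lift (b + b') = lift b + lift b'.
  by apply: psi_inj; rewrite rmorphD -!liftP mulrDr.
have liftM b b' : lift (b * b') * w = lift b * lift b'.
  by apply: psi_inj; rewrite !rmorphM -!liftP -wE; apply/ffunP => j; rewrite !ffunE; ring.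
have liftA a : lift (psi a) = w * a by apply: psi_inj; rewrite rmorphM -liftP wE.
have ioD b b' : io (b + b') = io b + io b' by rewrite /io liftD rmorphD mulrDl.
have ioM b b' : io (b * b') = io b * io b'.
  have := congr1 Defs.tofrac (liftM b b'); rewrite /io !rmorphM /= => h.
  by rewrite mulrACA -h -mulrA [Defs.tofrac w * _]mulrA wwi mul1r.
have ioA a : io (psi a) = Defs.tofrac a by rewrite /io liftA rmorphM mulrAC wwi mul1r.
have io_inj : injective io.
  move=> b b' e; apply/ffunP => j.
  have le : lift b = lift b'.
    apply: tofrac_inj; rewrite -[LHS]mulr1 -[RHS]mulr1 -wwi.
    by rewrite mulrCA [RHS]mulrCA; congr (_ * _).
  have := liftP b; rewrite le -liftP => /ffunP/(_ j); rewrite !ffunE.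
  by move/(Kt_lreg (@Xn_neq0 N)).
have io0 : io 0 = 0 by rewrite -(rmorph0 psi) ioA rmorph0.
have io1 : io 1 = 1 by rewrite -(rmorph1 psi) ioA rmorph1.
have ioN b : io (- b) = - io b.
  by apply/eqP; rewrite -addr_eq0 -ioD addNr io0.
exists io; split=> // q; split=> [[p mp /rootP pq]|[b ->]].
  have [a [s [sr qs]]] := tfrac_den q.
  have [si ssi] := tofrac_inv sr.
  have s0 j : psi s j <> 0 by apply: rreg_branch.
  (* Clear denominators in the equation of q = a / s. *)
  pose n := (size p).-1.
  have pn : size p = n.+1 by rewrite prednK // lt0n size_poly_eq0 monic_neq0.
  have eq0 : \sum_(i < n.+1) p`_i * a ^+ i * s ^+ (n - i) = 0.
    apply: tofrac_inj; rewrite rmorph0 -[RHS](mul0r (Defs.tofrac s ^+ n)) -pq.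
    rewrite (@horner_coef_wide _ n.+1); last by rewrite -pn size_poly.
    rewrite mulr_suml rmorph_sum; apply: eq_bigr => i _.
    rewrite coef_map /= !rmorphM !rmorphXn /= -qs exprMn.
    have -> : Defs.tofrac s ^+ n = Defs.tofrac s ^+ i * Defs.tofrac s ^+ (n - i).
      by rewrite -exprD subnKC // -ltnS.
    by rewrite !mulrA.
  (* If a had smaller order than s on branch j, no term could cancel a^n. *)
  have H j : exists h, psi a j = psi s j * h.
    have [a0|/eqP a0] := eqVneq (psi a j) 0; first by exists 0; rewrite mulr0.
    have [al va] := has_order_ex a0; have [si' vs] := has_order_ex (s0 j).
    have [sa|as_] := leqP si' al; first by apply: (has_order_div vs); exact: order_ge_le sa (proj1 va).
    have := congr1 (fun x => psi x j) eq0; rewrite /= rmorph0 ffunE big_ord_recr /= psiD psi_sum.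
    have -> : p`_n = 1 by have /monicP := mp.
    rewrite mul1r subnn expr0 mulr1 psiX => /eqP; rewrite addrC addr_eq0 => /eqP ea.
    have [] := has_orderX n va; rewrite ea => _; rewrite /tcoef scoefN scoef_sum big1 ?oppr0 //.
    move=> i _; rewrite !psiM !psiX.
    have H1 := order_geM (order_geM (@order_ge0 _ _ (psi p`_i j)) (order_geX (m := i) (proj1 va)))
               (order_geX (m := (n - i)) (proj1 vs)).
    apply: H1; rewrite mdeg_tmono; have := ltn_ord i; nia.
  have [h hP] := choice H; exists [ffun j => h j].
  have e : io (psi a) = io (psi s) * io [ffun j => h j].
    by rewrite -ioM; congr io; apply/ffunP => j; rewrite hP !ffunE.
  by rewrite -[q]mulr1 -ssi mulrA qs -ioA e ioA mulrAC ssi mul1r.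
pose c j := kappa (tcoef (b j) 0).
pose bb : B := \prod_j (b - psi (c j)).
have bb1 j : order_ge (bb j) 1.
  apply: order_ge1; rewrite tcoef_mono0 /bb.
  have -> : (\prod_j0 (b - psi (c j0))) j = \prod_j0 (b j - psi (c j0) j).
    by elim/big_rec2: _ => [|t x y _ <-]; rewrite !ffunE.
  rewrite (bigD1 j) //=; rewrite tcoef0M tcoefB psi_kappa tcoefZ tcoef1 mulr1 subrr mul0r //.
have [d dE] : exists d, bb ^+ N.+1 = psi d.
  apply: psi_onto => j.
  have -> : (bb ^+ N.+1) j = bb j ^+ N.+1.
    by elim: (N.+1) => [|m IH]; rewrite ?expr0 ?ffunE // !exprS ffunE IH.
  apply: (@order_ge_le _ _ _ _ (1 * N.+1)); first by rewrite mul1n.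
  exact: order_geX.
exists ((\prod_j ('X - (c j)%:P)) ^+ N.+1 - d%:P).
  by apply: monic1_subC; apply: monic1X; apply: monic1_prod => j; apply: monic1_XsubC.
apply/rootP; rewrite rmorphB rmorphXn /= map_polyC rmorph_prod hornerD hornerN hornerC.
rewrite horner_exp horner_prod.
have -> : \prod_j (map_poly Defs.tofrac ('X - (c j)%:P)).[io b] = io bb.
  rewrite /bb; elim/big_rec2: _ => [|j x y _ ->]; first by rewrite io1.
  by rewrite rmorphB /= map_polyX map_polyC hornerXsubC ioM ioD ioN ioA.
have -> : io bb ^+ N.+1 = Defs.tofrac d.
  rewrite -ioA -dE; elim: (N.+1) => [|m IH]; first by rewrite !expr0 io1.
  by rewrite !exprS ioM IH.
by rewrite subrr.
Qed.

Lemma delta_eq_of_quotient_dim d :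
  quotient_dim (fun c (v : B) => c *: v) (fun=> True) (fun v => exists g, v = psi g) d ->
  delta_eq kappa d.
Proof.
move=> [e [_ eP]]; have [io [ioD ioM ioA io_inj ioI]] := normalization_exists.
have io0 : io 0 = 0 by rewrite -(rmorph0 psi) ioA rmorph0.
have ioN b : io (- b) = - io b.
  by apply/eqP; rewrite -addr_eq0 -ioD addNr io0.
have ioZ c b : io (c *: b) = Defs.tofrac (kappa c) * io b.
  by rewrite -ioA -ioM; congr io; apply/ffunP => j; rewrite !ffunE psi_kappa -scalerAl mul1r.
have key b (c : 'rV[K]_d) : io (b - \sum_i c 0 i *: e i) =
    io b - \sum_i Defs.tofrac (kappa (c 0 i)) * io (e i).
  rewrite ioD ioN (big_morph io ioD io0); congr (_ - _).
  by apply: eq_bigr => i _; rewrite ioZ.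
exists (fun i => io (e i)); split=> [i|v /ioI[b ->]]; first by apply/ioI; exists (e i).
have [c [[g hg] cu]] := eP b I.
exists c; split; first by exists g; rewrite -key hg ioA.
move=> c' [g']; rewrite -key -ioA => /io_inj hg'; apply: cu; by exists g'.
Qed.

End FiniteCodim.

(** * A single primitive branch *)

Section Bundle.
Variables (K : numFieldType) (I : finType) (r : nat).
Local Notation Kt := (cps K 'I_1).
Variable p : 'I_r.+1 -> {lrmorphism cps K I -> Kt}.
Definition bundle (f : cps K I) : {ffun 'I_r.+1 -> Kt} := [ffun j => p j f].
Lemma bundle_zmod : zmod_morphism bundle.
Proof. by move=> f g; apply/ffunP => j; rewrite !ffunE rmorphB. Qed.
Lemma bundle_monoid : monoid_morphism bundle.
Proof. by split=> [|f g]; apply/ffunP => j; rewrite !ffunE ?rmorph1 ?rmorphM. Qed.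
Lemma bundle_scalable : scalable bundle.
Proof. by move=> c f; apply/ffunP => j; rewrite !ffunE linearZ. Qed.
Lemma bundleE f j : bundle f j = p j f. Proof. exact: ffunE. Qed.
HB.instance Definition _ := GRing.isZmodMorphism.Build _ _ bundle bundle_zmod.
HB.instance Definition _ := GRing.isMonoidMorphism.Build _ _ bundle bundle_monoid.
HB.instance Definition _ := GRing.isScalable.Build K _ _ _ bundle bundle_scalable.
End Bundle.

Section OneBranch.
Variables (K : numFieldType) (I : finType).
Local Notation Kt := (cps K 'I_1).
Local Notation X := (cvar K (ord0 : 'I_1)).
Variable phi : {lrmorphism cps K I -> Kt}.
Hypothesis x0 : forall i, tcoef (phi (cvar K i)) 0 = 0.
Hypothesis xneq0 : exists i, phi (cvar K i) <> 0.

Definition in_image f := exists g, f = phi g.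
Lemma in_imageM f g : in_image f -> in_image g -> in_image (f * g).
Proof. by move=> [a ->] [b ->]; exists (a * b); rewrite rmorphM. Qed.
Lemma in_imageB f g : in_image f -> in_image g -> in_image (f - g).
Proof. by move=> [a ->] [b ->]; exists (a - b); rewrite rmorphB. Qed.
Lemma in_imageZ (c : K) f : in_image f -> in_image (c *: f).
Proof. by move=> [a ->]; exists (c *: a); rewrite linearZ. Qed.
Lemma in_image1 : in_image 1. Proof. by exists 1; rewrite rmorph1. Qed.
Lemma in_imageX f n : in_image f -> in_image (f ^+ n).
Proof.
move=> fi; elim: n => [|n IH]; first by rewrite expr0; exact: in_image1.
by rewrite exprS; apply: in_imageM.
Qed.

(** If k and k+1 are orders of elements of the image, so is every m >= k^2:
    write m = k s + l with l < k and take a^l b^(s-l), or a^m when k = 0.  Subtracting multiples of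
    such elements approximates any f of order >= k^2 by the image up to an
    arbitrary power of t, which is enough for ideal_in_image. *)
Lemma conductor_of_consecutive a b k : in_image a -> in_image b -> has_order b k -> has_order a k.+1 ->
  exists c, forall f, order_ge f c -> in_image f.
Proof.
move=> ia ib vb va.
have vals m : (k * k <= m)%N -> exists2 f, in_image f & has_order f m.
  move=> km; have [k0|kp] := posnP k.
    exists (a ^+ m); first exact: in_imageX.
    by have := has_orderX m va; rewrite k0 muln1.
  have st : (m %% k <= m %/ k)%N.
    by apply: ltnW; apply: leq_trans (ltn_pmod m kp) _; rewrite leq_divRL.
  exists (a ^+ (m %% k) * b ^+ (m %/ k - m %% k)); first by apply: in_imageM; apply: in_imageX.
  have := has_orderM (has_orderX (m %% k) va) (has_orderX (m %/ k - m %% k) vb).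
  suff -> : (m %% k * k.+1 + (m %/ k - m %% k) * k)%N = m by [].
  by rewrite mulnS -addnA -mulnDl subnKC // addnC -divn_eq.
have approx f m : order_ge f (k * k) -> exists g, order_ge (f - phi g) (k * k + m).
  move=> fk; elim: m => [|m [g gm]]; first by exists 0; rewrite rmorph0 subr0 addn0.
  have [h [hg hE] vh] := vals (k * k + m)%N (leq_addr _ _).
  pose c := tcoef (f - phi g) (k * k + m) / tcoef h (k * k + m).
  exists (g + c *: hg); apply/order_geP => i; rewrite addnS ltnS leq_eqVlt.
  rewrite rmorphD /= linearZ /= -hE opprD addrA tcoefB tcoefZ.
  case/orP => [/eqP ->|ilt].
    by rewrite /c divfK ?subrr //; case: vh => _ /eqP.
  have /order_geP gm' := gm; rewrite gm' //.
  by have [/order_geP hm _] := vh; rewrite hm // mulr0 subr0.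
have [i xi] := xneq0; have [e ve] := has_order_ex xi.
have e0 : (0 < e)%N by rewrite lt0n; apply/eqP => e0; case: ve => _; rewrite e0 x0.
pose phi1 : {lrmorphism cps K I -> {ffun 'I_1 -> Kt}} :=
  [the {lrmorphism cps K I -> {ffun 'I_1 -> Kt}} of bundle (fun _ : 'I_1 => phi)].
have ad : adapted phi1 e.
  split=> [i' j|j]; first by rewrite /= bundleE.
  by exists i, e; rewrite e0 leqnn /= bundleE.
have step b' : in_tpow (k * k) b' -> exists g, in_tpow (k * k + e) (b' - phi1 g).
  move=> /(_ ord0)/(approx _ e)[g hg]; exists g => j.
  by rewrite !ffunE (ord1 j).
exists (k * k)%N => f fk.
have fB : in_tpow (k * k) ([ffun=> f] : {ffun 'I_1 -> Kt}) by move=> j; rewrite ffunE.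
have [g gE] := ideal_in_image ad step fB.
by exists g; move/ffunP: gE => /(_ ord0); rewrite ffunE /= bundleE.
Qed.

Hypothesis phi_prim : forall (psi : {lrmorphism cps K I -> Kt}) (tau : Kt),
    tau (mono0 'I_1) = 0 ->
    (forall i, phi (cvar K i) = comp_series (psi (cvar K i)) tau :> (mono 'I_1 -> K)) ->
    order1 tau.

(** Membership in the intersection of K{t} with the fraction field of the
    image. *)
Definition in_frac f := exists y, [/\ y <> 0, in_image y & in_image (y * f)].

(** Let q be the least positive difference of orders and tau a quotient of order
    q.  Division by tau preserves in_frac and leaves constant remainders, so
    every phi(x_i) is a power series in tau, and primitivity gives q = 1. *)
Lemma primitive_consecutive : exists a b k, [/\ in_image a, in_image b, has_order b k & has_order a k.+1].
Proof.
have [i xi] := xneq0; have [e ve] := has_order_ex xi.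
have e0 : (0 < e)%N by rewrite lt0n; apply/eqP => e0; case: ve => _; rewrite e0 x0.
pose D d := exists a b k, [/\ in_image a, in_image b, has_order b k, has_order a (k + d) & (0 < d)%N].
have exD : exists d, `[< D d >].
  exists e; apply/asboolP; exists (phi (cvar K i)), 1, 0%N; split=> //.
  - by exists (cvar K i).
  - exact: in_image1.
  - by rewrite -[1](expr0 X); apply: has_order_Xn.
have [q /asboolP[a [b [k [ia ib vb va q0]]]] qmin] := ex_minnP exD.
have [tau tE] : exists tau, a = b * tau.
  by apply: (has_order_div vb); apply: order_ge_le (proj1 va); rewrite leq_addr.
have vt : has_order tau q.
  have t0 : tau <> 0 by move=> t0; apply: (has_order_neq0 va); rewrite tE t0 mulr0.
  have [q' vq'] := has_order_ex t0; have := has_orderM vb vq'; rewrite -tE => /(has_order_uniq va).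
  by move/addnI => ->.
have fracB f g : in_frac f -> in_frac g -> in_frac (f - g).
  move=> [y [y0 iy iyf]] [z [z0 iz izg]]; exists (y * z); split; last first.
  - rewrite (_ : y * z * (f - g) = z * (y * f) - y * (z * g)); last by ring.
    by apply: in_imageB; apply: in_imageM.
  - exact: in_imageM.
  - by move/Kt_domain => [].
have fracC (c : K) : in_frac (c *: 1).
  exists 1; split; [by apply/eqP/oner_neq0|exact: in_image1|].
  by rewrite mul1r; apply/in_imageZ/in_image1.
(* Euclidean division: v %% q would be a smaller positive difference. *)
have frac_order f v : in_frac f -> has_order f v -> (q %| v)%N.
  move=> [y [y0 iy iyf]] vf; have [vy vyP] := has_order_ex y0.
  apply/eqP; apply: contrapT => /eqP; rewrite -lt0n => rho0.
  suff : (q <= v %% q)%N by rewrite leqNgt ltn_pmod.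
  apply: qmin; apply/asboolP; pose m := (v %/ q)%N.
  exists (y * f * b ^+ m), (y * a ^+ m), (vy + m * (k + q))%N; split=> //.
  - by apply: in_imageM => //; apply: in_imageX.
  - by apply: in_imageM => //; apply: in_imageX.
  - exact: has_orderM vyP (has_orderX m va).
  - have := has_orderM (has_orderM vyP vf) (has_orderX m vb).
    suff -> : (vy + v + m * k = vy + m * (k + q) + v %% q)%N by [].
    by rewrite {1}(divn_eq v q) -/m mulnDr; lia.
have frac_tcoef f l : in_frac f -> (0 < l < q)%N -> tcoef f l = 0.
  move=> ff /andP[l0 lq].
  have ff' := fracB _ _ ff (fracC (tcoef f 0)).
  have -> : tcoef f l = tcoef (f - tcoef f 0 *: 1) l.
    by rewrite tcoefB tcoefZ tcoef1 (gtn_eqF l0) mulr0 subr0.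
  have [->|/eqP f0] := eqVneq (f - tcoef f 0 *: 1) 0; first by rewrite tcoef0.
  have [v vv] := has_order_ex f0.
  have v0 : (0 < v)%N.
    rewrite lt0n; apply/eqP => v0; case: vv => _.
    by rewrite v0 tcoefB tcoefZ tcoef1 mulr1 subrr.
  have /order_geP -> // := proj1 vv.
  by apply: leq_trans lq _; apply: dvdn_leq => //; exact: frac_order ff' vv.
have [w wE] : exists w, X ^+ q = tau * w.
  by apply: (has_order_div vt); exact: (has_order_Xn K q).1.
have uw := esym wE.
(* The remainder of f is f(0), so the quotient is (f - f(0)) / tau. *)
have frac_step f : in_frac f -> in_frac (wstep w q f).
  move=> ff; have := fracB _ _ ff (fracC (tcoef f 0)).
  have -> : f - tcoef f 0 *: 1 = tau * wstep w q f.
    rewrite {1}(wstepE uw f) -(prednK q0) big_ord_recl big1 => [|l _].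
      by rewrite addr0 expr0 addrAC subrr add0r.
    by rewrite frac_tcoef ?scale0r //= /bump leq0n add1n -ltn_predRL ltn_ord.
  move=> [y [y0 iy iyf]]; exists (y * a); split.
  - by move/Kt_domain => [//|]; exact: has_order_neq0 va.
  - exact: in_imageM.
  - rewrite tE (_ : y * (b * tau) * _ = b * (y * (tau * wstep w q f))); last by ring.
    exact: in_imageM.
have frac_iter f m : in_frac f -> in_frac (iter m (wstep w q) f).
  by move=> ff; elim: m => //= m; apply: frac_step.
have tau0 : tcoef tau 0 = 0 by have /order_geP := proj1 vt; apply.
have [sb sbE] : exists sb : {lrmorphism Kt -> Kt}, forall j, sb (cvar K j) = tau.
  by apply: subst_exists => _; rewrite tcoef_mono0.
(* In the expansion in powers of tau, only constants occur. *)
have wcoefE f : in_frac f -> f = sb (wcoef w q f 0).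
  move=> ff; rewrite {1}(weierstrass uw f (sbE ord0) tau0).
  rewrite -(prednK q0) big_ord_recl /= expr0 mulr1 big1 ?addr0 // => l _.
  suff -> : wcoef w q.-1.+1 f (bump 0 l) = 0 by rewrite rmorph0 mul0r.
  apply: tcoefP => m; rewrite tcoef_wcoef tcoef0 prednK // frac_tcoef //; first exact: frac_iter.
  by rewrite /bump leq0n add1n -ltn_predRL ltn_ord.
have frac_x i' : in_frac (phi (cvar K i')).
  exists 1; split; [by apply/eqP/oner_neq0|exact: in_image1|].
  by rewrite mul1r; exists (cvar K i').
have [psi psiE] : exists psi : {lrmorphism cps K I -> Kt}, forall i',
    psi (cvar K i') = wcoef w q (phi (cvar K i')) 0.
  by apply: subst_exists => i'; rewrite tcoef_mono0 tcoef_wcoef /= x0.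
have [_ t1] : order1 tau.
  apply: (phi_prim (psi := psi)); first by rewrite tcoef_mono0.
  move=> i'; rewrite psiE -(sbE ord0) -morph_comp_series ?sbE //.
  by rewrite -(wcoefE _ (frac_x i')).
have q1 : q = 1%N.
  apply/eqP; rewrite eqn_leq q0 andbT leqNgt; apply/negP => q1; apply: t1.
  have /order_geP/(_ _ q1) := proj1 vt; rewrite /tcoef => <-; congr (coef tau).
  by apply/ffunP => l; rewrite !ffunE ord1.
by exists a, b, k; split=> //; rewrite -addn1 -q1.
Qed.

Lemma primitive_conductor : exists c, forall f, order_ge f c -> in_image f.
Proof.
have [a [b [k [ia ib vb va]]]] := primitive_consecutive.
exact: conductor_of_consecutive ia ib vb va.
Qed.

End OneBranch.

(** * Several branches and the local ring of the curve *)

Section Conductor.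
Variables (K : numFieldType) (I : finType) (r : nat).
Local Notation Kt := (cps K 'I_1).
Local Notation X := (cvar K (ord0 : 'I_1)).
Local Notation B := {ffun 'I_r.+1 -> Kt}.
Variable phi : {lrmorphism cps K I -> B}.
Hypothesis x0 : forall i j, tcoef (phi (cvar K i) j) 0 = 0.
Hypothesis xneq0 : forall j, exists i, phi (cvar K i) j <> 0.

(** If the kernel of branch j' were contained in that of branch j, take g in the
    second but not in the first.  A large power of each coordinate x_i is
    divisible by g on branch j' with a quotient in the image, hence congruent
    to a multiple of g modulo the kernel of j', so it vanishes on branch j; then
    x_i vanishes on branch j for all i. *)
Lemma separate_branches j j' :
  (exists c, forall f, order_ge f c -> in_image (branch phi j') f) ->
  ~ (forall g, phi g j = 0 <-> phi g j' = 0) ->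
  exists h, phi h j' = 0 /\ phi h j <> 0.
Proof.
move=> [c cP] ne; apply: contrapT => H.
have sub h : branch phi j' h = 0 -> branch phi j h = 0.
  by move=> h0; apply: contrapT => hj; apply: H; exists h.
apply: ne => g; split; last exact: sub.
move=> gj; apply: contrapT => gj'.
have [v vg] := has_order_ex gj'; have [i xi] := xneq0 j.
have xv : order_ge (branch phi j' (cvar K i) ^+ (v + c)) (v + c).
  by rewrite -[X in order_ge _ X]mul1n; apply: order_geX; apply: order_ge1; rewrite tcoef_mono0 [tcoef _ _]x0.
have [h [hE /cP[q qE]]] := has_order_div_ge vg xv.
apply: xi; apply: (@Kt_exp _ _ (v + c)).
have : branch phi j (cvar K i ^+ (v + c) - g * q) = 0.
  by apply: sub; rewrite rmorphB rmorphXn rmorphM /= hE qE subrr.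
by rewrite rmorphB rmorphXn rmorphM /= {2}/branch gj mul0r subr0.
Qed.

(** With h_j nonzero on branch j only, multiples of the h_j fill up a power of t
    on every branch independently. *)
Lemma conductor_of_branches :
  (forall j, exists c, forall f, order_ge f c -> in_image (branch phi j) f) ->
  (forall j j', j <> j' -> ~ (forall g, phi g j = 0 <-> phi g j' = 0)) ->
  exists N, forall b, in_tpow N b -> exists g, b = phi g.
Proof.
move=> cond dist.
have Hh j : exists h, branch phi j h <> 0 /\ forall j', j' != j -> branch phi j' h = 0.
  have H1 j' : exists h, branch phi j h <> 0 /\ (j' != j -> branch phi j' h = 0).
    have [->|jj'] := eqVneq j' j.
      by exists 1; rewrite rmorph1; split=> //; apply/eqP/oner_neq0.
    have [h [h1 h2]] := separate_branches (cond j') (dist j j' (nesym (elimN eqP jj'))).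
    by exists h.
  have [h hP] := choice H1; exists (\prod_j' h j'); split=> [|j' jj'].
    rewrite rmorph_prod; elim/big_ind: _ => [|f g f0 g0 /Kt_domain[]//|j' _].
      by apply/eqP/oner_neq0.
    by case: (hP j').
  by rewrite rmorph_prod (bigD1 j') //= (hP j').2 // mul0r.
have [h hP] := choice Hh.
have [v vP] := choice (fun j => has_order_ex (hP j).1).
have [c cP] := choice cond.
exists (\sum_j (v j + c j))%N => b bN.
have Hg j : exists g, b j = branch phi j (h j * g).
  have bj : order_ge (b j) (v j + c j).
    by apply: order_ge_le (bN j); rewrite (bigD1 j) //= leq_addr.
  have [f [fE /cP[g gE]]] := has_order_div_ge (vP j) bj.
  by exists g; rewrite rmorphM /= fE gE.
have [g gP] := choice Hg.
exists (\sum_j h j * g j); apply: branchP => j.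
rewrite rmorph_sum (bigD1 j) //= big1 ?addr0 // => j' jj'.
by rewrite rmorphM /= (hP j').2 ?mul0r // eq_sym.
Qed.

End Conductor.

Section CurveRing.
Variables (K : numFieldType) (n r : nat).
Local Notation Kx := (cps K 'I_n).
Local Notation Kt := (cps K 'I_1).
Local Notation B := {ffun 'I_r.+1 -> Kt}.
Variable phi : {lrmorphism Kx -> B}.

Lemma param_conductor : parameterization phi -> primitive phi ->
  exists N, forall b, in_tpow N b -> exists g, b = phi g.
Proof.
move=> [p1 p2 p3] prim.
have x0 i j : tcoef (phi (cvar K i) j) 0 = 0 by rewrite -tcoef_mono0 p1.
apply: conductor_of_branches => // j.
apply: (@primitive_conductor _ _ (branch phi j)) => [i|| psi tau]; [exact: x0|exact: p2|exact: prim].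
Qed.

(** Morphisms to K{t} preserve constant terms, so the image is local. *)
Lemma tcoef0_phi : (forall i j, tcoef (phi (cvar K i) j) 0 = 0) ->
  forall g j, tcoef (phi g j) 0 = ev0 g.
Proof.
move=> x0 g j; rewrite -tcoef_mono0 -/(branch phi j g).
rewrite (@morph_coef _ _ _ _ 1) ?mdeg0 // => [|i]; last by rewrite tcoef_mono0 [tcoef _ _]x0.
by rewrite box1 big_seq1 mpower0 scoef1 eqxx mulr1.
Qed.

(** The isomorphism of the quotient by the kernel with the image. *)
Definition OC_embed (q : OC phi) : B := phi (repr q).

Lemma OC_embed_pi g : OC_embed (\pi_(OC phi) g)%qT = phi g.
Proof.
apply/eqP; rewrite -subr_eq0 -rmorphB /=.
suff : (repr (\pi_(OC phi) g)%qT - g) \in kerp phi by rewrite unfold_in.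
by rewrite Quotient.idealrBE; apply/eqP; rewrite reprK.
Qed.

Lemma OC_embed_zmod : zmod_morphism OC_embed.
Proof.
move=> p q; rewrite -[p]reprK -[q]reprK -rmorphB !OC_embed_pi rmorphB //.
Qed.
Lemma OC_embed_monoid : monoid_morphism OC_embed.
Proof.
split=> [|p q]; first by rewrite -(rmorph1 \pi_(OC phi)%qT) OC_embed_pi rmorph1.
by rewrite -[p]reprK -[q]reprK -rmorphM !OC_embed_pi rmorphM.
Qed.
HB.instance Definition _ := GRing.isZmodMorphism.Build _ _ OC_embed OC_embed_zmod.
HB.instance Definition _ := GRing.isMonoidMorphism.Build _ _ OC_embed OC_embed_monoid.

Lemma OC_embed_inj : injective OC_embed.
Proof.
move=> p q e; rewrite -[p]reprK -[q]reprK; apply/eqP; rewrite -Quotient.idealrBE.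
by rewrite unfold_in /kerp rmorphB /= subr_eq0; apply/eqP.
Qed.

Hypothesis x0 : forall i j, tcoef (phi (cvar K i) j) 0 = 0.
Variable N : nat.
Hypothesis cond : forall b, in_tpow N b -> exists g, b = phi g.

Lemma curve_ring_of_conductor :
  reduced_curve_singularity (OC phi) r.+1 /\
  forall d, quotient_dim (fun c (v : B) => c *: v) (fun=> True) (fun v => exists g, v = phi g) d ->
     delta_eq (scalarC phi) d.
Proof.
have onto b : in_tpow N b -> exists q, b = OC_embed q.
  by move=> /cond[g ->]; exists (\pi_(OC phi) g)%qT; rewrite OC_embed_pi.
have loc q j j' : tcoef (OC_embed q j) 0 = tcoef (OC_embed q j') 0 by rewrite /OC_embed !tcoef0_phi.
have unit q : tcoef (OC_embed q ord0) 0 <> 0 -> exists q', q * q' = 1.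
  rewrite /OC_embed tcoef0_phi // => /eqP/cps_inv[g gE]; exists (\pi_(OC phi) g)%qT.
  by rewrite -{1}[q]reprK -rmorphM /= gE rmorph1.
have kap c j : OC_embed (scalarC phi c) j = c *: 1.
  rewrite /= OC_embed_pi linearZ ffunE; congr (_ *: _).
  by rewrite rmorph1 ffunE.
split; first exact: (curve_singularity_of_image OC_embed_inj onto loc unit).
move=> d [e [eT eP]].
apply: (delta_eq_of_quotient_dim OC_embed_inj kap onto).
exists e; split=> // v vT; have [c [[g gE] cu]] := eP v vT.
exists c; split; first by exists (\pi_(OC phi) g)%qT; rewrite gE /= OC_embed_pi.
by move=> c' [q qE]; apply: cu; exists (repr q).
Qed.

Lemma spanned_codim d0 (e : 'I_d0 -> B) :
  (forall b, exists (c : 'I_d0 -> K) g, b - \sum_i c i *: e i = phi g) ->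
  exists2 d, (d <= d0)%N &
   quotient_dim (fun c (v : B) => c *: v) (fun=> True) (fun v => exists g, v = phi g) d.
Proof.
move=> H; apply: (@quotient_dim_le _ _ (fun v => exists g, v = phi g) _ d0 e).
  by move=> c u v [g ->] [h ->]; exists (c *: g + h); rewrite linearP.
by move=> b; have [c [g gE]] := H b; exists c, g.
Qed.

(** The monomials t_j^k with k < N span B modulo t^N B. *)
Lemma finite_codim : exists d0 (e : 'I_d0 -> B),
  forall b, exists (c : 'I_d0 -> K) g, b - \sum_i c i *: e i = phi g.
Proof.
pose T : finType := ('I_r.+1 * 'I_N)%type.
exists #|T|, (fun i => let t : 'I_r.+1 * 'I_N := @enum_val T T i in [ffun j => if j == t.1 then cvar K ord0 ^+ t.2 else 0]) => b.
exists (fun i => let t : 'I_r.+1 * 'I_N := @enum_val T T i in tcoef (b t.1) t.2).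
apply: cond => j; apply/order_geP => k kN.
rewrite !ffunE tcoefB sum_ffunE tcoef_sum.
rewrite (reindex_onto (@enum_rank T) (@enum_val T T)) /=; last first.
  by move=> l _; rewrite enum_valK.
rewrite (eq_bigl predT) => [|t]; last by rewrite enum_rankK eqxx.
rewrite (bigD1 (j, Ordinal kN)) //= !ffunE enum_rankK eqxx tcoefZ tcoef_Xn eqxx mulr1.
rewrite big1 ?addr0 ?subrr // => t tj; rewrite !ffunE enum_rankK tcoefZ.
case: eqP => [jt|]; last by rewrite tcoef0 mulr0.
rewrite tcoef_Xn; case: eqP => [kt|]; last by rewrite mulr0.
case/eqP: tj; rewrite (surjective_pairing t) jt; congr pair; exact: val_inj.
Qed.

End CurveRing.

(** * Values of power series near the origin *)

Section Complete.
Variable K : numFieldType.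
(** The form of completeness that power series need: the partial sums converge
    geometrically.  It is kept apart from the complex numbers so that the rest
    applies to an abstract field. *)
Definition geometrically_complete := forall (u : nat -> K) (C : K), 0 <= C ->
  (forall m n, (m <= n)%N -> `|u n - u m| <= C * 2%:R^-1 ^+ m) ->
  exists L, forall m, `|L - u m| <= 2%:R * C * 2%:R^-1 ^+ m.
Definition half_archimedean := forall C e : K, 0 <= C -> 0 < e ->
  exists n, C * 2%:R^-1 ^+ n <= e.
End Complete.

(** The intervals of radius C / 2^n around u n pairwise intersect; the supremum
    of their left ends belongs to all of them. *)
Lemma real_geometric_cauchy (R : realType) (u : nat -> R) (C : R) :
  (forall m n, (m <= n)%N -> `|u n - u m| <= C * 2%:R^-1 ^+ m) ->
  exists L, forall m, `|L - u m| <= C * 2%:R^-1 ^+ m.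
Proof.
move=> H; pose E : set R := [set x | exists n, x = u n - C * 2%:R^-1 ^+ n]%classic.
have hub m : ubound E (u m + C * 2%:R^-1 ^+ m).
  have C0 k : 0 <= C * 2%:R^-1 ^+ k by apply: le_trans (normr_ge0 _) (H k k (leqnn k)).
  move=> _ [n ->]; have [mn|nm] := leqP m n.
    have := H m n mn; rewrite ler_norml => /andP[_ h].
    by have := C0 n; lra.
  have := H n m (ltnW nm); rewrite ler_norml => /andP[h _].
  by have := C0 m; lra.
have E0 : nonempty E by exists (u 0%N - C * 2%:R^-1 ^+ 0), 0%N.
exists (sup E) => m; rewrite ler_distl; apply/andP; split.
  by apply: ub_le_sup; [exists (u 0%N + C * 2%:R^-1 ^+ 0); exact: hub|exists m].
exact: ge_sup.
Qed.

Section ComplexComplete.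
Variable R : realType.
Local Open Scope complex_scope.

Lemma ge0_complexE (x : R[i]) : 0 <= x -> x = (complex.Re x)%:C.
Proof. by case: x => a b; rewrite lecE /= => /andP[/eqP -> _]. Qed.

Lemma normc_Im (x : R[i]) : (`|complex.Im x|%:C <= `|x|).
Proof.
case: x => a b; rewrite normc_def lecR /= -sqrtr_sqr.
by rewrite ler_wsqrtr // lerDr sqr_ge0.
Qed.

Lemma half_real n : (2%:R^-1 ^+ n : R[i]) = (2%:R^-1 ^+ n)%:C.
Proof. by rewrite rmorphXn rmorphV ?unitfE ?pnatr_eq0 //= rmorph_nat. Qed.

Lemma complex_complete : geometrically_complete R[i].
Proof.
move=> u C C0 H; have CE := ge0_complexE C0; set c := complex.Re C in CE.
have bnd (g : {additive R[i] -> R}) : (forall x, `|g x|%:C <= `|x|) ->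
    exists L, forall m, `|L - g (u m)| <= c * 2%:R^-1 ^+ m.
  move=> gP; apply: real_geometric_cauchy => m n mn.
  rewrite -raddfB -lecR; apply: le_trans (gP _) _; apply: le_trans (H m n mn) _.
  by rewrite CE half_real rmorphM.
have [a aP] := bnd (@complex.Re R) (fun x => @normc_ge_Re R x).
have [b bP] := bnd (@complex.Im R) normc_Im.
exists (a +i* b) => m.
have -> : (a +i* b) - u m = (a - complex.Re (u m))%:C + (0 +i* 1) * (b - complex.Im (u m))%:C.
  by case: (u m) => x y; simpc.
apply: le_trans (ler_normD _ _) _.
have ni : `|0 +i* 1 : R[i]| = 1 by rewrite normc_def /= expr0n add0r expr1n sqrtr1.
rewrite normrM ni mul1r -mulrA mulr_natl mulr2n CE half_real -rmorphM.
apply: lerD; rewrite normc_def /= expr0n addr0 sqrtr_sqr lecR; [exact: aP|exact: bP].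
Qed.

Lemma complex_half_archi : half_archimedean R[i].
Proof.
move=> C e C0 e0; have CE := ge0_complexE C0; have eE := ge0_complexE (ltW e0).
set c := complex.Re C in CE; set d := complex.Re e in eE.
have d0 : 0 < d by rewrite -ltcR -eE.
have c0 : 0 <= c by rewrite -lecR -CE.
exists (Num.bound (c / d)); rewrite CE eE half_real -rmorphM lecR.
rewrite exprVn ler_pdivrMr ?exprn_gt0 ?ltr0n // mulrC -ler_pdivrMr //.
apply: le_trans (ltW (archi_boundP _)) _; first by rewrite divr_ge0 // ltW.
by rewrite -natrX ler_nat ltnW // ltn_expl.
Qed.
End ComplexComplete.

Section Values.
Variable K : numFieldType.
Hypothesis Kc : geometrically_complete K.
Hypothesis Ka : half_archimedean K.
Variable I : finType.
Implicit Types (f g : mono I -> K) (s : I -> K).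

Definition mono_val s (a : mono I) : K := \prod_i s i ^+ a i.
Definition psum f s N : K := \sum_(a <- box I N) f a * mono_val s a.

Lemma mono_valD s a b : mono_val s (madd a b) = mono_val s a * mono_val s b.
Proof. by rewrite /mono_val -big_split; apply: eq_bigr => i _; rewrite ffunE exprD. Qed.

Lemma norm_mono_val s a rho : (forall i, `|s i| <= rho) -> `|mono_val s a| <= rho ^+ mdeg a.
Proof.
move=> H; rewrite /mono_val /mdeg normr_prod -prodrXr.
apply: ler_prod => i _; rewrite normr_ge0 normrX /= lerXn2r // nnegrE //.
exact: le_trans (H i).
Qed.

Lemma peval_limit f s L : (forall e, 0 < e -> exists N0, forall N, (N0 <= N)%N ->
  `|L - psum f s N| <= e) -> peval f s = L.
Proof.
move=> H; apply: cvg_lim; first exact: norm_hausdorff.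
apply/cvgrPdist_le => e /H[N0 N0P]; exists N0 => // N /= NN; exact: N0P.
Qed.

Lemma peval_eq f s L C : 0 <= C ->
  (forall N, `|L - psum f s N| <= C * 2%:R^-1 ^+ N) -> peval f s = L.
Proof.
move=> C0 H; apply: peval_limit => e e0; have [N0 hN] := Ka C0 e0.
exists N0 => N NN; apply: le_trans (H N) _; apply: le_trans hN.
rewrite ler_wpM2l // ler_wiXn2l ?invr_ge0 ?ler0n // invf_le1 ?ltr0n //.
by rewrite ler1n.
Qed.

Section Bound.
Variables (f : mono I -> K) (s : I -> K) (rho M th : K).
Hypotheses (r0 : 0 < rho) (fM : wnorm_le f rho M) (th0 : 0 <= th) (th1 : th <= 2%:R^-1).
Hypothesis sP : forall i, `|s i| <= th * rho.

Lemma term_bound a : `|f a * mono_val s a| <= `|f a| * rho ^+ mdeg a * th ^+ mdeg a.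
Proof.
rewrite normrM -mulrA -exprMn [rho * th]mulrC ler_wpM2l //; exact: norm_mono_val.
Qed.

Lemma theta_le1 : th <= 1.
Proof. by apply: le_trans th1 _; rewrite invf_le1 ?ltr0n // ler1n. Qed.

(** The terms outside the box of size m have degree at least m, so each is
    smaller by a factor th ^+ m than at radius rho. *)
Lemma psum_tail m n : (m <= n)%N -> `|psum f s n - psum f s m| <= M * th ^+ m.
Proof.
move=> mn.
have -> : psum f s n - psum f s m = \sum_(a <- box I n | a \notin box I m) f a * mono_val s a.
  have -> : psum f s m = \sum_(a <- box I n | a \in box I m) f a * mono_val s a.
    rewrite -[RHS]big_filter; apply: perm_big; apply: uniq_perm; rewrite ?filter_uniq ?box_uniq //.
    by move=> a; rewrite mem_filter andb_idr // => /boxS; apply.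
  by rewrite /psum (bigID (fun a => a \in box I m)) /= addrAC subrr add0r.
apply: le_trans (ler_norm_sum _ _ _) _.
apply: (@le_trans _ _ (\sum_(a <- box I n) `|f a| * rho ^+ mdeg a * th ^+ m)).
  rewrite [leLHS]big_mkcond; apply: ler_sum => a _; case: ifP => [am|_]; last first.
    by rewrite !mulr_ge0 ?exprn_ge0 // ltW.
  apply: le_trans (term_bound a) _.
  rewrite ler_wpM2l ?mulr_ge0 ?exprn_ge0 ?(ltW r0) // ler_wiXn2l ?theta_le1 //.
  by rewrite leqNgt; apply: contra am => /box_mdeg.
by rewrite -mulr_suml ler_wpM2r // exprn_ge0.
Qed.

Lemma peval_bound N : `|peval f s - psum f s N| <= M * th ^+ N.
Proof.
have M0 := wnorm_le_ge0 (ltW r0) fM.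
have th12 m : th ^+ m <= 2%:R^-1 ^+ m by rewrite lerXn2r ?nnegrE ?invr_ge0 ?ler0n.
have [L LP] := @Kc (psum f s) M M0 (fun m n mn =>
  le_trans (psum_tail mn) (ler_wpM2l M0 (th12 m))).
have C0 : 0 <= 2%:R * M by rewrite mulr_ge0 // ler0n.
rewrite (peval_eq C0 LP).
apply/ler_addgt0Pr => e e0; have [n0 hn] := Ka C0 e0.
pose n := maxn n0 N.
rewrite -(subrK (psum f s n) L) -addrA addrC.
apply: le_trans (ler_normD _ _) _; apply: lerD.
  by apply: psum_tail; rewrite leq_maxr.
apply: le_trans (LP n) _; apply: le_trans hn.
rewrite ler_wpM2l // ler_wiXn2l ?invr_ge0 ?ler0n ?leq_maxl //.
by rewrite invf_le1 ?ltr0n // ler1n.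
Qed.

Lemma psum_le N : `|psum f s N| <= M.
Proof.
apply: le_trans (ler_norm_sum _ _ _) _; apply: le_trans (fM N).
apply: ler_sum => a _; apply: le_trans (term_bound a) _.
by rewrite ler_piMr ?mulr_ge0 ?exprn_ge0 ?(ltW r0) // exprn_ile1 ?theta_le1.
Qed.

Lemma peval_le : `|peval f s| <= 2%:R * M.
Proof.
rewrite -(subrK (psum f s 0) (peval f s)) mulr_natl mulr2n.
apply: le_trans (ler_normD _ _) _; apply: lerD; last exact: psum_le.
by have := peval_bound 0; rewrite mulr1.
Qed.

(** The case N = 1 of the tail estimate; with th proportional to the size of s
    it is the continuity of f at 0. *)
Lemma peval_near0 : `|peval f s - f (mono0 I)| <= M * th.
Proof.
have := peval_bound 1; rewrite expr1 /psum box1 big_seq1 /mono_val big1 ?mulr1 //.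
by move=> i _; rewrite ffunE.
Qed.

End Bound.

Lemma peval0 f : convergentb f -> peval f (fun=> 0) = f (mono0 I).
Proof.
move=> /asboolP[rho [M [r0 fM]]]; apply/eqP; rewrite -subr_eq0 -normr_le0.
have := @peval_near0 f (fun=> 0) rho M 0 r0 fM (lexx _); rewrite mulr0; apply.
  by rewrite invr_ge0 ler0n.
by move=> i; rewrite normr0 mul0r.
Qed.

Section Algebra.
Variables (s : I -> K) (rho : K).
Hypothesis r0 : 0 < rho.
Hypothesis sP : forall i, `|s i| <= 2%:R^-1 * rho.

Let h0 : 0 <= 2%:R^-1 :> K. Proof. by rewrite invr_ge0 ler0n. Qed.

Lemma pevalD f g M M' : wnorm_le f rho M -> wnorm_le g rho M' ->
  peval (f + g) s = peval f s + peval g s.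
Proof.
move=> fM gM; have M0 := wnorm_le_ge0 (ltW r0) fM; have M0' := wnorm_le_ge0 (ltW r0) gM.
apply: (@peval_eq _ _ _ (M + M')) => [|N]; first exact: addr_ge0.
have -> : psum (f + g) s N = psum f s N + psum g s N.
  by rewrite /psum -big_split; apply: eq_bigr => a _; rewrite /= mulrDl.
rewrite opprD addrACA mulrDl; apply: le_trans (ler_normD _ _) _.
apply: lerD.
  exact: (peval_bound r0 fM h0 (lexx _) sP).
exact: (peval_bound r0 gM h0 (lexx _) sP).
Qed.

(** The product of the partial sums of f and g differs from the partial sum of
    the product by terms of degree at least N. *)
Lemma pevalM f g M M' : wnorm_le f rho M -> wnorm_le g rho M' ->
  peval (conv f g) s = peval f s * peval g s.
Proof.
move=> fM gM; have M0 := wnorm_le_ge0 (ltW r0) fM; have M0' := wnorm_le_ge0 (ltW r0) gM.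
have MM : 0 <= M * M' by rewrite mulr_ge0.
apply: (@peval_eq _ _ _ (4%:R * (M * M'))) => [|N]; first by rewrite mulr_ge0 ?ler0n.
pose d b c := f b * g c * mono_val s (madd b c).
have E : psum f s N * psum g s N - psum (conv f g) s N =
   \sum_(b <- box I N) \sum_(c <- box I N | madd b c \notin box I N) d b c.
  have -> : psum (conv f g) s N =
      \sum_(b <- box I N) \sum_(c <- box I N | madd b c \in box I N) d b c.
    rewrite -sum_box_below; apply: eq_bigr => a _; rewrite /conv mulr_suml.
    rewrite big_seq [RHS]big_seq; apply: eq_bigr => b.
    by rewrite mem_below /d => ba; rewrite msubK.
  rewrite /psum mulr_suml -sumrB; apply: eq_bigr => b _.
  rewrite mulr_sumr (bigID (fun c => madd b c \in box I N)) /=.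
  rewrite addrAC -sumrB big1 ?add0r => [|c _]; last first.
    by rewrite /d mono_valD mulrACA subrr.
  by apply: eq_bigr => c _; rewrite /d mono_valD mulrACA.
have B1 : `|psum f s N * psum g s N - psum (conv f g) s N| <= M * M' * 2%:R^-1 ^+ N.
  rewrite E; pose u b := `|f b| * rho ^+ mdeg b; pose v b := `|g b| * rho ^+ mdeg b.
  have u0 b : 0 <= u b by rewrite mulr_ge0 ?exprn_ge0 ?(ltW r0).
  have v0 b : 0 <= v b by rewrite mulr_ge0 ?exprn_ge0 ?(ltW r0).
  apply: (@le_trans _ _ (\sum_(b <- box I N) \sum_(c <- box I N) u b * v c * 2%:R^-1 ^+ N)).
    apply: le_trans (ler_norm_sum _ _ _) _; apply: ler_sum => b _.
    apply: le_trans (ler_norm_sum _ _ _) _; rewrite [leLHS]big_mkcond.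
    apply: ler_sum => c _; case: ifP => [bc|_]; last first.
      by rewrite mulr_ge0 ?exprn_ge0 // mulr_ge0.
    rewrite /d !normrM.
    apply: le_trans (ler_wpM2l _ (norm_mono_val (madd b c) sP)) _; first by rewrite mulr_ge0.
    have -> : u b * v c = `|f b| * `|g c| * rho ^+ mdeg (madd b c).
      by rewrite /u /v mulrACA -exprD -mdegD.
    rewrite exprMn [leRHS]mulrC mulrCA.
    rewrite ler_wpM2r ?mulr_ge0 ?exprn_ge0 ?(ltW r0) // ler_wiXn2l //.
      by rewrite invf_le1 ?ltr0n // ler1n.
    by rewrite leqNgt; apply: contra bc => /box_mdeg.
  rewrite (eq_bigr (fun b => u b * (\sum_(c <- box I N) v c) * 2%:R^-1 ^+ N)); last first.
    by move=> b _; rewrite mulr_sumr mulr_suml.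
  rewrite -!mulr_suml ler_wpM2r ?exprn_ge0 //; apply: ler_pM.
  - exact: sumr_ge0.
  - exact: sumr_ge0.
  - exact: fM.
  - exact: gM.
have -> : peval f s * peval g s - psum (conv f g) s N =
   peval f s * (peval g s - psum g s N) + (peval f s - psum f s N) * psum g s N +
   (psum f s N * psum g s N - psum (conv f g) s N) by ring.
apply: le_trans (ler_normD _ _) _.
have -> : 4%:R * (M * M') * 2%:R^-1 ^+ N =
   (2%:R * M * (M' * 2%:R^-1 ^+ N) + M * 2%:R^-1 ^+ N * M') + M * M' * 2%:R^-1 ^+ N by ring.
apply: lerD => //; apply: le_trans (ler_normD _ _) _; rewrite !normrM; apply: lerD.
  apply: ler_pM => //; first exact: (peval_le r0 fM h0 (lexx _) sP).
  exact: (peval_bound r0 gM h0 (lexx _) sP).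
apply: ler_pM => //; first exact: (peval_bound r0 fM h0 (lexx _) sP).
exact: (psum_le r0 gM h0 (lexx _) sP).
Qed.

Lemma peval_0 : peval (0 : mono I -> K) s = 0.
Proof.
apply: (@peval_eq _ _ _ 0) => // N; rewrite mul0r sub0r normrN /psum big1 ?normr0 //.
by move=> a _; rewrite /= mul0r.
Qed.

End Algebra.
End Values.

(** * Specialization of a family of series *)

Section Near.
Variables (K : numFieldType) (I : finType).

Definition near0 : set_system (I -> K) :=
  filter_from [set e : K | 0 < e]%classic (fun e => [set s | forall i, `|s i| < e]%classic).

Global Instance near0_filter : Filter near0.
Proof.
apply: filter_from_filter; first by exists 1; exact: ltr01.
move=> e d /= e0 d0; have ed : 0 < e + d by rewrite addr_gt0.
exists (e * d / (e + d)); first by rewrite /= divr_gt0 // mulr_gt0.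
move=> s /= sP; split=> i; apply: lt_le_trans (sP i) _; rewrite ler_pdivrMr //.
  by rewrite ler_pM2l // lerDr ltW.
by rewrite mulrC ler_pM2l // lerDl ltW.
Qed.

Lemma near0_small (e : K) : 0 < e -> \forall s \near near0, forall i, `|s i| <= e.
Proof. by move=> e0; exists e => // s /= sP i; apply: ltW. Qed.

Lemma near0P (P : (I -> K) -> Prop) : (\forall s \near near0, P s) ->
  exists e : K, 0 < e /\ forall s, (forall i, `|s i| < e) -> P s.
Proof. by move=> [e e0 eP]; exists e; split=> // s sP; apply: eP. Qed.

Local Notation Kt := (cps K 'I_1).

(** Coefficientwise convergence as s tends to 0. *)
Definition tcoef_cvg (f : (I -> K) -> Kt) (f0 : Kt) :=
  forall k, (tcoef (f s) k @[s --> near0] --> tcoef f0 k)%classic.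

Lemma tcoef_cvgM f f0 g g0 : tcoef_cvg f f0 -> tcoef_cvg g g0 -> tcoef_cvg (fun s => f s * g s) (f0 * g0).
Proof.
move=> ff gg k; under eq_cvg do rewrite tcoefM; rewrite tcoefM.
by apply: cvg_big => [|i _]; [exact: add_continuous|apply: cvgM].
Qed.

Lemma tcoef_cvg_mpower (J : finType) (h : J -> (I -> K) -> Kt) (h0 : J -> Kt) b :
  (forall j, tcoef_cvg (h j) (h0 j)) -> tcoef_cvg (fun s => mpower (h^~ s) b) (mpower h0 b).
Proof.
move=> H; rewrite /mpower; elim: (index_enum J) => [|j js IH] k.
  by rewrite big_nil; under eq_cvg do rewrite big_nil; exact: cvg_cst.
rewrite big_cons; under eq_cvg do rewrite big_cons.
apply: tcoef_cvgM => // {}k; elim: (b j) k => [|m IHm] k.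
  by rewrite expr0; under eq_cvg do rewrite expr0; exact: cvg_cst.
by rewrite exprS; under eq_cvg do rewrite exprS; exact: tcoef_cvgM.
Qed.

Lemma det_cvg m (D : (I -> K) -> 'M[K]_m) (D0 : 'M[K]_m) :
  (forall i j, (D s i j @[s --> near0] --> D0 i j)%classic) ->
  (\det (D s) @[s --> near0] --> \det D0)%classic.
Proof.
move=> H; rewrite /determinant; apply: cvg_big => [|p _]; first exact: add_continuous.
apply: cvgM; first exact: cvg_cst.
by apply: cvg_big => [|i _]; [exact: mul_continuous|exact: H].
Qed.

End Near.

Section Slices.
Variable K : numFieldType.
Hypothesis Kc : geometrically_complete K.
Hypothesis Ka : half_archimedean K.
Variable I : finType.
Local Notation KF := (cps K (I + 'I_1)%type).
Local Notation Kt := (cps K 'I_1).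
Implicit Types (F G : KF) (s : I -> K).

(** The coefficient of t^b, as a series in the parameters. *)
Definition slice F (b : mono 'I_1) : mono I -> K := fun a => F (mjoin a b).

Lemma mjoinP (a : mono I) (b : mono 'I_1) : mleft (mjoin a b) = a /\ mright (mjoin a b) = b.
Proof. by split; apply/ffunP => i; rewrite !ffunE. Qed.

Lemma mjoinK (c : mono (I + 'I_1)%type) : mjoin (mleft c) (mright c) = c.
Proof. by apply/ffunP => -[i|j]; rewrite !ffunE. Qed.

Lemma mdeg_join (a : mono I) (b : mono 'I_1) : mdeg (mjoin a b) = (mdeg a + mdeg b)%N.
Proof.
rewrite /mdeg big_sumType /=; congr addn; apply: eq_bigr => i _; rewrite !ffunE //.
Qed.

Lemma wnorm_le_slice F rho M b : 0 < rho -> wnorm_le F rho M -> wnorm_le (slice F b) rho (M / rho ^+ mdeg b).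
Proof.
move=> r0 H N; rewrite ler_pdivlMr ?exprn_gt0 // mulr_suml.
have us : uniq [seq mjoin a b | a <- box I N].
  rewrite map_inj_uniq ?box_uniq // => a a' e.
  by rewrite -(mjoinP a b).1 e (mjoinP a' b).1.
apply: le_trans (wnorm_le_seq (ltW r0) H us); rewrite [leRHS]big_map.
by apply: ler_sum => a _; rewrite -mulrA -exprD mdeg_join.
Qed.

Lemma slice0M F G : slice (F * G) (mono0 _) = conv (slice F (mono0 _)) (slice G (mono0 _)).
Proof.
apply/funext => a; rewrite /slice scoefM /conv.
rewrite (perm_big [seq mjoin c (mono0 'I_1) | c <- below a]) /=.
  rewrite big_map; apply: eq_bigr => c _; congr (_ * coef G _).
  by apply/ffunP => -[i|j]; rewrite !ffunE.
apply: uniq_perm; rewrite ?below_uniq //.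
  rewrite map_inj_uniq ?below_uniq // => c c' e.
  by rewrite -(mjoinP c (mono0 _)).1 e (mjoinP c' (mono0 _)).1.
move=> c; rewrite mem_below; apply/mleP/mapP => [h|[d]].
  exists (mleft c).
    by rewrite mem_below; apply/mleP => i; have := h (inl i); rewrite !ffunE.
  rewrite -{1}[c]mjoinK; congr mjoin; apply/ffunP => j.
  by have := h (inr j); rewrite !ffunE leqn0 => /eqP.
rewrite mem_below => /mleP h -> [i|j]; rewrite !ffunE //; exact: h.
Qed.

Lemma slice0_incl (g : cps K I) : slice (Defs.incl 'I_1 g) (mono0 _) = g.
Proof.
by apply/funext => a; rewrite /slice /= /incl_fun (mjoinP a _).1 (mjoinP a _).2 eqxx.
Qed.

Lemma slice0_tM G : slice (cvar K (inr ord0) * G) (mono0 _) = 0.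
Proof.
apply/funext => a; rewrite /slice coef_cmonoM; case: mleP => // /(_ (inr ord0)).
by rewrite !ffunE eqxx.
Qed.

(** Total version of the specialization: it is 0 when the specialized series
    diverges, which does not happen for s close to 0. *)
Definition fibre F s : Kt := insubd (0 : Kt) (specialize F s).

Lemma specializeE F s b : specialize F s b = peval (slice F b) s.
Proof. by []. Qed.

Lemma fibre_val F rho M s : 0 < rho -> wnorm_le F rho M -> (forall i, `|s i| <= 2%:R^-1 * rho) ->
  (fibre F s : mono 'I_1 -> K) = specialize F s.
Proof.
move=> r0 FM sP; rewrite /fibre -[LHS]/(val _) insubdK //.
apply: (@geom_bound_convergent _ _ (2%:R * M) rho^-1).
  by rewrite invr_ge0 ltW.
move=> k; rewrite specializeE exprVn -mulrA.
have := peval_le Kc Ka r0 (wnorm_le_slice (tmono k) r0 FM) _ (lexx _) sP; rewrite mdeg_tmono; apply.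
by rewrite invr_ge0 ler0n.
Qed.

Lemma near_fibre_val F : \forall s \near @near0 K I, (fibre F s : mono 'I_1 -> K) = specialize F s.
Proof.
have [rho [M [r0 FM]]] := convergent_wnorm F.
have h0 : 0 < 2%:R^-1 * rho by rewrite mulr_gt0 // invr_gt0 ltr0n.
by apply: filterS (near0_small I h0) => s; exact: fibre_val.
Qed.

Lemma peval_slice_cvg F b : (peval (slice F b) s @[s --> @near0 K I] --> F (mjoin (mono0 I) b))%classic.
Proof.
have [rho [M0 [r0 FM]]] := convergent_wnorm F.
have sM := wnorm_le_slice b r0 FM; set M := M0 / _ in sM.
have M_ge0 := wnorm_le_ge0 (ltW r0) sM.
apply/cvgrPdist_le => e e0.
have Me : 0 < M + e by rewrite ltr_wpDl.
(* This th satisfies th <= 1/2 and M * th <= e. *)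
pose th := 2%:R^-1 * (e / (M + e)).
have hp : 0 < 2%:R^-1 :> K by rewrite invr_gt0 ltr0n.
have th0 : 0 < th by rewrite mulr_gt0 // divr_gt0.
have h1 : 2%:R^-1 <= 1 :> K by rewrite invf_le1 ?ltr0n // ler1n.
have th1 : th <= 2%:R^-1.
  by rewrite ler_piMr ?(ltW hp) // ler_pdivrMr // mul1r lerDr.
have tr : 0 < th * rho by rewrite mulr_gt0.
apply: filterS (near0_small I tr) => s sP; rewrite distrC.
apply: le_trans (peval_near0 Kc Ka r0 sM (ltW th0) th1 sP) _.
apply: (@le_trans _ _ (M * (e / (M + e)))).
  by rewrite ler_wpM2l // ler_piMl // divr_ge0 ?ltW.
by rewrite mulrCA ler_piMr ?(ltW e0) // ler_pdivrMr // mul1r lerDl ltW.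
Qed.

Lemma fibre_cvg F (f0 : Kt) : (f0 : mono 'I_1 -> K) = specialize F (fun=> 0) ->
  @tcoef_cvg K I (fibre F) f0.
Proof.
move=> f0E k.
have -> : tcoef f0 k = F (mjoin (mono0 I) (tmono k)).
  rewrite /tcoef f0E specializeE peval0 //.
  have [rho [M [r0 FM]]] := convergent_wnorm F; apply/asboolP.
  by exists rho, (M / rho ^+ mdeg (tmono k)); split=> //; exact: wnorm_le_slice.
apply: cvg_trans (peval_slice_cvg (b := tmono k)).
apply: near_eq_cvg; apply: filterS (near_fibre_val F) => s sE.
by rewrite /tcoef sE.
Qed.

(** The constant term in t of F is a combination of the equations g l, and
    evaluation at s is multiplicative. *)
Lemma fibre_const0 F G (T : finType) (h : T -> KF) (g : T -> cps K I) :
  F = cvar K (inr ord0) * G + \sum_l h l * Defs.incl 'I_1 (g l) ->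
  \forall s \near @near0 K I, (forall l, peval (g l) s = 0) -> tcoef (fibre F s) 0 = 0.
Proof.
move=> FE.
have [rho [M [r0 HM]]] := wnorm_le_common (fun x : bool * T => if x.1 then h x.2 else Defs.incl 'I_1 (g x.2)).
have h0 : 0 < 2%:R^-1 * rho by rewrite mulr_gt0 // invr_gt0 ltr0n.
apply: filterS2 (near0_small I h0) (near_fibre_val F) => s sP sE g0.
have -> : tcoef (fibre F s) 0 = peval (slice F (mono0 _)) s by rewrite -tcoef_mono0 sE.
have -> : slice F (mono0 _) = \sum_l conv (slice (h l) (mono0 _)) (g l).
  transitivity (slice (\sum_l h l * Defs.incl 'I_1 (g l)) (mono0 _)).
    apply/funext => a; rewrite /slice FE scoefD.
    by rewrite -/(slice (cvar K (inr ord0) * G) (mono0 _) a) slice0_tM add0r.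
  apply: (big_ind2 (fun (v : KF) (u : mono I -> K) => slice v (mono0 _) = u)) => //.
    by move=> v u v' u' <- <-.
  by move=> l _; rewrite slice0M slice0_incl.
suff [C [C1 ->]] : exists C, wnorm_le (\sum_l conv (slice (h l) (mono0 _)) (g l)) rho C /\
    peval (\sum_l conv (slice (h l) (mono0 _)) (g l)) s = 0 by [].
apply: (big_ind (fun u => exists C, wnorm_le u rho C /\ peval u s = 0)).
- exists 0; split; last exact: (peval_0 Ka).
  by move=> N; rewrite big1 // => a _; rewrite /= normr0 mul0r.
- move=> u v [C [uC u0]] [D [vD v0]]; exists (C + D); split.
    move=> N; apply: le_trans (lerD (uC N) (vD N)); rewrite -big_split /=.
    apply: ler_sum => a _; rewrite -mulrDl ler_wpM2r ?exprn_ge0 ?(ltW r0) //.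
    exact: ler_normD.
  by rewrite (pevalD Kc Ka r0 sP uC vD) u0 v0 addr0.
move=> l _.
have H1 := wnorm_le_slice (mono0 _) r0 (HM (true, l)).
have H2 := wnorm_le_slice (mono0 _) r0 (HM (false, l)).
rewrite /= slice0_incl in H2; rewrite /= in H1.
exists (M / rho ^+ mdeg (mono0 'I_1) * (M / rho ^+ mdeg (mono0 'I_1))).
split; first exact: (wnorm_le_conv (ltW r0) H1 H2).
by rewrite (pevalM Kc Ka r0 sP H1 H2) g0 mulr0.
Qed.

End Slices.

(** * Upper semicontinuity of the codimension *)

Section Semicontinuity.
Variable K : numFieldType.
Hypothesis Kc : geometrically_complete K.
Hypothesis Ka : half_archimedean K.
Variables (I : finType) (n r : nat).
Local Notation KF := (cps K (I + 'I_1)%type).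
Local Notation Kt := (cps K 'I_1).
Local Notation B := {ffun 'I_r.+1 -> Kt}.
Variable F : 'I_n -> 'I_r.+1 -> KF.
Variable phi0 : {lrmorphism cps K 'I_n -> B}.
Hypothesis phi0E : forall i j, (phi0 (cvar K i) j : mono 'I_1 -> K) = specialize (F i j) (fun=> 0).
Hypothesis x0 : forall i j, tcoef (phi0 (cvar K i) j) 0 = 0.
Hypothesis xneq0 : forall j, exists i, phi0 (cvar K i) j <> 0.

(** phi is the member of the family at s, and s is such that the constant terms
    vanish. *)
Definition specializes_to (phi : {lrmorphism cps K 'I_n -> B}) (s : I -> K) :=
  forall i j, phi (cvar K i) j = fibre (F i j) s /\ tcoef (fibre (F i j) s) 0 = 0.

(** The coefficient that gives a coordinate of phi0 its order stays nonzero near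
    0, so orders can only drop. *)
Lemma near_adapted : exists E, \forall s \near @near0 K I,
  forall phi, specializes_to phi s -> adapted phi E.
Proof.
have H j : exists p : 'I_n * nat, has_order (phi0 (cvar K p.1) j) p.2.
  by have [i /has_order_ex[e ve]] := xneq0 j; exists (i, e).
have [p pP] := choice H.
exists (\sum_j (p j).2)%N.
have nz : \forall s \near @near0 K I, forall j, tcoef (fibre (F (p j).1 j) s) (p j).2 != 0.
  apply: filter_forall => j; apply: (cvgr_neq0 _ (fibre_cvg Kc Ka (phi0E (p j).1 j) (k := (p j).2))).
  by apply/eqP; case: (pP j).
apply: filterS nz => s sP phi ph; split=> [i j|j].
  by have [-> ->] := ph i j.
have [pE c0] := ph (p j).1 j.
have f0 : phi (cvar K (p j).1) j <> 0.
  by move=> f0; have /eqP[] := sP j; rewrite -pE f0.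
have [e ve] := has_order_ex f0; exists (p j).1, e; split=> //; apply/andP; split.
  by rewrite lt0n; apply/eqP => e0; case: ve => _; rewrite e0 pE c0.
apply: (@leq_trans (p j).2); last by rewrite (bigD1 j) //= leq_addr.
rewrite leqNgt; apply/negP => le; have /order_geP/(_ _ le) z := proj1 ve.
by have := sP j; rewrite -pE z eqxx.
Qed.

(** The coefficient of t_j^k in phi(g) for the member phi of the family at s, as
    a function of s defined everywhere. *)
Definition coef_at (g : cps K 'I_n) (s : I -> K) j k : K :=
  \sum_(b <- box 'I_n k.+1) g b * tcoef (mpower (fun i => fibre (F i j) s) b) k.

Lemma coef_atE phi s g j k : specializes_to phi s -> tcoef (phi g j) k = coef_at g s j k.
Proof.
move=> ph; rewrite /tcoef -/(branch phi j g) (@morph_coef _ _ _ _ k.+1) ?mdeg_tmono //; last first.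
  by move=> i; have [pE c0] := ph i j; rewrite tcoef_mono0 -[RHS]c0 -pE.
apply: eq_bigr => b _; congr (_ * coef (mpower _ b) _); apply/funext => i.
by have [<- _] := ph i j.
Qed.

Lemma coef_at_cvg g j k : (coef_at g s j k @[s --> @near0 K I] --> tcoef (phi0 g j) k)%classic.
Proof.
have -> : tcoef (phi0 g j) k = \sum_(b <- box 'I_n k.+1) g b * tcoef (mpower (fun i => phi0 (cvar K i) j) b) k.
  rewrite /tcoef -/(branch phi0 j g) (@morph_coef _ _ _ _ k.+1) ?mdeg_tmono //.
  by move=> i; rewrite tcoef_mono0 [tcoef _ _]x0.
apply: cvg_big => [|b _]; first exact: add_continuous.
apply: cvgM; first exact: cvg_cst.
by apply: tcoef_cvg_mpower => i; apply: (fibre_cvg Kc Ka).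
Qed.

(** The matrix D s holds the coefficients of degree < N of the vectors obtained
    by replacing phi0 with phi in an expression of the monomials t_j^k; it is
    the identity at s = 0. *)
Lemma near_spanned d (e : 'I_d -> B) :
  (forall b, exists (c : 'I_d -> K) g, b - \sum_i c i *: e i = phi0 g) ->
  \forall s \near @near0 K I, forall phi, specializes_to phi s ->
    exists2 k, (forall b, in_tpow k b -> exists g, b = phi g) &
     forall b, exists (c : 'I_d -> K) g, b - \sum_i c i *: e i = phi g.
Proof.
move=> span; have [E nE] := near_adapted; pose N := (E * d.+1)%N.
pose T : finType := ('I_r.+1 * 'I_N)%type.
pose mon_at (t : 'I_r.+1 * 'I_N) : B := [ffun j => if j == t.1 then cvar K ord0 ^+ t.2 else 0].
have H (t : 'I_r.+1 * 'I_N) : exists cg : ('I_d -> K) * cps K 'I_n,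
    mon_at t = \sum_i cg.1 i *: e i + phi0 cg.2.
  by have [c [g h]] := span (mon_at t); exists (c, g); rewrite -h addrC subrK.
have [cg cgP] := choice H.
pose tv (i : 'I_#|T|) : 'I_r.+1 * 'I_N := @enum_val T T i.
pose D s : 'M[K]_#|T| := \matrix_(a, b)
   (tcoef ((\sum_i (cg (tv a)).1 i *: e i) (tv b).1) (tv b).2 + coef_at (cg (tv a)).2 s (tv b).1 (tv b).2).
have Dcvg : (\det (D s) @[s --> @near0 K I] --> \det (1%:M : 'M[K]_#|T|))%classic.
  apply: det_cvg => a b; under eq_cvg do rewrite mxE.
  have -> : (1%:M : 'M[K]_#|T|) a b = tcoef ((\sum_i (cg (tv a)).1 i *: e i) (tv b).1) (tv b).2
      + tcoef (phi0 (cg (tv a)).2 (tv b).1) (tv b).2.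
    transitivity (tcoef (mon_at (tv a) (tv b).1) (tv b).2).
      rewrite mxE ffunE -(inj_eq (@enum_val_inj T T)) -/(tv a) -/(tv b) eq_sym.
      case: (tv a) (tv b) => [j k] [j' k'] /=; rewrite xpair_eqE; case: eqP => _ //=.
      by rewrite tcoef_Xn.
    by rewrite cgP ffunE.
  by apply: cvgD; [exact: cvg_cst|exact: coef_at_cvg].
rewrite det1 in Dcvg.
apply: filterS2 nE (cvgr_neq0 (1 : K) Dcvg (oner_neq0 K)) => s ad Dn phi ph.
have {}ad := ad phi ph.
have approx b : exists (c : 'I_d -> K) g, in_tpow N (b - \sum_i c i *: e i - phi g).
  (* Solve for the coefficients of degree < N of b with the matrix D s. *)
  pose beta : 'rV[K]_#|T| := \row_a tcoef (b (tv a).1) (tv a).2.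
  pose y := beta *m invmx (D s).
  have yD : y *m D s = beta by rewrite mulmxKV // unitmxE unitfE.
  exists (fun i => \sum_a y 0 a * (cg (tv a)).1 i), (\sum_a y 0 a *: (cg (tv a)).2).
  have -> : b - \sum_i (\sum_a y 0 a * (cg (tv a)).1 i) *: e i - phi (\sum_a y 0 a *: (cg (tv a)).2)
     = b - \sum_a y 0 a *: (\sum_i (cg (tv a)).1 i *: e i + phi (cg (tv a)).2).
    rewrite -addrA -opprD; congr (_ - _).
    rewrite rmorph_sum /= (eq_bigr (fun i => \sum_a y 0 a *: ((cg (tv a)).1 i *: e i))).
      rewrite exchange_big -big_split; apply: eq_bigr => a _ /=.
      by rewrite scalerDr scaler_sumr linearZ.
    by move=> i _; rewrite scaler_suml; apply: eq_bigr => a _; rewrite scalerA.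
  move=> j; apply/order_geP => k kN; pose l : 'I_#|T| := enum_rank ((j, Ordinal kN) : T).
  have tl : tv l = (j, Ordinal kN) by rewrite /tv enum_rankK.
  have := congr1 (fun v : 'rV_ _ => v 0 l) yD; rewrite /beta !mxE tl /= => yDl.
  rewrite !ffunE tcoefB -yDl sum_ffunE tcoef_sum; apply/eqP; rewrite subr_eq0; apply/eqP.
  apply: eq_bigr => a _; rewrite !mxE ffunE tcoefZ ffunE tcoefD tl /=.
  by rewrite (coef_atE _ _ _ ph).
have [k kN kP] := conductor_of_approx ad (leqnn N) approx.
exists k => // b; have [c [g gP]] := approx b.
have [g' g'E] : exists g', b - \sum_i c i *: e i - phi g = phi g'.
  by apply: kP => j; apply: order_ge_le (gP j).
by exists c, (g' + g); rewrite rmorphD /= -g'E subrK.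
Qed.

End Semicontinuity.

(** * Deformations of a primitive parameterization *)

(** A series whose class is divisible by t is a multiple of t plus a combination
    of the equations of S. *)
Lemma piS_eq_decomp (K : numFieldType) (S : germ K) (F : cps K ('I_(gdim S) + 'I_1)%type)
    (g : OSx S 'I_1) : piS F = piS (cvar K (inr ord0)) * g ->
  exists G (h : 'I_(gnum S) -> cps K ('I_(gdim S) + 'I_1)%type),
    F = cvar K (inr ord0) * G + \sum_l h l * Defs.incl 'I_1 (geqn l).
Proof.
move=> FE; pose G := repr g; exists G.
have : F - cvar K (inr ord0) * G \in @gideal K S 'I_1.
  rewrite Quotient.idealrBE; apply/eqP; rewrite rmorphM /=.
  by rewrite /G reprK -[RHS]FE.
by move=> /asboolP[h hE]; exists h; rewrite -hE addrC subrK.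
Qed.

Theorem proposition25 (R : realType) (S : germ R[i]) (n r : nat)
  (phiS : {rmorphism OSx S 'I_n -> {ffun 'I_r.+1 -> OSx S 'I_1}})
  (phiS_alg : OS_algebra_morphism phiS)
  (phiS_t : forall i j, exists g : OSx S 'I_1,
     phiS (piS (cvar _ (inr i))) j = piS (cvar _ (inr ord0)) * g)
  (F : 'I_n -> 'I_r.+1 -> cps R[i] ('I_(gdim S) + 'I_1)%type)
  (F_lift : forall i j, phiS (piS (cvar _ (inr i))) j = piS (F i j))
  (phi0 : {lrmorphism cps R[i] 'I_n -> {ffun 'I_r.+1 -> cps R[i] 'I_1}})
  (phi0_ind : induced_at F (fun=> 0) phi0)
  (phi0_param : parameterization phi0)
  (phi0_prim : primitive phi0) :
  exists eps : R[i], 0 < eps /\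
  forall s : 'I_(gdim S) -> R[i], gpoint s -> (forall k, `|s k| < eps) ->
  exists phi : {lrmorphism cps R[i] 'I_n -> {ffun 'I_r.+1 -> cps R[i] 'I_1}},
  [/\ induced_at F s phi,
      reduced_curve_singularity (OC phi) r.+1
    & exists d d0 : nat,
      [/\ quotient_dim (fun c (v : {ffun 'I_r.+1 -> cps R[i] 'I_1}) => c *: v)
            (fun=> True) (fun v => exists g, v = phi g) d,
          delta_eq (scalarC phi) d,
          delta_eq (scalarC phi0) d0
        & (d <= d0)%N]].
Proof.
have Kc := @complex_complete R; have Ka := @complex_half_archi R.
have [p1 p2 p3] := phi0_param.
have x0 i j : tcoef (phi0 (cvar _ i) j) 0 = 0 by rewrite -tcoef_mono0 p1.
have [N condN] := param_conductor phi0_param phi0_prim.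
have [d1 [e1 span1]] := finite_codim condN.
have [d0 _ qd0] := spanned_codim span1.
have delta0 := (curve_ring_of_conductor x0 condN).2 d0 qd0.
have [e [_ eP]] := qd0.
have span b : exists (c : 'I_d0 -> R[i]) g, b - \sum_i c i *: e i = phi0 g.
  by have [c [[g gE] _]] := eP b Logic.I; exists (c 0), g.
have near1 := near_spanned Kc Ka phi0_ind x0 p2 span.
have near2 : \forall s \near @near0 R[i] 'I_(gdim S), forall i j,
    (fibre (F i j) s : mono 'I_1 -> R[i]) = specialize (F i j) s.
  by apply: filter_forall => i; apply: filter_forall => j; apply: near_fibre_val.
have near3 : \forall s \near @near0 R[i] 'I_(gdim S), forall i j,
    gpoint s -> tcoef (fibre (F i j) s) 0 = 0.
  apply: filter_forall => i; apply: filter_forall => j.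
  have [g gE] := phiS_t i j; rewrite F_lift in gE.
  have [G [h FE]] := piS_eq_decomp gE.
  exact: (fibre_const0 Kc Ka FE).
have [eps [eps0 epsP]] := near0P (filterI near1 (filterI near2 near3)).
exists eps; split=> // s sS s_eps.
have [n1 [n2 n3]] := epsP s s_eps.
have Hp (j : 'I_r.+1) : exists p : {lrmorphism cps R[i] 'I_n -> cps R[i] 'I_1},
    forall i, p (cvar _ i) = fibre (F i j) s.
  by apply: subst_exists => i; rewrite tcoef_mono0 n3.
have [p pP] := choice Hp.
pose phi : {lrmorphism cps R[i] 'I_n -> {ffun 'I_r.+1 -> cps R[i] 'I_1}} :=
  [the {lrmorphism cps R[i] 'I_n -> {ffun 'I_r.+1 -> cps R[i] 'I_1}} of bundle p].
have phiE i j : phi (cvar _ i) j = fibre (F i j) s by rewrite /= bundleE pP.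
have ph : specializes_to F phi s by move=> i j; split; [exact: phiE|exact: n3].
have [k cond spank] := n1 phi ph.
have x0' i j : tcoef (phi (cvar _ i) j) 0 = 0 by rewrite phiE n3.
have [curve delta] := curve_ring_of_conductor x0' cond.
have [d dd0 qd] := spanned_codim spank.
exists phi; split=> //; first by move=> i j; rewrite phiE n2.
by exists d, d0; split=> //; apply: delta.
Qed.
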